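(* Let $(G_n)_{n\in\mathbb N}$, $G_n=(V_n,E_n)$, be a sequence of finite random simple graphs that locally converges to the unimodular Galton–Watson tree $\mathcal T(P,\rho)$, where the degree distribution $P$ has finite second moment $\sum_k k^2P_k<\infty$ (equivalently $\overline\rho=\sum_k k\rho_k<\infty$). Then almost surely, for all $x>0$, $$\varepsilon_{G_n}(x):= x\frac{\partial}{\partial x}\frac{\log Z_{G_n}(x)}{|V_n|}=\frac{1}{|V_n|}\sum_{v\in V_n}\mathcal R_x(G_n,v)\xrightarrow[n\to\infty]{}\mathbb E[Y(x)],$$ and the function $x\mapsto\mathbb E[Y(x)]$ is analytic on $(0,\infty)$. Here $Y(x)\overset{\mathcal D}{=}\frac{x^2}{x^2+\sum_{i=1}^\Delta X_i}$, where $\Delta\sim P$ is independent of $(X_i)_{i\in\mathbb N}$, the $X_i$ are i.i.d. copies of $X$, and the distribution of $X$ is the unique solution supported in $[0,1]$ of $X\overset{\mathcal D}{=}\frac{x^2}{x^2+\sum_{i=1}^K X_i}$ with $K\sim\rho$ independent of $(X_i)_{i\in\mathbb N}$.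
   Context: Monomer-dimer model: for a finite simple graph $G=(V,E)$ and $x>0$, $Z_G(x)=\sum_D x^{|V|-2|D|}$ over all matchings $D\subseteq E$, $\mu_{G,x}(D)=x^{|V|-2|D|}/Z_G(x)$, and $\mathcal R_x(G,o)$ is the $\mu_{G,x}$-probability that $o$ is not covered by an edge of $D$. $[G,v]_r$ is the subgraph induced by vertices at distance $\le r$ from $v$. Galton–Watson tree $\mathcal T(P,\rho)$ rooted at $o$: the root has $\Delta\sim P$ children, each further vertex has an independent $\rho$-distributed number of children; $\mathcal T(P,\rho,r)$ is the subtree of the first $r$ generations. It is unimodular if $0<\overline P:=\sum_k kP_k<\infty$ and $\rho_k=(k+1)P_{k+1}/\overline P$ for all $k$. The random graphs $G_n$ are defined on a common probability space; $(G_n)$ locally converges to $\mathcal T(P,\rho)$ if for every $r\in\mathbb N$ and every finite rooted tree $(T,o)$ with at most $r$ generations, $\frac{1}{|V_n|}\sum_{v\in V_n}\mathbb 1\big(([G_n,v]_r,v)\cong(T,o)\big)\to\mathbb P\big((\mathcal T(P,\rho,r),o)\cong(T,o)\big)$ almost surely, where $\cong$ is isomorphism of rooted graphs. *)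

(* Defs.v *)
From HB Require Import structures.
From mathcomp Require Import all_boot all_order all_algebra.
From mathcomp Require Import finmap.
From mathcomp Require Import all_classical all_reals all_analysis.
Unset Printing Implicit Defensive.
Import Order.TTheory GRing.Theory Num.Theory.
Import numFieldNormedType.Exports.
Local Open Scope classical_set_scope.
Local Open Scope ring_scope.

Record simple_graph := FGraph {
  nv : nat;
  adj : rel 'I_nv;
  adj_sym : symmetric adj;
  adj_irr : irreflexive adj }.
Arguments adj {_}.

Definition rooted_iso {A B : Type} (VA : A -> Prop) (adjA : A -> A -> bool) (ra : A)
  (VB : B -> Prop) (adjB : B -> B -> bool) (rb : B) : Prop :=
  exists f : A -> B,
    [/\ forall a, VA a -> VB (f a),
        forall a a', VA a -> VA a' -> f a = f a' -> a = a',
        forall b, VB b -> exists2 a, VA a & f a = b,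
        f ra = rb &
        forall a a', VA a -> VA a' -> adjA a a' = adjB (f a) (f a')].

Definition ball_step {G : simple_graph} (S : {set 'I_(nv G)}) : {set 'I_(nv G)} :=
  S :|: [set w | [exists u in S, adj u w]]%SET.
Definition gball {G : simple_graph} (v : 'I_(nv G)) (r : nat) : {set 'I_(nv G)} :=
  iter r (@ball_step G) [set v]%SET.

(** * Finite rooted (plane) trees in Ulam--Harris form: a finite set of words,
    root = [::], parent of (rcons u i) = u, children of u labelled 0..k-1. *)
Definition word := seq nat.

Definition is_ptree (t : {fset word}) : Prop :=
  [::] \in t /\
  forall (u : word) (i : nat), rcons u i \in t ->
    u \in t /\ forall j, (j < i)%N -> rcons u j \in t.

Definition tadj (u w : word) : bool :=
  ((size w == (size u).+1) && (take (size u) w == u)) ||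
  ((size u == (size w).+1) && (take (size w) u == w)).

Definition height_le (t : {fset word}) (r : nat) : Prop :=
  forall w, w \in t -> (size w <= r)%N.

Definition nchild (t : {fset word}) (u : word) : nat :=
  count (fun w : word => (size w == (size u).+1) && (take (size u) w == u))
        (enum_fset t).

(** Law of the (plane, Ulam--Harris) Galton--Watson tree T(P,rho) truncated to its
    first r generations: probability that the truncation equals the plane tree t
    (of height <= r): product over vertices of depth < r of the offspring
    probability (P at the root, rho elsewhere). *)
Definition gw_weight {R : realType} (P rho : nat -> R) (r : nat) (t : {fset word}) : R :=
  \prod_(u <- enum_fset t | (size u < r)%N) (if u == [::] then P else rho) (nchild t u).

Definition gw_prob {R : realType} (P rho : nat -> R) (r : nat) (T : {fset word}) : \bar R :=
  \esum_(t in [set t : {fset word} | [/\ is_ptree t, height_le t r &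
             rooted_iso (fun w => w \in t) tadj [::] (fun w => w \in T) tadj [::]]])
     (gw_weight P rho r t)%:E.

Definition loc_freq {R : realType} (G : simple_graph) (r : nat) (T : {fset word}) : R :=
  (#|[set v : 'I_(nv G) |
       `[< rooted_iso (fun x => x \in gball v r) (@adj G) v
                      (fun w => w \in T) tadj [::] >] ]|)%:R / (nv G)%:R.

(** a matching: a set of edges {u,v} (stored as (u,v) with u < v), pairwise disjoint *)
Definition is_matching {G : simple_graph} (D : {set 'I_(nv G) * 'I_(nv G)}) : bool :=
  [forall e in D, (e.1 < e.2)%N && adj e.1 e.2] &&
  [forall e in D, forall e' in D, (e != e') ==>
     [&& e.1 != e'.1, e.1 != e'.2, e.2 != e'.1 & e.2 != e'.2]].

Definition covers {G : simple_graph} (D : {set 'I_(nv G) * 'I_(nv G)}) (v : 'I_(nv G)) : bool :=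
  [exists e in D, (e.1 == v) || (e.2 == v)].

Definition mdZ {R : realType} (G : simple_graph) (x : R) : R :=
  \sum_(D : {set 'I_(nv G) * 'I_(nv G)} | is_matching D) x ^+ (nv G - 2 * #|D|).

Definition mdR {R : realType} (G : simple_graph) (x : R) (o : 'I_(nv G)) : R :=
  (\sum_(D : {set 'I_(nv G) * 'I_(nv G)} | is_matching D && ~~ covers D o)
       x ^+ (nv G - 2 * #|D|)) / mdZ G x.

Definition mean_R {R : realType} (G : simple_graph) (x : R) : R :=
  (\sum_(v : 'I_(nv G)) mdR G x v) / (nv G)%:R.

(** k-fold iterated integral against mu: E[F(X_1,...,X_k)] with X_i iid ~ mu *)
Fixpoint iint {R : realType} (mu : probability R R) (k : nat) (F : seq R -> \bar R)
  : \bar R :=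
  match k with
  | 0 => F [::]
  | k'.+1 => (\int[mu]_y iint mu k' (fun s => F (y :: s)))%E
  end.

(** Law of  x^2 / (x^2 + sum_{i=1}^K X_i),  K ~ offs independent of X_i iid ~ mu,
    evaluated at the set A. *)
Definition rde_rhs {R : realType} (offs : nat -> R) (x : R) (mu : probability R R)
  (A : set R) : \bar R :=
  (\sum_(k <oo) ((offs k)%:E *
     iint mu k (fun s => (\1_A (x ^+ 2 / (x ^+ 2 + \sum_(y <- s) y)))%:E)))%E.

Definition is_rde_sol {R : realType} (rho : nat -> R) (x : R) (mu : probability R R)
  : Prop :=
  mu [set y : R | 0 <= y <= 1] = 1%E /\
  forall A : set R, measurable A -> mu A = rde_rhs rho x mu A.

Definition EY {R : realType} (P : nat -> R) (x : R) (mu : probability R R) : \bar R :=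
  (\sum_(k <oo) ((P k)%:E *
     iint mu k (fun s => (x ^+ 2 / (x ^+ 2 + \sum_(y <- s) y))%:E)))%E.

Definition real_analytic_on {R : realType} (U : set R) (f : R -> R) : Prop :=
  forall a, U a -> exists2 r : R, 0 < r &
    exists c : nat -> R, forall y, `|y - a| < r ->
      (fun N => \sum_(n < N) c n * (y - a) ^+ n) @ \oo --> f y.

(* Main.v *)
Require Import Defs.
From HB Require Import structures.
From mathcomp Require Import all_boot all_order all_algebra.
From mathcomp Require Import finmap.
From mathcomp Require Import all_classical all_reals all_analysis.
From mathcomp Require Import complex measurable_realfun ring lra.
Set Implicit Arguments.
Unset Strict Implicit.
Import Order.TTheory GRing.Theory Num.Theory.
Import numFieldNormedType.Exports.
Local Open Scope ring_scope.

(** The cavity recursion expresses the monomer probability of a vertex as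
    [x^2 / (x^2 + S)], [S] being the sum of the monomer probabilities of its
    neighbours once the vertex is deleted.  Unrolling it along self-avoiding
    walks and truncating at depth [r] gives upper bounds for even [r] and lower
    bounds for odd [r]; these only see the ball of radius [r], so local
    convergence identifies the limits of their averages with the expectations
    of the same truncated recursion on the Galton--Watson tree.  The truncated
    laws are monotone for the stochastic order along even and along odd depths.
    That both limits agree follows from unimodularity: the expected probability
    that the root is covered equals [Pbar] times the expectation of a function
    symmetric in the two messages along an edge, one of even and one of odd
    depth.  Hence the odd and even limits have the same [E[Y]], and a strictly
    monotone functional that agrees on two ordered laws forces them to be equal.

    For analyticity, Heilmann--Lieb shows that the zeros of [Z_G] lie in the
    closed left half-plane, so [mean_R G] has at [a > 0] a Taylor series whose
    truncation at order [M] has error at most [2 (|h|/a)^M] uniformly in [G];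
    this survives pointwise limits. *)

(** * Partition functions of induced subgraphs *)

Section matchings.
Context {G : simple_graph}.
Local Notation V := 'I_(nv G).
Local Open Scope set_scope.
Implicit Types (D : {set V * V}) (S : {set V}) (o v w : V) (e : V * V).

(** The recursion reverses the stochastic order and is not shown to contract, so the two limits are
    compared quantitatively. Write [m r] for the mean of the depth-[r] law. Unimodularity bounds the
    gap in [E[Y]] between depths [2j+1] and [2j] by a constant times [m (2j) - m (2j+2)], a
    difference of consecutive terms of a monotone bounded sequence; strict monotonicity bounds the
    same gap below by a positive constant times [m (2j) - m (2j+1)]. Hence [m (2j) - m (2j+1)] tends
    to 0, and for ordered laws the defect of means controls every Lipschitz test function. The limit
    law itself is built as an infimum of distribution functions.

    On the graph side lower bounds suffice: for a nonnegative local functional, finitely many trees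
    already bound its average over the vertices from below. Applied to the truncated monomer
    probability and to its complement to 1, this gives both inequalities. The argument is
    deterministic once countably many frequencies converge, so one null set serves all [x], and one
    good realisation of the graphs yields analyticity. *)

Definition cov D : {set V} := [set v | covers D v].

Definition uedge o v : V * V := if (o < v)%N then (o, v) else (v, o).

Lemma uedgeC o v : uedge o v = uedge v o.
Proof.
rewrite /uedge; case: ltngtP => // /val_inj ->; by [].
Qed.

Lemma covP D v : reflect (exists2 e, e \in D & (e.1 == v) || (e.2 == v)) (v \in cov D).
Proof. rewrite inE; exact: exists_inP. Qed.

Lemma matching_edge D e : is_matching D -> e \in D -> (e.1 < e.2)%N /\ adj e.1 e.2.
Proof. by case/andP => /forall_inP H _ /H/andP[]. Qed.

Lemma matching_disj D e e' v : is_matching D -> e \in D -> e' \in D ->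
  (e.1 == v) || (e.2 == v) -> (e'.1 == v) || (e'.2 == v) -> e = e'.
Proof.
case/andP => _ /forall_inP H eD e'D ev e'v; apply/eqP; apply/negPn/negP => ne.
have /forall_inP/(_ _ e'D) := H _ eD; rewrite ne /= => /and4P[].
by case/orP: ev => /eqP ->; case/orP: e'v => /eqP ->; rewrite eqxx.
Qed.

Lemma matching_sub D D' : is_matching D -> D' \subset D -> is_matching D'.
Proof.
move=> mD /fintype.subsetP sD; have [/forall_inP H1 /forall_inP H2] := andP mD.
apply/andP; split; apply/forall_inP => e eD; first exact/H1/sD.
by apply/forall_inP => e' e'D; have /forall_inP := H2 e (sD _ eD); apply; exact: sD.
Qed.

Lemma adj_neq o v : adj o v -> o != v.
Proof. by apply: contraTneq => ->; rewrite (@adj_irr G). Qed.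

Lemma uedge_ends o v w : ((uedge o v).1 == w) || ((uedge o v).2 == w) = (w \in [set o; v]).
Proof.
by rewrite !inE /uedge; case: ifP => _ /=; rewrite ![_ == w]eq_sym ?[(w == v) || _]orbC.
Qed.

Lemma cov_uedge o v D : cov (uedge o v |: D) = [set o; v] :|: cov D.
Proof.
apply/setP => w; rewrite [RHS]inE -uedge_ends; apply/covP/orP.
  move=> [e]; rewrite in_setU1 => /orP[/eqP ->|eD ew]; first by left.
  by right; apply/covP; exists e.
case=> [?|/covP[e eD ew]]; first by exists (uedge o v) => //; rewrite finset.setU11.
by exists e => //; rewrite setU1r.
Qed.

Lemma matching_uedge o v D : is_matching D -> adj o v -> o \notin cov D -> v \notin cov D ->
  is_matching (uedge o v |: D).
Proof.
move=> mD ov oD vD; have [/forall_inP H1 /forall_inP H2] := andP mD.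
have ne := adj_neq ov.
have dis e w : e \in D -> w \in [set o; v] -> (e.1 != w) && (e.2 != w).
  move=> eD; rewrite !inE -negb_or => /orP[] /eqP ->.
    by apply: contra oD => ew; apply/covP; exists e.
  by apply: contra vD => ew; apply/covP; exists e.
have u1 : (uedge o v).1 \in [set o; v] by rewrite -uedge_ends eqxx.
have u2 : (uedge o v).2 \in [set o; v] by rewrite -uedge_ends eqxx orbT.
apply/andP; split; apply/forall_inP => e; rewrite in_setU1 => /orP[/eqP ->|eD].
- rewrite /uedge; case: ifP => ltov /=; first by rewrite ltov.
  by rewrite (@adj_sym G) ov andbT ltn_neqAle leqNgt ltov andbT eq_sym.
- exact: H1.
- apply/forall_inP => e'; rewrite in_setU1 => /orP[/eqP ->|e'D]; first by rewrite eqxx.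
  apply/implyP => _; have /andP[a1 a2] := dis _ _ e'D u1; have /andP[b1 b2] := dis _ _ e'D u2.
  by rewrite ![(uedge o v).1 == _]eq_sym ![(uedge o v).2 == _]eq_sym; apply/and4P.
- apply/forall_inP => e'; rewrite in_setU1 => /orP[/eqP ->|e'D].
    apply/implyP => _; have /andP[a1 a2] := dis _ _ eD u1; have /andP[b1 b2] := dis _ _ eD u2.
    by apply/and4P.
  by have /forall_inP := H2 _ eD; apply.
Qed.

Lemma matching_covered D o : is_matching D -> o \in cov D ->
  exists2 v, adj o v & uedge o v \in D.
Proof.
move=> mD /covP[[a b] eD /=]; have [/= ab adab] := matching_edge mD eD.
case/orP => /eqP E; [exists b|exists a]; rewrite -?E //.
- by rewrite /uedge ab.
- by rewrite (@adj_sym G).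
- by rewrite uedgeC /uedge ab.
Qed.

Lemma matching_partner D o v w : is_matching D -> uedge o v \in D -> uedge o w \in D -> v = w.
Proof.
move=> mD vD wD; have : uedge o v = uedge o w.
  by apply: (matching_disj (v := o) mD vD wD); rewrite uedge_ends !inE eqxx.
move=> E; have : w \in [set o; v] by rewrite -uedge_ends E uedge_ends !inE eqxx orbT.
rewrite !inE => /orP[] /eqP wo; last by [].
have : v \in [set o; w] by rewrite -uedge_ends -E uedge_ends !inE eqxx orbT.
by rewrite wo !inE orbb => /eqP.
Qed.

Lemma cov_rem D o v : is_matching D -> uedge o v \in D ->
  cov (D :\ uedge o v) = cov D :\: [set o; v].
Proof.
move=> mD ovD; apply/setP => w; rewrite [RHS]inE -uedge_ends; apply/covP/andP.
  move=> [e]; rewrite in_setD1 => /andP[ne eD] ew; split; last by apply/covP; exists e.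
  by apply: contra ne => ow; rewrite (matching_disj mD eD ovD ew ow).
move=> [nw /covP[e eD ew]]; exists e => //; rewrite in_setD1 eD andbT.
by apply: contra nw => /eqP <-.
Qed.

Lemma card_cov D : is_matching D -> #|cov D| = (2 * #|D|)%N.
Proof.
(* [f (e, b)] is the endpoint of [e] selected by [b]; it is injective on [D] because edges are
   disjoint and have distinct ends. *)
move=> mD; pose f (p : (V * V) * bool) := if p.2 then p.1.1 else p.1.2.
have -> : cov D = f @: finset.setX D [set: bool].
  apply/setP => w; apply/covP/imsetP.
    move=> [e eD /orP[] /eqP <-]; [exists (e, true)|exists (e, false)]; by rewrite ?finset.in_setX /= ?eD ?finset.in_setT.
  move=> [[e b]]; rewrite finset.in_setX /= => /andP[eD _] ->; exists e => //.
  by case: b; rewrite /f/= eqxx ?orbT.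
rewrite card_in_imset; first by rewrite cardsX cardsT card_bool mulnC.
move=> [e b] [e' b']; rewrite !finset.in_setX /= => /andP[eD _] /andP[e'D _] E.
have ee' : e = e'.
  apply: (matching_disj (v := f (e, b)) mD eD e'D); last rewrite E.
    by case: b {E} => /=; rewrite eqxx ?orbT.
  by case: b' {E} => /=; rewrite eqxx ?orbT.
move: E; rewrite -ee'; have [/= lt _] := matching_edge mD eD.
by case: b; case: b' => //= E; rewrite /f/= in E; rewrite E ltnn in lt.
Qed.

Section partition_function.
Variables (K : comNzRingType) (x : K).

(** The partition function of the subgraph induced on [S], written with matchings of the whole graph
    so that deleting vertices does not change the type. The ring is arbitrary because real and
    complex activities and the polynomial variable ['X] all occur. *)
Definition Zsub S : K :=
  (\sum_(D : {set V * V} | is_matching D && (cov D \subset S)) x ^+ #|S :\: cov D|)%R.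

Lemma Zsub_not_cov S o : o \in S ->
  (\sum_(D : {set V * V} | is_matching D && (cov D \subset S) && (o \notin cov D)) x ^+ #|S :\: cov D|
   = x * Zsub (S :\ o))%R.
Proof.
move=> oS; rewrite /Zsub big_distrr/=; apply: eq_big.
  by move=> D; rewrite subsetD1 andbA.
move=> D /andP[_ oD]; rewrite -exprS; congr (_ ^+ _)%R.
rewrite (cardsD1 o) inE oD oS add1n; congr (_.+1); apply: eq_card => w.
by rewrite !inE andbCA.
Qed.

(** Either [o] is a monomer, or it is matched to a neighbour [v]; removing the edge between them
    leaves an arbitrary matching of [S] without [o] and [v]. *)
Lemma Zsub_rec S o : o \in S ->
  (Zsub S = x * Zsub (S :\ o) + \sum_(v in S :\ o | adj o v) Zsub (S :\ o :\ v))%R.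
Proof.
move=> oS; rewrite [LHS](bigID (fun D => o \notin cov D))/= Zsub_not_cov//; congr (_ + _)%R.
(* The partner of [o] in [D]; the default [o] is never taken when [o] is covered. *)
pose pt D := odflt o [pick v | uedge o v \in D].
rewrite (partition_big pt (fun v => (v \in S :\ o) && adj o v)); last first.
  move=> D /andP[/andP[mD sD] /negPn oD]; have [v ov vD] := matching_covered mD oD.
  rewrite /pt; case: pickP => [w wD|/(_ v)]; last by rewrite vD.
  rewrite /= (matching_partner mD wD vD) ov andbT in_setD1 eq_sym adj_neq//.
  apply: (fintype.subsetP sD); apply/covP; exists (uedge o v) => //.
  by rewrite uedge_ends !inE eqxx orbT.
apply: eq_bigr => v /andP[vS ov]; rewrite /Zsub.
rewrite (reindex_onto (fun D => uedge o v |: D) (fun D => D :\ uedge o v)); last first.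
  move=> D /andP[/andP[/andP[mD sD] /negPn oD] /eqP pD].
  apply: finset.setD1K; move: pD; rewrite /pt; case: pickP => [w wD /= <-//|H].
  by have [w ow wD] := matching_covered mD oD; rewrite H in wD.
have vo : v != o by rewrite eq_sym adj_neq.
have sub2 D : (cov D \subset S :\ o :\ v) = [&& cov D \subset S, o \notin cov D & v \notin cov D].
  by rewrite !subsetD1 andbA.
have vSS : v \in S by move: vS; rewrite in_setD1 => /andP[].
apply: eq_big => D.
  rewrite sub2; apply/idP/idP.
    move=> /andP[/andP[/andP[/andP[mD sD] _] _] /eqP E].
    have ovD : uedge o v \notin D by rewrite -E finset.setD11.
    have mD' : is_matching D by apply: matching_sub mD _; rewrite subsetU1.
    rewrite mD'/=; have C := cov_rem mD (finset.setU11 _ _); rewrite E in C.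
    rewrite C !finset.in_setD !inE !eqxx/= orbT/= andbT.
    by apply: fintype.subset_trans sD; rewrite finset.subsetDl.
  move=> /andP[mD /and3P[sD oD vD]].
  have ovD : uedge o v \notin D.
    by apply: contra oD => ovD; apply/covP; exists (uedge o v) => //; rewrite uedge_ends !inE eqxx.
  have mU := matching_uedge mD ov oD vD.
  rewrite mU cov_uedge finset.subUset sD andbT !inE eqxx/= finset.subUset !finset.sub1set oS vSS/=.
  rewrite finset.setU1K// eqxx andbT; apply/eqP; rewrite /pt; case: pickP => [w wD|/(_ v)].
    by rewrite (matching_partner mU wD (finset.setU11 _ _)).
  by rewrite finset.setU11.
move=> _; congr (_ ^+ _)%R; apply: eq_card => w; rewrite cov_uedge !inE negb_or.
by case: (w == o); case: (w == v); case: (covers D w); case: (w \in S).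
Qed.

Lemma Zsub0 : Zsub finset.set0 = 1%R.
Proof.
rewrite /Zsub (big_pred1 finset.set0) ?finset.set0D ?cards0//.
move=> D; rewrite finset.subset0; apply/idP/eqP => [/andP[mD /eqP cD]|->].
  have := card_cov mD; rewrite cD cards0 => /esym/eqP.
  by rewrite muln_eq0/= cards_eq0 => /eqP.
apply/andP; split; last by apply/eqP/setP => w; rewrite !inE; apply/negbTE/exists_inP => -[e]; rewrite inE.
by apply/andP; split; apply/forall_inP => e; rewrite inE.
Qed.

End partition_function.

End matchings.

Lemma mdZ_Zsub (R : realType) (G : simple_graph) (x : R) :
  mdZ G x = Zsub x ([set: 'I_(nv G)]%SET).
Proof.
apply: eq_big => D; first by rewrite finset.subsetT andbT.
move=> mD; rewrite -card_cov// cardsD cardsT card_ord finset.setTI; congr (_ ^+ _).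
Qed.

Lemma mdR_Zsub (R : realType) (G : simple_graph) (x : R) (o : 'I_(nv G)) :
  mdR G x o = x * Zsub x ([set: 'I_(nv G)] :\ o)%SET / Zsub x [set: 'I_(nv G)]%SET.
Proof.
rewrite /mdR mdZ_Zsub -Zsub_not_cov ?inE//; congr (_ / _).
apply: eq_big => D; first by rewrite finset.subsetT andbT inE.
move=> /andP[mD _]; rewrite -card_cov// cardsD cardsT card_ord finset.setTI; congr (_ ^+ _).
Qed.

(** * Monomer probabilities at positive activity *)

Section positive_activity.
Context {R : realType} {G : simple_graph}.
Local Notation V := 'I_(nv G).
Local Open Scope set_scope.
Implicit Types (S : {set V}) (o v : V) (x : R).

Lemma Zsub_gt0 x S : (0 < x -> 0 < Zsub x S)%R.
Proof.
move=> x0; rewrite /Zsub (bigD1 finset.set0)/=; last first.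
  apply/andP; split; last first.
    by apply/fintype.subsetP => w /covP[e]; rewrite inE.
  by apply/andP; split; apply/forall_inP => e; rewrite inE.
rewrite ltr_wpDr ?exprn_gt0//; apply: sumr_ge0 => D _.
by rewrite exprn_ge0// ltW.
Qed.

(** For [o] in [S], the monomer probability of [o] in the subgraph induced on [S]. *)
Definition Rsub x S o : R := (x * Zsub x (S :\ o) / Zsub x S)%R.

Lemma Rsub_rec x S o : (0 < x)%R -> o \in S ->
  (Rsub x S o = x ^+ 2 / (x ^+ 2 + \sum_(v in S :\ o | adj o v) Rsub x (S :\ o) v))%R.
Proof.
move=> x0 oS; rewrite /Rsub (Zsub_rec _ oS) -mulr_suml -mulr_sumr.
set A := Zsub x (S :\ o); set B := (\sum_(v in _ | _) _)%R.
have A0 : (0 < A)%R by exact: Zsub_gt0.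
have B0 : (0 <= B)%R by apply: sumr_ge0 => v _; exact/ltW/Zsub_gt0.
field; apply/and3P; split; rewrite gt_eqF//.
- by rewrite ltr_wpDr ?mulr_gt0// mulr_ge0// ltW.
- by rewrite ltr_wpDr// mulr_gt0.
Qed.

Lemma Rsub_bounds x S o : (0 < x)%R -> o \in S -> (0 <= Rsub x S o <= 1)%R.
Proof.
move=> x0 oS; apply/andP; split.
  by rewrite /Rsub divr_ge0 ?mulr_ge0 ?(ltW x0) ?(ltW (Zsub_gt0 _ x0)).
rewrite /Rsub ler_pdivrMr ?Zsub_gt0// mul1r (Zsub_rec _ oS) lerDl.
by apply: sumr_ge0 => v _; exact/ltW/Zsub_gt0.
Qed.

End positive_activity.

Section derivative.
Context {G : simple_graph}.
Local Notation V := 'I_(nv G).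
Variable K : comNzRingType.

Lemma horner_Zsub (S : {set V}) (x : K) : (Zsub ('X : {poly K}) S).[x] = Zsub x S.
Proof.
by rewrite /Zsub horner_sum; apply: eq_bigr => D _; rewrite hornerXn.
Qed.

Lemma size_Zsub (S : {set V}) : (size (Zsub ('X : {poly K}) S) <= #|S|.+1)%N.
Proof.
apply: (leq_trans (size_sum _ _ _)); apply/bigmax_leqP => D _.
by rewrite size_polyXn ltnS subset_leq_card// finset.subsetDl.
Qed.

(** Differentiating ['X^k] marks one of the [k] monomers; exchanging the two sums deletes the marked
    vertex. *)
Lemma deriv_Zsub (S : {set V}) :
  (Zsub ('X : {poly K}) S)^`() = \sum_(v in S) Zsub 'X (S :\ v)%SET.
Proof.
rewrite /Zsub raddf_sum.
under [RHS]eq_bigr => v vS.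
  under eq_bigl do rewrite finset.subsetD1 andbA.
  over.
rewrite (exchange_big_dep (fun D : {set V * V} => is_matching D && (cov D \subset S)))/=; last first.
  by move=> v D _ /andP[].
apply: eq_bigr => D /andP[mD sD]; rewrite derivXn.
rewrite (eq_bigl (fun v => v \in S :\: cov D)%SET); last first.
  by move=> v; rewrite mD sD /= finset.in_setD andbC.
rewrite (eq_bigr (fun=> 'X^(#|S :\: cov D|.-1)%SET)); last first.
  move=> v vS; congr ('X^_); rewrite [in RHS](cardsD1 v) vS /=.
  by apply: eq_card => w; rewrite !inE andbCA.
by rewrite sumr_const.
Qed.

End derivative.

Lemma derive_ln_mdZ (R : realType) (G : simple_graph) (x : R) : 0 < x ->
  x * derive1 (fun y => ln (mdZ G y) / (nv G)%:R) x = mean_R G x.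
Proof.
move=> x0; pose p : {poly R} := Zsub 'X [set: 'I_(nv G)]%SET.
have pE y : mdZ G y = p.[y] by rewrite mdZ_Zsub horner_Zsub.
have px0 : 0 < p.[x] by rewrite horner_Zsub Zsub_gt0.
have D1 : is_derive x 1 (@ln R \o horner p) (p.[x]^-1 * p^`().[x]).
  by apply: is_derive1_comp; exact: is_derive1_ln.
have -> : derive1 (fun y => ln (mdZ G y) / (nv G)%:R) x = (nv G)%:R^-1 * (p.[x]^-1 * p^`().[x]).
  rewrite derive1E (_ : (fun y => _) = (nv G)%:R^-1 \*: (@ln R \o horner p)); last first.
    by apply/funext => y /=; rewrite pE mulrC.
  by apply: derive_val.
have -> : p^`().[x] = \sum_v Zsub x ([set: 'I_(nv G)] :\ v)%SET.
  rewrite deriv_Zsub horner_sum; apply: eq_big => v; first by rewrite inE.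
  by rewrite horner_Zsub.
rewrite /mean_R; under [in RHS]eq_bigr do rewrite mdR_Zsub.
rewrite -mulr_suml -mulr_sumr -[Zsub x [set: _]%SET]horner_Zsub -/p.
ring.
Qed.

(** * The Heilmann--Lieb theorem and analyticity *)

Section heilmann_lieb.
Context {R : realType} {G : simple_graph}.
Local Notation V := 'I_(nv G).
Local Notation C := R[i].
Implicit Types (S : {set V}) (o v : V) (z w : C).

Lemma Re_add z w : complex.Re (z + w) = complex.Re z + complex.Re w.
Proof. by case: z; case: w. Qed.

Lemma Re_sum (I : Type) (s : seq I) (Q : pred I) (F : I -> C) :
  complex.Re (\sum_(i <- s | Q i) F i) = \sum_(i <- s | Q i) complex.Re (F i).
Proof. by elim/big_rec2: _ => // i a b _ <-; rewrite Re_add. Qed.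

Lemma Re_inv_gt0 z : 0 < complex.Re z -> 0 < complex.Re z^-1.
Proof.
case: z => a b /= a0; rewrite divr_gt0//.
by rewrite ltr_pwDl ?sqr_ge0// exprn_gt0.
Qed.

Lemma Re_gt0_neq0 z : 0 < complex.Re z -> z != 0.
Proof. by apply: contraTneq => ->; rewrite ltxx. Qed.

(** By [Zsub_rec] the ratio equals [z] plus a sum of inverses of ratios for smaller sets, and the
    open right half-plane is stable under addition and inversion. A nonzero ratio in turn makes
    [Zsub z S] nonzero. *)
Lemma Zsub_ratio z S : 0 < complex.Re z -> Zsub z S != 0 /\
  forall o, o \in S -> 0 < complex.Re (Zsub z S / Zsub z (S :\ o)%SET).
Proof.
move=> z0; have [n] := ubnP #|S|; elim: n S => // n IH S; rewrite ltnS => Sn.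
have ratio o : o \in S -> 0 < complex.Re (Zsub z S / Zsub z (S :\ o)%SET).
  move=> oS; have So : (#|S :\ o| < n)%N%SET.
    by move: Sn; rewrite (cardsD1 o) oS.
  have [nz H] := IH _ So; rewrite (Zsub_rec _ oS) mulrDl mulfK// Re_add ltr_pwDl//.
  rewrite mulr_suml Re_sum; apply: sumr_ge0 => v /andP[vS _].
  rewrite -[Zsub z (_ :\ v)%SET / _]invf_div; exact/ltW/Re_inv_gt0/H.
split=> //; have [->| [u oS]] := set_0Vmem S; first by rewrite Zsub0 oner_neq0.
have := Re_gt0_neq0 (ratio u oS); apply: contra => /eqP ->; by rewrite mul0r.
Qed.

Lemma Zsub_morph (K K' : comNzRingType) (f : {rmorphism K -> K'}) (x : K) S :
  Zsub (f x) S = f (Zsub x S).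
Proof. by rewrite /Zsub rmorph_sum; apply: eq_bigr => D _; rewrite rmorphXn. Qed.

Lemma horner_prod_log (K : fieldType) (r : seq K) (x : K) :
  (forall t, t \in r -> x != t) ->
  (\prod_(t <- r) ('X - t%:P))^`().[x] =
  (\prod_(t <- r) ('X - t%:P)).[x] * \sum_(t <- r) (x - t)^-1.
Proof.
elim: r => [|t r IH] xr; first by rewrite !big_nil derivC hornerC mulr0.
rewrite !big_cons derivM derivB derivX derivC subr0 mul1r hornerD !hornerM.
rewrite IH; last by move=> s sr; apply: xr; rewrite inE sr orbT.
have xt : x - t != 0 by rewrite subr_eq0 xr// inE eqxx.
rewrite hornerXsubC; move: (_.[x]) (\sum_(_ <- _) _) => A B; by field.
Qed.

(** Partial fractions of the logarithmic derivative [x p'(x) / p(x)], which is the sum of the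
    monomer probabilities. The bound on the number of roots is what makes later estimates uniform in
    the graph after division by [nv G]. *)
Lemma mean_R_roots : exists r : seq C, [/\ (size r <= nv G)%N,
  forall t, t \in r -> complex.Re t <= 0 &
  forall x : R, 0 < x ->
   (real_complex R (mean_R G x)) =
     (nv G)%:R^-1 * \sum_(t <- r) (real_complex R x) / (real_complex R x - t)].
Proof.
pose p : {poly C} := Zsub 'X [set: V]%SET.
have [r] := closed_field_poly_normal p; set l := lead_coef p => pE.
have pz z : 0 < complex.Re z -> p.[z] != 0.
  by move=> z0; rewrite horner_Zsub; case: (Zsub_ratio [set: V]%SET z0).
have p0 : p != 0.
  have := pz 1; rewrite /= ltr01 => /(_ isT); apply: contra => /eqP ->.
  by rewrite hornerC.
have l0 : l != 0 by rewrite lead_coef_eq0.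
have rneg t : t \in r -> complex.Re t <= 0.
  move=> tr; rewrite leNgt; apply/negP => /pz; rewrite pE hornerZ mulf_eq0 negb_or l0/=.
  by rewrite -rootE root_prod_XsubC tr.
exists r; split => //.
  have := size_Zsub C [set: V]%SET; rewrite -/p pE size_scale// size_prod_XsubC.
  by rewrite cardsT card_ord ltnS.
move=> x x0.
have x0' : 0 < complex.Re (real_complex R x) by [].
have pd : p^`().[real_complex R x] / p.[real_complex R x] = \sum_(t <- r) (real_complex R x - t)^-1.
  rewrite pE derivZ !hornerZ horner_prod_log; last first.
    by move=> t /rneg tr; apply: contraTneq tr => <-; rewrite -ltNge.
  have := pz _ x0'; rewrite pE hornerZ mulf_eq0 negb_or => /andP[_ nz].
  by rewrite -mulf_div divff// mul1r mulrAC divff// mul1r.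
rewrite -mulr_sumr -pd /mean_R.
under eq_bigr do rewrite mdR_Zsub.
rewrite -mulr_suml -mulr_sumr.
have dE : p^`().[real_complex R x] = real_complex R (\sum_v Zsub x ([set: V] :\ v)%SET).
  rewrite deriv_Zsub horner_sum rmorph_sum; apply: eq_big => v; first by rewrite inE.
  by rewrite horner_Zsub Zsub_morph.
rewrite dE horner_Zsub Zsub_morph !rmorphM !fmorphV rmorph_nat.
by rewrite [LHS]mulrC !mulrA.
Qed.

End heilmann_lieb.

(** * Taylor expansions with errors uniform in the graph *)

Section power_series.
Context {R : realType}.
Local Notation C := R[i].
Local Notation nc := (@complex.ComplexField.Normc.normc R).
Local Notation rc := (real_complex R).
Implicit Types (z w t : C) (x a h : R).

Lemma nc_ge0 z : 0 <= nc z.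
Proof. by case: z => a b /=; exact: sqrtr_ge0. Qed.

Lemma ncM z w : nc (z * w) = nc z * nc w.
Proof. exact: complex.ComplexField.Normc.normcM. Qed.

Lemma ncV z : nc z^-1 = (nc z)^-1.
Proof. exact: complex.ComplexField.Normc.normcV. Qed.

Lemma nc_rc x : nc (rc x) = `|x|.
Proof. by rewrite /= expr0n addr0 sqrtr_sqr. Qed.

Lemma ncX z n : nc (z ^+ n) = nc z ^+ n.
Proof.
elim: n => [|n IH]; last by rewrite !exprS ncM IH.
by rewrite !expr0 -[1]/(rc 1) nc_rc normr1.
Qed.

Lemma ncD z w : nc (z + w) <= nc z + nc w.
Proof. exact: le_normcD. Qed.

Lemma ncN z : nc (- z) = nc z.
Proof. exact: normcN. Qed.

Lemma nc_sum (I : Type) (s : seq I) (F : I -> C) :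
  nc (\sum_(i <- s) F i) <= \sum_(i <- s) nc (F i).
Proof.
elim: s => [|i s IH]; first by rewrite !big_nil -[0]/(rc 0) nc_rc normr0.
by rewrite !big_cons (le_trans (ncD _ _))// lerD2l.
Qed.

Lemma normr_Re z : `|complex.Re z| <= nc z.
Proof.
by case: z => a b /=; rewrite -sqrtr_sqr ler_wsqrtr// lerDl sqr_ge0.
Qed.

Lemma Re_mul_real x z : complex.Re (rc x * z) = x * complex.Re z.
Proof. by case: z => a b /=; rewrite mul0r subr0. Qed.

Section one_root.
Variables (t : C) (a : R).
Hypotheses (t0 : complex.Re t <= 0) (a0 : 0 < a).

(** The location of the zeros enters here: no zero is closer to [x] than the imaginary axis, so the
    expansion at [a] is controlled on the disc of radius [a]. *)
Lemma nc_sub_ge x : 0 < x -> x <= nc (rc x - t).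
Proof.
move=> x0; apply: le_trans (normr_Re _); rewrite Re_add /=.
case: t t0 => b c /= b0; rewrite ger0_norm ?lerDl ?oppr_ge0//.
by rewrite addr_ge0 ?oppr_ge0// ltW.
Qed.

Lemma sub_neq0 x : 0 < x -> rc x - t != 0.
Proof.
move=> x0; apply/eqP => E; have := nc_sub_ge x0.
by rewrite E -[0]/(rc 0) nc_rc normr0 leNgt x0.
Qed.

(** Origin of the constant 2 in the error bounds: [|t| <= x + |x - t|], and [x <= |x - t|]. *)
Lemma nc_root_le x : 0 < x -> nc t <= 2 * nc (rc x - t).
Proof.
move=> x0; rewrite -[in leLHS](subKr (rc x) t).
apply: le_trans (ncD _ _) _; rewrite ncN nc_rc gtr0_norm//.
by have := nc_sub_ge x0; lra.
Qed.

(** Taylor coefficients at [a] of [y / (y - t) = 1 + t / (y - t)]. *)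
Definition root_coef n : C := (n == 0)%:R + (-1) ^+ n * t / (rc a - t) ^+ n.+1.

Lemma root_series h M : `|h| < a ->
  rc (a + h) / (rc (a + h) - t) - \sum_(n < M.+1) root_coef n * rc h ^+ n =
  t * (- rc h / (rc a - t)) ^+ M.+1 / (rc (a + h) - t).
Proof.
move=> ha; have w0 := sub_neq0 a0.
have ah0 : 0 < a + h by move: ha; rewrite ltr_norml => /andP[]; lra.
have v0 := sub_neq0 ah0; rewrite rmorphD /= in v0 *.
set w := rc a - t in w0 *; set H := rc h in v0 *.
have aE : rc a = w + t by rewrite /w subrK.
have wE : rc a + H - t = w + H by rewrite /w addrAC.
rewrite wE in v0 *; rewrite aE.
have cE n : root_coef n * H ^+ n = (n == 0)%:R + t / w * (- H / w) ^+ n.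
  rewrite /root_coef -/w mulrDl; congr (_ + _); first by case: n => [|n]; rewrite ?mul0r ?mulr1.
  rewrite -[- H]mulN1r !exprMn exprVn exprS invfM; ring.
under eq_bigr do rewrite cE.
elim: M => [|M IH].
  rewrite big_ord_recr big_ord0 /= add0r expr0 mulr1 expr1.
  by field; rewrite w0 v0.
rewrite big_ord_recr opprD addrA IH /= add0r [in RHS]exprSr.
by move: (_ ^+ M.+1) => Q; field; rewrite w0 v0.
Qed.

Lemma nc_root_series h M : `|h| < a ->
  nc (rc (a + h) / (rc (a + h) - t) - \sum_(n < M.+1) root_coef n * rc h ^+ n) <=
  2 * (`|h| / a) ^+ M.+1.
Proof.
move=> ha; rewrite root_series//.
have ah0 : 0 < a + h by move: ha; rewrite ltr_norml => /andP[]; lra.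
have wa := nc_sub_ge a0; have tw := nc_root_le ah0; have va := nc_sub_ge ah0.
rewrite mulrAC ncM ncM ncV ncX ncM ncV ncN nc_rc.
apply: ler_pM; rewrite ?mulr_ge0 ?exprn_ge0 ?mulr_ge0 ?invr_ge0 ?nc_ge0//.
  by rewrite ler_pdivrMr//; exact: lt_le_trans va.
rewrite lerXn2r ?nnegrE ?mulr_ge0 ?invr_ge0 ?nc_ge0 ?(ltW a0)//.
by rewrite ler_wpM2l// lef_pV2 ?posrE//; exact: lt_le_trans wa.
Qed.

End one_root.

Lemma mean_R_series (G : simple_graph) a : 0 < a ->
  exists c : nat -> R, forall h M, `|h| < a ->
      `|mean_R G (a + h) - \sum_(n < M.+1) c n * h ^+ n| <= 2 * (`|h| / a) ^+ M.+1.
Proof.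
move=> a0; have [r [sr rneg rE]] := mean_R_roots (R := R) (G := G).
(* At most [nv G] roots each contribute an error [b]; for the empty graph the inverse is 0 and the
   bound still holds. *)
have N1 (b : R) : 0 <= b -> `|(nv G)%:R^-1| * (\sum_(t <- r) b) <= b.
  move=> b0; rewrite big_const_seq count_predT iter_addr_0 ger0_norm ?invr_ge0//.
  have [->|N0] := posnP (nv G); first by rewrite invr0 mul0r.
  rewrite ler_pdivrMl ?ltr0n// -[b *+ _]mulr_natl ler_wpM2r// ler_nat//.
have rcN : (nv G)%:R^-1 = rc (nv G)%:R^-1 by rewrite fmorphV rmorph_nat.
exists (fun n => complex.Re ((nv G)%:R^-1 * \sum_(t <- r) root_coef t a n)).
move=> h M ha.
have ah0 : 0 < a + h by move: ha; rewrite ltr_norml => /andP[]; lra.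
rewrite -[mean_R _ _]/(complex.Re (rc (mean_R G (a + h)))) rE//.
set A := _ * _.
have -> : \sum_(n < M.+1) complex.Re ((nv G)%:R^-1 * \sum_(t <- r) root_coef t a n) * h ^+ n =
  complex.Re ((nv G)%:R^-1 * \sum_(t <- r) \sum_(n < M.+1) root_coef t a n * rc h ^+ n).
  rewrite exchange_big /= mulr_sumr Re_sum; apply: eq_bigr => n _.
  by rewrite -mulr_suml mulrA [in RHS]mulrC -rmorphXn Re_mul_real mulrC.
rewrite -[complex.Re A - _]/(complex.Re A + - _).
have ReN z : - complex.Re z = complex.Re (- z) by case: z.
rewrite ReN -Re_add /A -mulrBr -sumrB.
apply: le_trans (normr_Re _) _; rewrite ncM rcN nc_rc.
apply: le_trans (N1 _ _); last by rewrite mulr_ge0 ?exprn_ge0 ?divr_ge0 ?(ltW a0).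
rewrite ler_wpM2l//; apply: le_trans (nc_sum _ _) _.
by rewrite big_seq [leRHS]big_seq; apply: ler_sum => t tr; apply: nc_root_series => //; exact: rneg.
Qed.

End power_series.

(** * Pointwise limits of uniformly controlled power series *)

Section limit_of_series.
Local Open Scope classical_set_scope.

Lemma cvg_sum_seq (R : realType) (I : eqType) (l : seq I) (u : I -> nat -> R) (v : I -> R) :
  (forall i, i \in l -> (fun n => u i n) @ \oo --> v i) ->
  (fun n => \sum_(i <- l) u i n) @ \oo --> \sum_(i <- l) v i.
Proof.
elim: l => [|i l IH] uv.
  by rewrite big_nil; under eq_fun do rewrite big_nil; exact: cvg_cst.
rewrite big_cons; under eq_fun do rewrite big_cons.
apply: cvgD; first by apply: uv; rewrite inE eqxx.
by apply: IH => j jl; apply: uv; rewrite inE jl orbT.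
Qed.

Context {R : realType}.
Variables (a : R) (g : nat -> R -> R) (l : R -> R) (c : nat -> nat -> R).
Hypotheses (a0 : 0 < a)
  (gs : forall k h M, `|h| < a ->
     `|g k h - \sum_(n < M.+1) c k n * h ^+ n| <= 2 * (`|h| / a) ^+ M.+1)
  (gl : forall h, `|h| < a -> (fun k => g k h) @ \oo --> l h).

(** Strong induction on [n]: once the lower coefficients converge, so does, for fixed [h], the
    quotient of [g k h] minus its lower terms by [h ^ n]. It differs from [c k n] by an error of
    order [h], uniformly in [k], so a small [h] makes [c _ n] Cauchy. *)
Lemma coef_cvg n : cvg ((fun k => c k n) @ \oo).
Proof.
have [m] := ubnP n; elim: m n => // m IH n; rewrite ltnS => nm.
apply/cauchy_cvgP/cauchyP => /= e e0.
have an0 : 0 < a ^+ n.+1 by rewrite exprn_gt0.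
(* The truncation error [2 (h / a) ^ n.+1] divided by [h ^ n] is [2 h / a ^ n.+1]. *)
have [h h0 [ha he]] : exists2 h, 0 < h & h < a /\ 2 * h / a ^+ n.+1 <= e / 4.
  have e8 : 0 < e / 8 * a ^+ n.+1 by rewrite mulr_gt0// divr_gt0.
  exists (Num.min (a / 2) (e / 8 * a ^+ n.+1)).
    by rewrite lt_min e8 andbT divr_gt0.
  split; first by rewrite gt_min; apply/orP; left; rewrite ltr_pdivrMr// ltr_pMr// ltr1n.
  rewrite ler_pdivrMr//; have : Num.min (a / 2) (e / 8 * a ^+ n.+1) <= e / 8 * a ^+ n.+1.
    by rewrite ge_min lexx orbT.
  by move: (Num.min _ _) => v; lra.
have habs : `|h| < a by rewrite gtr0_norm.
have hn0 : 0 < h ^+ n by rewrite exprn_gt0.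
pose q k := (g k h - \sum_(i < n) c k i * h ^+ i) / h ^+ n.
have cq : cvg (q @ \oo).
  apply/cvg_ex; exists ((l h - \sum_(i < n) limn (fun k => c k i) * h ^+ i) / h ^+ n).
  apply: cvgM; last exact: cvg_cst.
  apply: cvgB; first exact: gl.
  apply: (cvg_sum_seq (u := fun (i : 'I_n) k => c k i * h ^+ i)
    (v := fun i : 'I_n => limn (fun k => c k i) * h ^+ i)) => i _.
  by apply: cvgM; [exact: (IH i (leq_trans (ltn_ord i) nm)) | exact: cvg_cst].
have e4 : 0 < e / 4 by rewrite divr_gt0.
exists (limn q); have /cvgrPdist_lt/(_ _ e4) := cq; apply: filterS => k /=.
rewrite /ball /= => qk.
have H : `|q k - c k n| <= e / 4.
  apply: le_trans he; rewrite -(ler_pM2r hn0) -[X in _ * X](gtr0_norm hn0) -normrM mulrBl.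
  rewrite /q divfK ?gt_eqF//; have := gs k n habs; rewrite big_ord_recr/= opprD addrA.
  move/le_trans; apply; rewrite gtr0_norm// expr_div_n exprS.
  by rewrite le_eqVlt; apply/orP; left; apply/eqP; ring.
rewrite (_ : limn q - c k n = (limn q - q k) + (q k - c k n)); last by ring.
by apply: le_lt_trans (ler_normD _ _) _; lra.
Qed.

Lemma limit_series h : `|h| < a ->
  (fun N => \sum_(n < N) limn (fun k => c k n) * h ^+ n) @ \oo --> l h.
Proof.
move=> ha; set d := fun n => limn (fun k => c k n).
have B M : `|l h - \sum_(n < M.+1) d n * h ^+ n| <= 2 * (`|h| / a) ^+ M.+1.
  have cvk : (fun k => `|g k h - \sum_(n < M.+1) c k n * h ^+ n|) @ \oo -->
      `|l h - \sum_(n < M.+1) d n * h ^+ n|.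
    apply: cvg_norm; apply: cvgB; first exact: gl.
    apply: (cvg_sum_seq (u := fun (n : 'I_M.+1) k => c k n * h ^+ n)
      (v := fun n : 'I_M.+1 => d n * h ^+ n)) => n _.
    by apply: cvgM; [exact: coef_cvg | exact: cvg_cst].
  rewrite -(cvg_lim _ cvk)//; apply: limr_le; first by apply/cvg_ex; eexists; exact: cvk.
  by apply: nearW => k; exact: gs.
rewrite -(cvg_shiftn 1).
apply/cvgrPdist_le => e e0.
have q1 : `| `|h| / a | < 1.
  by rewrite ger0_norm ?divr_ge0 ?(ltW a0)// ltr_pdivrMr// mul1r.
have cg : (fun M => 2 * (`|h| / a) ^+ M.+1) @ \oo --> (0 : R).
  rewrite -(mulr0 2); apply: cvgM; first exact: cvg_cst.
  by have := cvg_expr q1; rewrite -(cvg_shiftS (fun n => (`|h| / a) ^+ n)).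
have /cvgrPdist_le/(_ _ e0) := cg; apply: filterS => M /=.
rewrite sub0r normrN addn1 => H; apply: le_trans (B M) _.
by apply: le_trans (ler_norm _) H.
Qed.

End limit_of_series.

(** * Plane trees and self-avoiding walks *)

Section plane_trees.
Implicit Types (t T : {fset word}) (u w : word) (ts : seq {fset word}).

Lemma downset_size (s : seq nat) : uniq s ->
  (forall i j, i \in s -> (j < i)%N -> j \in s) -> forall i, (i \in s) = (i < size s)%N.
Proof.
move=> us ds i; apply/idP/idP => [si|]; last first.
  move=> isz; apply/negPn/negP => ns.
  have sub : {subset s <= iota 0 i}.
    move=> j sj; rewrite mem_iota add0n /= ltnNge leq_eqVlt; apply/negP => /orP[/eqP E|ij].
      by rewrite E sj in ns.
    by rewrite (ds _ _ sj ij) in ns.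
  by have := uniq_leq_size us sub; rewrite size_iota leqNgt isz.
have sub : {subset iota 0 i.+1 <= s}.
  move=> j; rewrite mem_iota add0n ltnS /= leq_eqVlt => /orP[/eqP ->//|]; exact: ds.
by have := uniq_leq_size (iota_uniq 0 i.+1) sub; rewrite size_iota.
Qed.

Lemma childP u w : reflect (exists i, w = rcons u i)
  ((size w == (size u).+1) && (take (size u) w == u)).
Proof.
apply: (iffP andP) => [[/eqP sw /eqP tw]|[i ->]].
  case/lastP: w sw tw => // w i; rewrite size_rcons => -[sw].
  by rewrite -cats1 take_cat sw ltnn subnn take0 cats0 => <-; exists i; rewrite cats1.
by rewrite size_rcons eqxx -cats1 take_cat ltnn subnn take0 cats0.
Qed.

Lemma mem_child T u i : is_ptree T -> (rcons u i \in T) = (i < nchild T u)%N.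
Proof.
move=> [_ pT]; pose p (w : word) := (size w == (size u).+1) && (take (size u) w == u).
pose s := seq.filter p (enum_fset T).
have us : uniq s by rewrite filter_uniq// fset_uniq.
have sP w : w \in s -> exists2 j, w = rcons u j & rcons u j \in T.
  by rewrite mem_filter => /andP[/childP[j ->] ?]; exists j.
have inj : {in s &, injective (last 0%N)}.
  by move=> _ _ /sP[j -> _] /sP[k -> _]; rewrite !last_rcons => ->.
have memj j : (j \in map (last 0%N) s) = (rcons u j \in T).
  apply/mapP/idP => [[_ /sP[k -> kT]]|jT]; first by rewrite last_rcons => ->.
  exists (rcons u j); last by rewrite last_rcons.
  by rewrite mem_filter jT andbT; apply/childP; exists j.
rewrite -memj /nchild -size_filter -(size_map (last 0%N) s); apply: downset_size.
  by rewrite map_inj_in_uniq.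
by move=> j k; rewrite !memj => /pT[_]; apply.
Qed.

Lemma nchild_unique T u n : is_ptree T ->
  (forall i, (rcons u i \in T) = (i < n)%N) -> nchild T u = n.
Proof.
move=> pT H; apply/eqP; rewrite eqn_leq; apply/andP; split; rewrite leqNgt; apply/negP => lt.
  by have := mem_child u n pT; rewrite H lt ltnn.
by have := mem_child u (nchild T u) pT; rewrite H lt ltnn.
Qed.

(** The plane tree whose root carries the branches [ts], listed branch by branch so that products
    over its vertices factorise. *)
Definition node_seq ts : seq word :=
  [::] :: flatten [seq [seq i :: w | w <- enum_fset (nth fset0 ts i)] | i <- iota 0 (size ts)].

Definition node ts : {fset word} := [fset w in node_seq ts]%fset.

Lemma mem_node ts w : (w \in node ts) =
  if w is i :: w' then (i < size ts)%N && (w' \in nth fset0 ts i) else true.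
Proof.
rewrite in_fset /=; case: w => [|i w]; first by rewrite inE.
rewrite inE /=; apply/flatten_mapP/andP => [[j]|[ij wi]].
  by rewrite mem_iota add0n => jt /mapP[v vj [-> ->]].
by exists i; rewrite ?mem_iota//; apply/mapP; exists w.
Qed.

Lemma uniq_node_seq ts : uniq (node_seq ts).
Proof.
rewrite /node_seq cons_uniq; apply/andP; split.
  by apply/flatten_mapP => -[j _ /mapP[v _]].
elim: (iota 0 (size ts)) (iota_uniq 0 (size ts)) => //= i s IH /andP[ns us].
rewrite cat_uniq map_inj_uniq ?fset_uniq ?IH ?andbT//=; last by move=> a b [].
by apply/hasPn => _ /flatten_mapP[j js /mapP[v _ ->]]; apply/mapP => -[v' _ [ji _]]; rewrite -ji js in ns.
Qed.

Lemma perm_node ts : perm_eq (enum_fset (node ts)) (node_seq ts).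
Proof.
apply: uniq_perm; [exact: fset_uniq | exact: uniq_node_seq|].
by move=> w; rewrite -[LHS]/(w \in node ts) in_fset.
Qed.

Definition all_ptree ts := forall t, t \in ts -> is_ptree t.

Lemma is_ptree_node ts : all_ptree ts -> is_ptree (node ts).
Proof.
move=> pts; split; first by rewrite mem_node.
move=> [|i u] j; rewrite /= mem_node.
  move=> /andP[jt _]; split; first by rewrite mem_node.
  move=> k kj; rewrite mem_node (ltn_trans kj jt)/=.
  by have [] := pts _ (mem_nth fset0 (ltn_trans kj jt)).
move=> /andP[it uT]; have [_ H] := pts _ (mem_nth fset0 it).
have [H1 H2] := H _ _ uT; rewrite mem_node it; split => // k kj.
by rewrite mem_node it H2.
Qed.

Lemma height_node ts r : (forall t, t \in ts -> height_le t r) -> height_le (node ts) r.+1.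
Proof.
move=> hts [|i u] //; rewrite mem_node => /andP[it ut] /=.
by rewrite ltnS; apply: hts ut; exact: mem_nth.
Qed.

Lemma nchild_node_root ts : all_ptree ts -> nchild (node ts) [::] = size ts.
Proof.
move=> pts; apply: nchild_unique; first exact: is_ptree_node.
move=> i; rewrite mem_node /=; case: ltnP => // it /=.
by have [] := pts _ (mem_nth fset0 it).
Qed.

Lemma nchild_node ts i u : all_ptree ts -> (i < size ts)%N ->
  nchild (node ts) (i :: u) = nchild (nth fset0 ts i) u.
Proof.
move=> pts it; apply: nchild_unique; first exact: is_ptree_node.
move=> j; rewrite rcons_cons mem_node it /= mem_child//.
by apply: pts; exact: mem_nth.
Qed.

Lemma node_inj ts ts' : all_ptree ts -> all_ptree ts' -> node ts = node ts' -> ts = ts'.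
Proof.
move=> p p' E.
have sz : size ts = size ts' by rewrite -nchild_node_root// E nchild_node_root.
apply: (@eq_from_nth _ fset0) => // i it; apply/fsetP => w.
have : (i :: w \in node ts) = (i :: w \in node ts') by rewrite E.
by rewrite !mem_node -sz it.
Qed.

(** The branching property. Inside a branch every vertex, including its root, has offspring law
    [rho]; hence [gw_weight rho rho]. *)
Lemma gw_weight_node (R : realType) (P rho : nat -> R) r ts : all_ptree ts ->
  gw_weight P rho r.+1 (node ts) = P (size ts) * \prod_(t <- ts) gw_weight rho rho r t.
Proof.
move=> pts; rewrite /gw_weight (perm_big _ (perm_node ts)) /= big_cons /=.
rewrite nchild_node_root//; congr (_ * _).
rewrite big_flatten big_map /= [RHS](big_nth fset0) /index_iota subn0.
rewrite big_seq [RHS]big_seq; apply: eq_bigr => i; rewrite mem_iota add0n => /= it.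
rewrite big_map; apply: eq_big => u //= _; rewrite nchild_node//.
by case: eqP.
Qed.

Section tree_value.
Variables (R : realType) (c : R).

(** The boundary value 1 is the largest possible monomer probability, which is why even depths
    overestimate and odd depths underestimate. *)
Fixpoint tval r t u : R :=
  if r is r'.+1 then c / (c + \sum_(i < nchild t u) tval r' t (rcons u i)) else 1.

Lemma tval_node_sub r ts i u : all_ptree ts -> (i < size ts)%N ->
  tval r (node ts) (i :: u) = tval r (nth fset0 ts i) u.
Proof.
move=> pts it; elim: r u => //= r IH u; rewrite nchild_node//.
by congr (_ / (_ + _)); apply: eq_bigr => j _; rewrite IH.
Qed.

Lemma tval_node r ts : all_ptree ts ->
  tval r.+1 (node ts) [::] = c / (c + \sum_(t <- ts) tval r t [::]).
Proof.
move=> pts /=; rewrite nchild_node_root//; congr (_ / (_ + _)).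
rewrite [RHS](big_nth fset0) big_mkord; apply: eq_bigr => i _.
by rewrite tval_node_sub.
Qed.

Lemma tval_bounds r t u : 0 < c -> 0 <= tval r t u <= 1.
Proof.
move=> c0; elim: r u => [|r IH] u /=; first by rewrite ler01 lexx.
set S := \sum_(_ < _) _.
have S0 : 0 <= S by apply: sumr_ge0 => i _; case/andP: (IH (rcons u i)).
rewrite divr_ge0 ?addr_ge0 ?(ltW c0)//= ler_pdivrMr ?mul1r ?lerDl//.
by rewrite ltr_wpDr.
Qed.

End tree_value.

Fixpoint lists (A : Type) k (s : seq A) : seq (seq A) :=
  if k is k'.+1 then [seq a :: l | a <- s, l <- lists k' s] else [:: [::]].

Lemma mem_lists (A : eqType) k (s : seq A) l :
  (l \in lists k s) = (size l == k) && all (mem s) l.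
Proof.
elim: k l => [|k IH] l /=; first by rewrite inE; case: l.
apply/allpairsP/idP => [[[a m] /= [aS mS ->]]|].
  by move: mS; rewrite IH => /andP[/eqP sm am]; rewrite /= sm eqxx aS.
by case: l => // a l /= /andP[sl /andP[aS lS]]; exists (a, l); split => //; rewrite IH lS andbT.
Qed.

Lemma uniq_lists (A : eqType) k (s : seq A) : uniq s -> uniq (lists k s).
Proof.
move=> us; elim: k => //= k IH; apply: allpairs_uniq => //.
by move=> [a l] [b m] _ _ /= [-> ->].
Qed.

(** A finite exhaustion, as [N] grows, of the plane trees of height at most [r]: vertices of depth
    below [r] have fewer than [N] children. *)
Fixpoint trees N r : seq {fset word} :=
  if r is r'.+1
  then flatten [seq [seq node ts | ts <- lists k (trees N r')] | k <- iota 0 N]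
  else [:: [fset [::]]%fset].

Lemma trees_ptree N r t : t \in trees N r -> is_ptree t /\ height_le t r.
Proof.
elim: r t => [|r IH] t /=.
  rewrite inE => /eqP ->; split.
    split; first by rewrite inE.
    by move=> u i; rewrite inE => /eqP/(congr1 size); rewrite size_rcons.
  by move=> w; rewrite inE => /eqP ->.
move=> /flatten_mapP[k _ /mapP[ts]]; rewrite mem_lists => /andP[_ /allP H] ->.
split; first by apply: is_ptree_node => s /H /IH[].
by apply: height_node => s /H /IH[].
Qed.

Lemma lists_ptree N r k ts : ts \in lists k (trees N r) -> all_ptree ts /\ size ts = k.
Proof.
rewrite mem_lists => /andP[/eqP sz /allP H]; split => // t /H.
by case/trees_ptree.
Qed.

Lemma uniq_trees N r : uniq (trees N r).
Proof.
elim: r => //= r IH.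
elim: (iota 0 N) (iota_uniq 0 N) => //= k s IHs /andP[ns us].
rewrite cat_uniq IHs// andbT; apply/andP; split.
  rewrite map_inj_in_uniq ?uniq_lists// => ts ts' /lists_ptree[p _] /lists_ptree[p' _].
  exact: node_inj.
apply/hasPn => _ /flatten_mapP[j js /mapP[ts /lists_ptree[p sz] ->]].
apply/mapP => -[ts' /lists_ptree[p' sz'] /(node_inj p p') E].
by move: ns; rewrite -sz' -E sz js.
Qed.

Lemma big_trees (R : realType) N r (F : {fset word} -> R) :
  \sum_(t <- trees N r.+1) F t = \sum_(k < N) \sum_(ts <- lists k (trees N r)) F (node ts).
Proof.
rewrite /= big_flatten big_map -[N in iota 0 N]subn0 -/(index_iota 0 N) big_mkord.
by apply: eq_bigr => k _; rewrite big_map.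
Qed.

Lemma big_lists (R : realType) (A : Type) k (s : seq A) (F : seq A -> R) :
  \sum_(l <- lists k.+1 s) F l = \sum_(a <- s) \sum_(l <- lists k s) F (a :: l).
Proof. by rewrite /= big_flatten big_map; apply: eq_bigr => a _; rewrite big_map. Qed.

End plane_trees.

(** * The recursion along self-avoiding walks *)

Section self_avoiding.
Context {R : realType} (c : R) {A : eqType} (nb : A -> seq A).

(* [p] lists the vertices visited before [a]. *)
Fixpoint saw r (p : seq A) (a : A) : R :=
  if r is r'.+1
  then c / (c + \sum_(b <- nb a | b \notin a :: p) saw r' (a :: p) b) else 1.

Lemma saw_bounds r p a : 0 < c -> 0 <= saw r p a <= 1.
Proof.
move=> c0; elim: r p a => [|r IH] p a /=; first by rewrite ler01 lexx.
set S := \sum_(_ <- _ | _) _.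
have S0 : 0 <= S by apply: sumr_ge0 => b _; case/andP: (IH (a :: p) b).
rewrite divr_ge0 ?addr_ge0 ?(ltW c0)//= ler_pdivrMr ?mul1r ?lerDl//.
by rewrite ltr_wpDr.
Qed.

Variables (VA : A -> Prop) (adjA : A -> A -> bool) (root : A) (r : nat)
  (B : nat -> A -> Prop) (T : {fset word}).
Hypotheses (uniq_nb : forall a, uniq (nb a))
  (B0 : B 0 root)
  (BV : forall k a, (k <= r)%N -> B k a -> VA a)
  (Bnb : forall k a b, (k < r)%N -> B k a -> (b \in nb a) <-> (VA b /\ adjA a b))
  (BS : forall k a b, (k < r)%N -> B k a -> b \in nb a -> B k.+1 b)
  (pT : is_ptree T)
  (iso : rooted_iso VA adjA root (fun w => w \in T) tadj [::]).

(** In a tree a step goes either to a child or back to the parent, and the parent already lies on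
    the walk; so self-avoiding walks from the root are descending paths. [B k] contains the vertices
    reached after [k] steps and records that, for [k < r], all their neighbours belong to [VA]. *)
Lemma saw_tval : saw r [::] root = tval c r T [::].
Proof.
have [f [f1 f2 f3 f4 f5]] := iso.
(* Invariant for a walk at [a] on level [k] with [m] steps left: the visited vertices lie on lower
   levels, and the parent of [f a] is the image of one of them. *)
suff H m k p a : (k + m = r)%N -> B k a -> size (f a) = k ->
    (forall q, q \in p -> VA q /\ (size (f q) < k)%N) ->
    ((0 < k)%N -> exists2 q, q \in p & f q = take k.-1 (f a)) ->
    saw m p a = tval c m T (f a).
  by rewrite -f4; apply: (H r 0%N) => //; rewrite f4.
elim: m k p a => // m IH k p a km Ba sa pV par.
have kr : (k < r)%N by rewrite -km -addSnnS leq_addr.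
have Va : VA a := BV (ltnW kr) Ba.
have child b : b \in nb a -> b \notin a :: p -> exists2 i, f b = rcons (f a) i & f b \in T.
  move=> bn; have [Vb ab] := (Bnb b kr Ba).1 bn.
  rewrite inE negb_or => /andP[ba bp].
  have : tadj (f a) (f b) by rewrite -f5.
  case/orP => [/childP[i fb]|/childP[i fa]]; first by exists i => //; exact: f1.
  have k0 : (0 < k)%N by rewrite -sa fa size_rcons.
  have [q qp fq] := par k0; case/negP: bp.
  suff -> : b = q by [].
  apply: f2 => //; first by case: (pV q qp).
  by rewrite fq -sa fa size_rcons /= -cats1 take_cat ltnn subnn take0 cats0.
rewrite /=; congr (_ / (_ + _)).
rewrite -big_filter; set s := [seq b <- _ | _].
have sP b : b \in s = (b \notin a :: p) && (b \in nb a) by rewrite mem_filter.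
transitivity (\sum_(w <- map f s) tval c m T w).
  rewrite big_map big_seq [RHS]big_seq; apply: eq_bigr => b; rewrite sP => /andP[bp bn].
  have [i fb _] := child b bn bp.
  apply: (IH k.+1); rewrite ?addSnnS//; first exact: BS bn.
  - by rewrite fb size_rcons sa.
  - move=> q; rewrite inE => /orP[/eqP ->|/pV[? ?]]; first by rewrite sa.
    by split => //; exact: ltnW.
  - by move=> _; exists a; rewrite ?inE ?eqxx// fb -sa -cats1 take_cat ltnn subnn take0 cats0.
rewrite -(big_mkord xpredT (fun i => tval c m T (rcons (f a) i))) -(big_map (rcons (f a)) xpredT (tval c m T)).
apply: perm_big; apply: uniq_perm.
- rewrite map_inj_in_uniq ?filter_uniq// => b b'; rewrite !sP => /andP[_ bn] /andP[_ b'n].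
  by apply: f2; [case: ((Bnb b kr Ba).1 bn) | case: ((Bnb b' kr Ba).1 b'n)].
- by rewrite map_inj_uniq ?iota_uniq// => i j /rcons_inj[].
move=> w; apply/mapP/mapP => -[].
  move=> b; rewrite sP => /andP[bp bn] ->; have [i fb fT] := child b bn bp.
  by exists i => //; rewrite mem_index_iota /= -mem_child// -fb.
move=> i; rewrite mem_index_iota /= -mem_child// => iT ->.
have [b Vb fb] := f3 _ iT; exists b => //; rewrite sP.
have bn : b \in nb a.
  apply/(Bnb b kr Ba); split => //; rewrite f5// fb; apply/orP; left.
  by apply/childP; exists i.
rewrite bn andbT inE negb_or; apply/andP; split.
  by apply/eqP => ba; move: fb; rewrite ba => /(congr1 size); rewrite size_rcons => /n_Sn.
by apply/negP => /pV[_]; rewrite fb size_rcons sa ltnNge leqnSn.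
Qed.

End self_avoiding.

(** [tval] is computed from the plane structure, [saw] only from adjacency. Viewing [t] as a graph,
    [saw_tval] applies both to the given isomorphism and to the identity, and both values equal the
    same [saw]. *)
Lemma tval_iso (R : realType) (c : R) (r : nat) (t T : {fset word}) :
  is_ptree t -> is_ptree T ->
  rooted_iso (fun w => w \in t) tadj [::] (fun w => w \in T) tadj [::] ->
  tval c r t [::] = tval c r T [::].
Proof.
move=> pt pT tT.
pose nb u := [seq w <- enum_fset t | tadj u w].
have saw_eq T' : is_ptree T' ->
    rooted_iso (fun w => w \in t) tadj [::] (fun w => w \in T') tadj [::] ->
    saw c nb r [::] [::] = tval c r T' [::].
  move=> pT' iso; apply: (@saw_tval R c _ nb (fun w => w \in t) tadj [::] r
    (fun _ w => w \in t) T') => //.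
  - by move=> u; rewrite filter_uniq// fset_uniq.
  - by case: pt.
  - by move=> k u w _ _; rewrite mem_filter; split => [/andP[]|[-> ->]].
  - by move=> k u w _ _; rewrite mem_filter => /andP[].
rewrite -(saw_eq T)// -(saw_eq t)//.
by exists id; split => // w wt; exists w.
Qed.

Section graph_saw.
Context {R : realType} {G : simple_graph}.
Local Notation V := 'I_(nv G).

Definition nbG (v : V) : seq V := [seq w <- enum V | adj v w].

Lemma mem_nbG v w : (w \in nbG v) = adj v w.
Proof. by rewrite mem_filter mem_enum andbT. Qed.

Lemma gballS (v : V) k a b : a \in gball v k -> adj a b -> b \in gball v k.+1.
Proof.
move=> ak ab; rewrite /gball iterS finset.in_setU; apply/orP; right.
by rewrite inE; apply/existsP; exists a; rewrite ak.
Qed.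

Lemma gball_le (v : V) k r a : (k <= r)%N -> a \in gball v k -> a \in gball v r.
Proof.
move=> /subnK <-; elim: (r - k)%N => // m IH /IH H.
by rewrite addSn /gball iterS finset.in_setU H.
Qed.

Lemma saw_ball (c : R) (v : V) r T : is_ptree T ->
  rooted_iso (fun a => a \in gball v r) (@adj G) v (fun w => w \in T) tadj [::] ->
  saw c nbG r [::] v = tval c r T [::].
Proof.
move=> pT iso; apply: (@saw_tval R c _ nbG (fun a => a \in gball v r) (@adj G) v r
  (fun k a => a \in gball v k) T _ _ _ _ _ pT iso).
- by move=> a; rewrite filter_uniq// enum_uniq.
- by rewrite /gball /= inE.
- by move=> k a kr; exact: gball_le.
- move=> k a b kr ak; rewrite mem_nbG; split => [ab|[]//]; split => //.
  exact: gball_le kr (gballS ak ab).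
- by move=> k a b kr ak; rewrite mem_nbG; exact: gballS.
Qed.

Lemma in_compl (p : seq V) b : b \notin p -> b \in (~: [set a in p])%SET.
Proof. by move=> bp; rewrite finset.in_setC inE. Qed.

(** Avoiding visited vertices is exactly the vertex deletion of [Rsub_rec], and the map [s] to
    [x^2 / (x^2 + s)] is decreasing, so each further level swaps upper and lower bounds, starting
    from the bound 1. *)
Lemma saw_sandwich (x : R) r (p : seq V) o : 0 < x -> o \notin p ->
  if odd r then saw (x ^+ 2) nbG r p o <= Rsub x (~: [set a in p])%SET o
  else Rsub x (~: [set a in p])%SET o <= saw (x ^+ 2) nbG r p o.
Proof.
move=> x0; elim: r p o => [|r IH] p o op.
  by have /andP[] := Rsub_bounds x0 (in_compl op).
have c0 : 0 < x ^+ 2 by rewrite exprn_gt0.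
have oS := in_compl op.
rewrite [in X in if _ then _ else X]Rsub_rec// [in X in if _ then X else _]Rsub_rec//.
have SE : ((~: [set a in p]) :\ o = ~: [set a in o :: p])%SET.
  by apply/setP => a; rewrite !inE negb_or.
have sumE : \sum_(v in ((~: [set a in p]) :\ o)%SET | adj o v) Rsub x ((~: [set a in p]) :\ o)%SET v =
   \sum_(b <- nbG o | b \notin o :: p) Rsub x (~: [set a in o :: p])%SET b.
  rewrite SE /nbG big_filter_cond big_enum_cond; apply: eq_bigl => b.
  by rewrite !inE andbC.
rewrite sumE /=; set S2 := \sum_(_ <- _ | _) _; set S1 := \sum_(_ <- _ | _) _.
have S10 : 0 <= S1.
  by apply: sumr_ge0 => b bp; case/andP: (Rsub_bounds x0 (in_compl bp)).
have S20 : 0 <= S2 by apply: sumr_ge0 => b bp; case/andP: (saw_bounds nbG r (o :: p) b c0).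
have div_le (u v : R) : 0 <= u -> u <= v -> x ^+ 2 / (x ^+ 2 + v) <= x ^+ 2 / (x ^+ 2 + u).
  move=> u0 uv; rewrite ler_pM2l// lef_pV2 ?posrE ?ltr_wpDr ?lerD2l//.
  exact: le_trans uv.
case: (boolP (odd r)) => od /=; apply: div_le => //; apply: ler_sum => b bp.
  by have := IH _ _ bp; rewrite od.
by have := IH _ _ bp; rewrite (negbTE od).
Qed.

Lemma mdR_Rsub (x : R) o : mdR G x o = Rsub x (~: [set a in [::]])%SET o.
Proof.
have -> : (~: [set a : V in [::]] = [set: V])%SET by apply/setP => a; rewrite !inE.
exact: mdR_Zsub.
Qed.

End graph_saw.

(** * Laws on [0, 1] and stochastic order *)

Local Open Scope classical_set_scope.
Local Open Scope ring_scope.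

Section expectation.
Context {d : measure_display} {T : measurableType d} {R : realType}.
Implicit Types (m : probability T R) (f g : T -> R).

Definition bdmeas f := measurable_fun setT f /\ exists M, forall y, `|f y| <= M.

Definition Ex m f : R := \int[m]_y f y.

Lemma bdmeas_integrable m f : bdmeas f -> m.-integrable setT (EFin \o f).
Proof.
move=> [mf [M fM]]; apply: (@le_integrable _ _ _ m setT _ (EFin \o f) (cst M%:E)) => //.
- exact/measurable_EFinP.
- by move=> y _ /=; rewrite lee_fin (le_trans (fM y))// ler_norm.
- exact: finite_measure_integrable_cst.
Qed.

Lemma Ex_EFin m f : bdmeas f -> (\int[m]_y (f y)%:E)%E = (Ex m f)%:E.
Proof.
move=> bf; rewrite /Ex /Rintegral fineK//.
exact/integrable_fin_num/bdmeas_integrable.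
Qed.

Lemma bdmeas_cst c : bdmeas (fun=> c).
Proof. by split; [exact: measurable_cst | exists `|c|]. Qed.

Lemma bdmeasD f g : bdmeas f -> bdmeas g -> bdmeas (fun y => f y + g y).
Proof.
move=> [mf [M fM]] [mg [N gN]]; split; first exact: measurable_funD.
by exists (M + N) => y; rewrite (le_trans (ler_normD _ _))// lerD.
Qed.

Lemma bdmeasZ c f : bdmeas f -> bdmeas (fun y => c * f y).
Proof.
move=> [mf [M fM]]; split; first exact: measurable_funM.
by exists (`|c| * M) => y; rewrite normrM ler_wpM2l.
Qed.

Lemma bdmeasN f : bdmeas f -> bdmeas (fun y => - f y).
Proof.
by move=> /(bdmeasZ (-1)); congr bdmeas; apply/funext => y; rewrite mulN1r.
Qed.

Lemma bdmeasB f g : bdmeas f -> bdmeas g -> bdmeas (fun y => f y - g y).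
Proof. by move=> bf /bdmeasN; exact: bdmeasD. Qed.

Lemma ExD m f g : bdmeas f -> bdmeas g ->
  Ex m (fun y => f y + g y) = Ex m f + Ex m g.
Proof. by move=> bf bg; apply: RintegralD => //; exact: bdmeas_integrable. Qed.

Lemma ExB m f g : bdmeas f -> bdmeas g ->
  Ex m (fun y => f y - g y) = Ex m f - Ex m g.
Proof. by move=> bf bg; apply: RintegralB => //; exact: bdmeas_integrable. Qed.

Lemma ExZ m c f : bdmeas f -> Ex m (fun y => c * f y) = c * Ex m f.
Proof. by move=> bf; apply: RintegralZl => //; exact: bdmeas_integrable. Qed.

Lemma ExN m f : bdmeas f -> Ex m (fun y => - f y) = - Ex m f.
Proof.
move=> bf; rewrite -mulN1r -ExZ//; congr Ex; apply/funext => y.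
by rewrite mulN1r.
Qed.

Lemma Ex_cst m c : Ex m (fun=> c) = c.
Proof.
rewrite /Ex Rintegral_cst//; have -> : fine (m setT) = 1 by rewrite probability_setT.
by rewrite mulr1.
Qed.

Lemma le_Ex m f g : bdmeas f -> bdmeas g -> (forall y, f y <= g y) ->
  Ex m f <= Ex m g.
Proof.
by move=> bf bg fg; apply: le_Rintegral => //; exact: bdmeas_integrable.
Qed.

Lemma Ex_ge0 m f : (forall y, 0 <= f y) -> 0 <= Ex m f.
Proof. by move=> f0; apply: Rintegral_ge0. Qed.

Lemma normr_Ex m f M : bdmeas f -> (forall y, `|f y| <= M) -> `|Ex m f| <= M.
Proof.
move=> bf fM; have := @le_normr_Rintegral _ _ _ m setT f measurableT (bdmeas_integrable m bf).
move/le_trans; apply; rewrite -[leRHS](Ex_cst m); apply: le_Ex => //.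
  case: bf => mf [N fN]; split; first exact: measurableT_comp.
  by exists N => y; rewrite normr_id.
exact: bdmeas_cst.
Qed.

Lemma le_Ex_supp m (D : set T) f g : measurable D -> m D = 1%E ->
  bdmeas f -> bdmeas g -> (forall y, D y -> f y <= g y) -> Ex m f <= Ex m g.
Proof.
move=> mD mD1 bf bg fg.
have DE k : bdmeas k -> Ex m k = \int[m]_(y in D) k y.
  move=> bk; rewrite /Ex /Rintegral; congr fine.
  have mDC : measurable (~` D) by exact: measurableC.
  rewrite (@negligible_integral _ _ _ m setT (~` D) (EFin \o k))//=.
  - by rewrite setTD setCK.
  - exact: bdmeas_integrable.
  - by rewrite [LHS]probability_setC// mD1 subee.
rewrite !DE//; apply: le_Rintegral => //.
- exact: integrableS (bdmeas_integrable m bf).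
- exact: integrableS (bdmeas_integrable m bg).
Qed.

End expectation.

(** * Stochastic order tested on bounded Lipschitz functions *)

Section lipschitz.
Context {R : realType}.
Implicit Types (m n : probability R R) (f g : R -> R).

Definition lipschitzR (L : R) f := forall y z, `|f y - f z| <= L * `|y - z|.

Definition blip f := (exists L, lipschitzR L f) /\ exists M, forall y, `|f y| <= M.

Lemma lipschitzR_continuous L f : lipschitzR L f -> continuous f.
Proof.
move=> Lf y; apply/cvgrPdist_lt => e e0; near=> z.
apply: le_lt_trans (Lf _ _) _.
have L1 : 0 < `|L| + 1 by rewrite ltr_wpDl.
apply: (@le_lt_trans _ _ ((`|L| + 1) * `|y - z|)).
  by rewrite ler_wpM2r// (le_trans (ler_norm _))// lerDl.
rewrite -ltr_pdivlMl//.
by near: z; apply: (@near_ball R R) => //; rewrite mulr_gt0 ?invr_gt0.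
Unshelve. all: by end_near. Qed.

Lemma blip_bdmeas f : blip f -> bdmeas f.
Proof.
move=> [[L Lf] bf]; split => //.
apply: continuous_measurable_fun; exact: lipschitzR_continuous Lf.
Qed.

(** The usual stochastic order, with continuous test functions only: this class is stable under
    composition with the cavity map and under averaging over the other summands. [st_le_dfn] and
    [dfn_st_le] relate it to distribution functions. *)
Definition st_le m n := forall f, blip f -> {homo f : y z / y <= z} -> Ex m f <= Ex n f.

Lemma blipN f : blip f -> blip (fun y => - f y).
Proof.
move=> [[L Lf] [M fM]]; split; last by exists M => y; rewrite normrN.
by exists L => y z; rewrite -opprD normrN.
Qed.

Lemma st_le_anti m n f : st_le m n -> blip f -> {homo f : y z /~ y <= z} ->
  Ex n f <= Ex m f.
Proof.
move=> mn bf df; rewrite -lerN2 -!ExN; try exact: blip_bdmeas.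
by apply: mn; [exact: blipN | move=> y z yz; rewrite lerN2 df].
Qed.

Lemma st_le_refl m : st_le m m.
Proof. by move=> f. Qed.

Lemma st_le_trans m n k : st_le m n -> st_le n k -> st_le m k.
Proof. by move=> mn nk f bf df; apply: le_trans (mn f bf df) (nk f bf df). Qed.

End lipschitz.

Section iterated_integral.
Context {R : realType}.
Local Open Scope ereal_scope.

Lemma measurable_integral_param (d' : measure_display) (T' : measurableType d')
    (m : probability R R) (H : T' * R -> \bar R) :
  measurable_fun setT H -> measurable_fun setT (fun t => \int[m]_y H (t, y)).
Proof.
move=> mH.
rewrite (_ : (fun _ => _) = (fun t => \int[m]_y H^\+ (t, y)) \-
                             (fun t => \int[m]_y H^\- (t, y))); last first.
  by apply/funext => t; rewrite [LHS]integralE; congr (_ - _); apply: eq_integral => y _; rewrite ?funeposE ?funenegE.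
apply: emeasurable_funB.
- by apply: (@measurable_fun_fubini_tonelli_F _ _ _ _ _ m H^\+) => //; exact: measurable_funepos.
- by apply: (@measurable_fun_fubini_tonelli_F _ _ _ _ _ m H^\-) => //; exact: measurable_funeneg.
Qed.

(** The parameter space is universally quantified because each induction step enlarges it by one
    coordinate, the partial sum so far. *)
Lemma measurable_iint (m : probability R R) (k : nat) :
  forall (d' : measure_display) (T' : measurableType d') (G : T' * R -> \bar R),
  measurable_fun setT G ->
  measurable_fun setT (fun t => iint m k (fun s => G (t, (\sum_(y <- s) y)%R))).
Proof.
elim: k => [|k IH] d' T' G mG.
  rewrite /= big_nil.
  by apply: (measurableT_comp mG); exact: measurable_fun_pair.
have mG' : measurable_fun setT (fun p : (T' * R) * R => G (p.1.1, (p.1.2 + p.2)%R)).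
  apply: (measurableT_comp mG); apply: measurable_fun_pair.
    exact: (measurableT_comp measurable_fst).
  apply: measurable_funD; last exact: measurable_snd.
  exact: (measurableT_comp measurable_snd).
have := measurable_integral_param m (IH _ _ _ mG'); apply: eq_measurable_fun => t _ /=.
apply: eq_integral => y _; congr iint; apply/funext => s.
by rewrite big_cons.
Qed.

End iterated_integral.

(** * Laws of sums of independent variables *)

Section sums.
Context {R : realType}.
Implicit Types (mu nu : probability R R) (f g : R -> R) (y s x : R).

Definition clip01 y : R := Num.max 0 (Num.min 1 y).
Definition posr s : R := Num.max 0 s.

Lemma clip01_ge0 y : 0 <= clip01 y. Proof. by rewrite le_max lexx. Qed.
Lemma clip01_le1 y : clip01 y <= 1.
Proof. by rewrite ge_max ler01 ge_min lexx. Qed.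
Lemma posr_ge0 s : 0 <= posr s. Proof. by rewrite le_max lexx. Qed.
Lemma clip01_id y : 0 <= y <= 1 -> clip01 y = y.
Proof. by case/andP=> y0 y1; rewrite /clip01 min_r// max_r. Qed.
Lemma posr_id s : 0 <= s -> posr s = s.
Proof. by move=> s0; rewrite /posr max_r. Qed.
Lemma clip01E y : clip01 y = if y <= 0 then 0 else if 1 <= y then 1 else y.
Proof.
rewrite /clip01; case: (leP 1 y) => ?; case: (leP y 0) => ? //; first by lra.
by rewrite max_r.
Qed.
Lemma clip01_homo : {homo clip01 : y z / y <= z}.
Proof.
by move=> y z yz; rewrite !clip01E; case: (leP y 0) => ?; case: (leP 1 y) => ?; case: (leP z 0) => ?; case: (leP 1 z) => ?; lra.
Qed.
Lemma posr_homo : {homo posr : y z / y <= z}.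
Proof. by move=> y z yz; rewrite /posr; case: (leP 0 y) => ?; case: (leP 0 z) => ?; lra. Qed.
Lemma clip01_lip y z : `|clip01 y - clip01 z| <= `|y - z|.
Proof.
wlog yz : y z / y <= z.
  by move=> W; have [/W//|/ltW/W] := leP y z; rewrite distrC [leRHS]distrC.
rewrite distrC [leRHS]distrC ger0_norm ?subr_ge0 ?clip01_homo// ger0_norm ?subr_ge0//.
by rewrite !clip01E; case: (leP y 0) => ?; case: (leP 1 y) => ?; case: (leP z 0) => ?; case: (leP 1 z) => ?; lra.
Qed.
Lemma posr_lip y z : `|posr y - posr z| <= `|y - z|.
Proof.
wlog yz : y z / y <= z.
  by move=> W; have [/W//|/ltW/W] := leP y z; rewrite distrC [leRHS]distrC.
rewrite distrC [leRHS]distrC ger0_norm ?subr_ge0 ?posr_homo// ger0_norm ?subr_ge0//.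
by rewrite /posr; case: (leP 0 y) => ?; case: (leP 0 z) => ?; lra.
Qed.

Lemma measurable_clip01 : measurable_fun setT (clip01 : R -> R).
Proof.
apply: continuous_measurable_fun; apply: (@lipschitzR_continuous _ 1) => y z.
by rewrite mul1r clip01_lip.
Qed.

Lemma measurable_posr : measurable_fun setT (posr : R -> R).
Proof.
apply: continuous_measurable_fun; apply: (@lipschitzR_continuous _ 1) => y z.
by rewrite mul1r posr_lip.
Qed.

Definition addc (p : R * R) : R := clip01 p.1 + posr p.2.

Lemma measurable_addc : measurable_fun setT addc.
Proof.
apply: measurable_funD.
  exact: (measurableT_comp measurable_clip01 measurable_fst).
exact: (measurableT_comp measurable_posr measurable_snd).
Qed.

HB.instance Definition _ := isMeasurableFun.Build _ _ _ _ addc measurable_addc.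

(* On laws carried by [0, 1] and [0, +oo[ the truncations in [addc] are
   invisible; they make all identities below hold without almost-sure provisos. *)
Definition convp mu nu : probability R R :=
  distribution (mu \x nu)%E (addc : {mfun (R * R)%type >-> R}).

Lemma bdmeas_addc f y : bdmeas f -> bdmeas (fun s => f (clip01 y + posr s)).
Proof.
move=> [mf [M fM]]; split; last by exists M.
apply: (measurableT_comp mf); apply: measurable_funD => //.
exact: measurable_posr.
Qed.

Lemma bdmeas_Ex (d1 : measure_display) (T1 : measurableType d1) mu (H : T1 * R -> R) :
  bdmeas H -> bdmeas (fun t => Ex mu (fun y => H (t, y))).
Proof.
move=> [mH [M HM]].
have bH t : bdmeas (fun y => H (t, y)).
  by split; [exact: measurableT_comp | exists M].
split; last by exists M => t; apply: normr_Ex.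
apply/measurable_EFinP.
have /measurable_EFinP/(measurable_integral_param mu) := mH.
by apply: eq_measurable_fun => t _ /=; rewrite Ex_EFin.
Qed.

Lemma bdmeas_addc2 f : bdmeas f -> bdmeas (fun p : R * R => f (clip01 p.1 + posr p.2)).
Proof.
move=> [mf [M fM]]; split; last by exists M.
exact: (measurableT_comp mf measurable_addc).
Qed.

Lemma bdmeas_Ex_addc nu f : bdmeas f ->
  bdmeas (fun y => Ex nu (fun s => f (clip01 y + posr s))).
Proof. by move=> /bdmeas_addc2 /(bdmeas_Ex nu). Qed.

Lemma Ex_convp mu nu f : bdmeas f ->
  Ex (convp mu nu) f = Ex mu (fun y => Ex nu (fun s => f (clip01 y + posr s))).
Proof.
move=> bf; apply: EFin_inj; rewrite -Ex_EFin// -Ex_EFin; last exact: bdmeas_Ex_addc.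
have bF := bdmeas_addc2 bf.
have iF : (mu \x nu)%E.-integrable setT (EFin \o (fun p : R * R => f (clip01 p.1 + posr p.2))).
  exact: bdmeas_integrable.
rewrite integral_distribution//; last by apply/measurable_EFinP; case: bf.
have := integral12_prod_meas1 iF; rewrite /fubini_F /= => <-.
by apply: eq_integral => y _; rewrite Ex_EFin//; exact: bdmeas_addc.
Qed.

Lemma Ex_swap mu nu (H : R * R -> R) : bdmeas H ->
  Ex mu (fun y => Ex nu (fun s => H (y, s))) = Ex nu (fun s => Ex mu (fun y => H (y, s))).
Proof.
move=> bH.
have bH' : bdmeas (fun p : R * R => H (p.2, p.1)).
  case: bH => mH [M HM]; split; last by exists M.
  exact: (measurableT_comp mH (@measurable_swap _ _ _ _)).
have b1 t : bdmeas (fun y => H (t, y)).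
  by case: bH => mH [M HM]; split; [exact: measurableT_comp | exists M].
have b2 t : bdmeas (fun y => H (y, t)).
  by case: bH => mH [M HM]; split; [apply: (measurableT_comp mH); exact: measurable_fun_pair | exists M].
apply: EFin_inj.
rewrite -Ex_EFin; last exact: (bdmeas_Ex nu bH).
rewrite -Ex_EFin; last exact: (bdmeas_Ex mu bH').
under eq_integral do rewrite -Ex_EFin//.
under [RHS]eq_integral do rewrite -Ex_EFin//.
apply: (@Fubini _ _ _ _ _ mu nu (EFin \o H)); exact: bdmeas_integrable.
Qed.

Fixpoint sumlaw mu (k : nat) : probability R R :=
  if k is k'.+1 then convp mu (sumlaw mu k') else \d_(0 : R).

Lemma Ex_dirac (a : R) f : bdmeas f -> Ex (\d_a : probability R R) f = f a.
Proof.
move=> bf; rewrite /Ex /Rintegral integral_dirac//; first by rewrite diracT mul1e.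
by apply/measurable_EFinP; case: bf.
Qed.

Definition supp01 mu := mu [set y | 0 <= y <= 1] = 1%E.

Lemma measurable_01 : measurable [set y : R | 0 <= y <= 1].
Proof.
rewrite (_ : [set y | _] = `[0, 1]%classic)//.
Qed.

(** Passage from iterated integrals to [sumlaw]. [F] is the function in the statement of the theorem
    and [f] its bounded version, equal on the half-line that carries the sums; the offset [a]
    collects the variables already integrated. *)
Lemma iint_sumlaw mu k F f a : supp01 mu -> measurable_fun setT F -> bdmeas f ->
  (forall s, 0 <= s -> F s = f s) -> 0 <= a ->
  iint mu k (fun t : seq R => (F (a + \sum_(y <- t) y))%:E) =
  (Ex (sumlaw mu k) (fun s => f (a + posr s)))%:E.
Proof.
move=> smu mF bf Ff; elim: k a => [|k IH] a a0 /=.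
  rewrite big_nil Ff ?addr0// Ex_dirac ?posr_id ?addr0//.
  case: bf => mf [M fM]; split; last by exists M.
  by apply: (measurableT_comp mf); apply: measurable_funD => //; exact: measurable_posr.
have bfa : bdmeas (fun s => f (a + posr s)).
  case: bf => mf [M fM]; split; last by exists M.
  by apply: (measurableT_comp mf); apply: measurable_funD => //; exact: measurable_posr.
rewrite Ex_convp// -Ex_EFin; last exact: (bdmeas_Ex_addc _ bfa).
apply: ae_eq_integral => //.
- have mG : measurable_fun setT (fun p : R * R => (F (a + (p.1 + p.2)))%:E).
    apply/measurable_EFinP/(measurableT_comp mF); apply: measurable_funD => //.
    by apply: measurable_funD; [exact: measurable_fst | exact: measurable_snd].
  have := measurable_iint mu k mG; apply: eq_measurable_fun => y _ /=.
  by congr iint; apply/funext => s; rewrite big_cons.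
- apply/measurable_EFinP; exact: (bdmeas_Ex_addc _ bfa).1.
exists (~` [set y | 0 <= y <= 1]); split.
- by apply: measurableC; exact: measurable_01.
- by rewrite [LHS]probability_setC ?smu ?subee//; exact: measurable_01.
apply: subsetC => y y01 /= _.
have y0 : 0 <= y by case/andP: y01.
under eq_fun do rewrite big_cons addrA.
rewrite IH ?addr_ge0//; congr (Ex _ _)%:E; apply/funext => s.
by rewrite clip01_id// [in RHS]posr_id ?addr_ge0 ?posr_ge0// addrA.
Qed.

End sums.

(** * The cavity map *)

Section cavity_map.
Context {R : realType}.
Implicit Types (c y z s t : R).

(** Truncating at 0 makes the map bounded, nonincreasing and Lipschitz on the whole line. *)
Definition cav c s : R := c / (c + posr s).

Lemma cavE c s : 0 <= s -> cav c s = c / (c + s).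
Proof. by move=> s0; rewrite /cav posr_id. Qed.

Lemma cav_den_gt0 c s : 0 < c -> 0 < c + posr s.
Proof. by move=> c0; rewrite ltr_wpDr// posr_ge0. Qed.

Lemma cav_ge0 c s : 0 < c -> 0 <= cav c s.
Proof. by move=> c0; rewrite divr_ge0// ltW// cav_den_gt0. Qed.

Lemma cav_le1 c s : 0 < c -> cav c s <= 1.
Proof.
by move=> c0; rewrite ler_pdivrMr ?cav_den_gt0// mul1r lerDl posr_ge0.
Qed.

Lemma cav_bounds c s : 0 < c -> 0 <= cav c s <= 1.
Proof. by move=> c0; rewrite cav_ge0// cav_le1. Qed.

Lemma cav_diff c s t : 0 < c ->
  cav c s - cav c t = c * (posr t - posr s) / ((c + posr s) * (c + posr t)).
Proof.
move=> c0; rewrite /cav; field.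
by rewrite !gt_eqF ?cav_den_gt0.
Qed.

Lemma cav_anti c : 0 < c -> {homo cav c : s t /~ s <= t}.
Proof.
move=> c0 s t st; rewrite -subr_ge0 cav_diff// divr_ge0//.
  by rewrite mulr_ge0 ?(ltW c0)// subr_ge0 posr_homo.
by rewrite mulr_ge0// ltW// cav_den_gt0.
Qed.

Lemma cav_lip c : 0 < c -> lipschitzR c^-1 (cav c).
Proof.
move=> c0 s t; rewrite cav_diff// !normrM normfV (gtr0_norm c0).
rewrite (gtr0_norm (_ : 0 < (c + posr s) * (c + posr t))); last first.
  by rewrite mulr_gt0 ?cav_den_gt0.
rewrite ler_pdivrMr ?mulr_gt0 ?cav_den_gt0//.
apply: (@le_trans _ _ (c * `|s - t|)).
  by rewrite ler_wpM2l ?(ltW c0)// distrC posr_lip.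
rewrite -mulrA [leRHS]mulrCA [leRHS]mulrC ler_wpM2r// ler_pdivlMl//.
by apply: ler_pM; rewrite ?(ltW c0)// lerDl posr_ge0.
Qed.

Lemma blip_cav c : 0 < c -> blip (cav c).
Proof.
move=> c0; split; first by exists c^-1; exact: cav_lip.
by exists 1 => s; rewrite ger0_norm ?cav_le1 ?cav_ge0.
Qed.

Lemma blip_clip01 : blip (@clip01 R).
Proof.
split; first by exists 1 => y z; rewrite mul1r clip01_lip.
by exists 1 => y; rewrite ger0_norm ?clip01_le1 ?clip01_ge0.
Qed.

Lemma lipschitz_ge0 L (f : R -> R) : lipschitzR L f -> 0 <= L.
Proof.
move=> /(_ 1 0); rewrite subr0 normr1 mulr1; apply: le_trans; exact: normr_ge0.
Qed.

Lemma blip_comp (f g : R -> R) : blip f -> (exists L, lipschitzR L g) -> blip (f \o g).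
Proof.
move=> [[L Lf] [M fM]] [K Kg]; split; last by exists M => y /=.
exists (L * K) => y z /=; rewrite (le_trans (Lf _ _))// -mulrA ler_wpM2l//.
exact: lipschitz_ge0 Lf.
Qed.

Lemma lipschitz_addc y : exists L, lipschitzR L (fun s : R => clip01 y + posr s).
Proof. by exists 1 => s t; rewrite opprD addrACA subrr add0r mul1r posr_lip. Qed.

Lemma blip_addc (f : R -> R) y : blip f -> blip (fun s => f (clip01 y + posr s)).
Proof. by move=> bf; apply: (blip_comp bf (lipschitz_addc y)). Qed.

Lemma blip_Ex_addc (nu : probability R R) (f : R -> R) : blip f ->
  blip (fun y => Ex nu (fun s => f (clip01 y + posr s))).
Proof.
move=> bf; have bm y : bdmeas (fun s => f (clip01 y + posr s)).
  exact/blip_bdmeas/blip_addc.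
case: (bf) => [[L Lf] [M fM]]; split; last by exists M => y; exact: normr_Ex.
exists L => y z; rewrite -ExB//; apply: normr_Ex; first exact: bdmeasB.
move=> s; rewrite (le_trans (Lf _ _))// ler_wpM2l ?(lipschitz_ge0 Lf)//.
by rewrite opprD addrACA subrr addr0 clip01_lip.
Qed.

Lemma blipD (f g : R -> R) : blip f -> blip g -> blip (fun y => f y + g y).
Proof.
move=> [[L Lf] [M fM]] [[K Kg] [N gN]]; split.
  exists (L + K) => y z; rewrite opprD addrACA mulrDl.
  by rewrite (le_trans (ler_normD _ _))// lerD.
by exists (M + N) => y; rewrite (le_trans (ler_normD _ _))// lerD.
Qed.

Lemma blipZ a (f : R -> R) : blip f -> blip (fun y => a * f y).
Proof.
move=> [[L Lf] [M fM]]; split.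
  by exists (`|a| * L) => y z; rewrite -mulrBr normrM -mulrA ler_wpM2l.
by exists (`|a| * M) => y; rewrite normrM ler_wpM2l.
Qed.

Lemma blipB (f g : R -> R) : blip f -> blip g -> blip (fun y => f y - g y).
Proof. by move=> bf /blipN; apply: blipD. Qed.

End cavity_map.

Section order.
Context {R : realType}.
Implicit Types (mu nu : probability R R) (f g : R -> R).

Definition meanc mu : R := Ex mu clip01.

Lemma st_le_meanc mu nu : st_le mu nu -> meanc mu <= meanc nu.
Proof. by move=> mn; apply: mn; [exact: blip_clip01 | exact: clip01_homo]. Qed.

(* Since [L * clip01 +- f] is nondecreasing, the defect of means controls all
   Lipschitz test functions. *)
Lemma st_le_lip mu nu f L : st_le mu nu ->
  (forall y z, `|f y - f z| <= L * `|clip01 y - clip01 z|) -> blip f ->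
  `|Ex nu f - Ex mu f| <= L * (meanc nu - meanc mu).
Proof.
move=> mn Lf bf.
have bc := @blip_clip01 R.
have mono y z : y <= z -> `|f z - f y| <= L * (clip01 z - clip01 y).
  move=> yz; rewrite (le_trans (Lf _ _))// ger0_norm// subr_ge0; exact: clip01_homo.
have H1 : Ex mu (fun y => L * clip01 y - f y) <= Ex nu (fun y => L * clip01 y - f y).
  apply: mn; first by apply: blipB => //; exact: blipZ.
  move=> y z /mono; rewrite ler_norml mulrBr => /andP[? ?]; lra.
have H2 : Ex mu (fun y => L * clip01 y + f y) <= Ex nu (fun y => L * clip01 y + f y).
  apply: mn; first by apply: blipD => //; exact: blipZ.
  move=> y z /mono; rewrite ler_norml mulrBr => /andP[? ?]; lra.
have b1 : bdmeas (fun y => L * clip01 y) by apply/blip_bdmeas/blipZ.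
have b2 := blip_bdmeas bf.
have b3 := blip_bdmeas bc.
move: H1 H2; rewrite !ExB// !ExD// !ExZ//.
move=> H1 H2; rewrite ler_norml mulrBr /meanc; apply/andP; split; lra.
Qed.

Lemma le_Ex_sumlaw mu k f g : bdmeas f -> bdmeas g ->
  (forall s, 0 <= s <= k%:R -> f s <= g s) ->
  Ex (sumlaw mu k) f <= Ex (sumlaw mu k) g.
Proof.
elim: k f g => [|k IH] f g bf bg fg /=.
  by rewrite !Ex_dirac// fg// lexx.
rewrite !Ex_convp//; apply: le_Ex; try exact: bdmeas_Ex_addc.
move=> y; apply: IH; try exact: bdmeas_addc.
move=> s /andP[s0 sk]; apply: fg.
rewrite posr_id// addr_ge0 ?clip01_ge0//= -natr1 addrC lerD ?clip01_le1//.
Qed.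

Lemma st_le_sumlaw mu nu k : st_le mu nu -> st_le (sumlaw mu k) (sumlaw nu k).
Proof.
move=> mn; elim: k => [|k IH] f bf df //=.
have bm := blip_bdmeas bf.
rewrite !Ex_convp//; apply: (@le_trans _ _
  (Ex mu (fun y => Ex (sumlaw nu k) (fun s => f (clip01 y + posr s))))).
  apply: le_Ex; try exact: bdmeas_Ex_addc.
  move=> y; apply: IH; first exact: blip_addc.
  by move=> s t st; apply: df; rewrite lerD2l posr_homo.
apply: mn; first exact: blip_Ex_addc.
move=> y z yz; apply: le_Ex; try exact: bdmeas_addc.
by move=> s; apply: df; rewrite lerD2r clip01_homo.
Qed.

(* The factor is the smallest slope of [- cav c] on [0, k + 1]. *)
Lemma cav_sumlaw_gap c mu nu k : 0 < c -> st_le mu nu ->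
  c / (c + k.+1%:R) ^+ 2 * (meanc nu - meanc mu) <=
  Ex (sumlaw mu k.+1) (cav c) - Ex (sumlaw nu k.+1) (cav c).
Proof.
move=> c0 mn; have bc := blip_cav c0; have bm := blip_bdmeas bc.
set L := c / _.
pose phi y := Ex (sumlaw nu k) (fun s => cav c (clip01 y + posr s)).
have bphi : blip phi by apply: blip_Ex_addc.
have H1 : Ex mu phi <= Ex (sumlaw mu k.+1) (cav c).
  rewrite /= Ex_convp//; apply: le_Ex; try exact: bdmeas_Ex_addc.
  move=> y; apply: (st_le_anti (st_le_sumlaw k mn)); first exact: blip_addc.
  by move=> s t st; apply: cav_anti => //; rewrite lerD2l posr_homo.
have -> : Ex (sumlaw nu k.+1) (cav c) = Ex nu phi by rewrite /= Ex_convp.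
(* In [H1] the last [k] summands pass from [mu] to [nu] by monotonicity alone; the first one yields
   the gap, since [phi + L * clip01] is still nonincreasing. *)
suff : Ex nu (fun y => phi y + L * clip01 y) <= Ex mu (fun y => phi y + L * clip01 y).
  have b1 : bdmeas (fun y => L * clip01 y) by apply/blip_bdmeas/blipZ/blip_clip01.
  rewrite !ExD//; try exact: blip_bdmeas.
  rewrite !(ExZ _ L (blip_bdmeas blip_clip01)) => H2; rewrite mulrBr /meanc; lra.
apply: (st_le_anti mn); first by apply: blipD => //; exact/blipZ/blip_clip01.
move=> z y yz; rewrite -lerBrDr -addrA -mulrBr.
have bcy w : bdmeas (fun s => cav c (clip01 w + posr s)) by exact: bdmeas_addc.
rewrite /phi -[X in _ <= _ + X](Ex_cst (sumlaw nu k)) -ExD//; last exact: bdmeas_cst.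
apply: le_Ex_sumlaw => //; first by apply: bdmeasD => //; exact: bdmeas_cst.
move=> s /andP[s0 sk]; rewrite -lerBlDl cav_diff//.
have ya := clip01_ge0 y; have za := clip01_ge0 z.
have yb := clip01_le1 y; have zb := clip01_le1 z.
rewrite (posr_id s0) !posr_id ?addr_ge0//.
have -> : clip01 y + s - (clip01 z + s) = clip01 y - clip01 z by lra.
have D : 0 <= clip01 z - clip01 y by rewrite subr_ge0 clip01_homo.
rewrite -[clip01 y - clip01 z]opprB [leRHS]mulrN [c * - _]mulrN mulNr lerN2 /L mulrAC.
have kE : k.+1%:R = k%:R + 1 :> R by rewrite natr1.
rewrite ler_wpM2l ?mulr_ge0 ?(ltW c0)//.
have X0 : 0 < c + (clip01 z + s) by lra.
have Y0 : 0 < c + (clip01 y + s) by lra.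
have Z0 : 0 < c + k.+1%:R by rewrite ltr_wpDr.
rewrite lef_pV2 ?posrE ?mulr_gt0 ?exprn_gt0//.
by rewrite expr2; apply: ler_pM; rewrite ?(ltW X0) ?(ltW Y0)//; lra.
Qed.

End order.

(** * Distribution functions *)

Section distribution_function.
Context {R : realType}.
Implicit Types (mu nu : probability R R) (t : R).

Definition dfn mu t : R := fine (mu `]-oo, t]%classic).

Lemma dfnE mu t : mu `]-oo, t]%classic = (dfn mu t)%:E.
Proof. by rewrite /dfn fineK// fin_num_measure. Qed.

Lemma dfn_ge0 mu t : 0 <= dfn mu t.
Proof. by rewrite -lee_fin -dfnE. Qed.

Lemma dfn_le1 mu t : dfn mu t <= 1.
Proof. by rewrite -lee_fin -dfnE probability_le1. Qed.

Lemma dfn_homo mu : {homo dfn mu : s t / s <= t}.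
Proof.
move=> s t st; rewrite -lee_fin -!dfnE le_measure ?inE//.
by apply: subset_itvl; rewrite bnd_simp.
Qed.

Lemma bdmeas_indic (A : set R) : measurable A -> bdmeas (\1_A : R -> R).
Proof.
move=> mA; split; first exact: measurable_indic.
by exists 1 => y; rewrite indicE ger0_norm// lern1 leq_b1.
Qed.

Lemma Ex_indic mu (A : set R) : measurable A -> (Ex mu (\1_A : R -> R))%:E = mu A.
Proof.
by move=> mA; rewrite -Ex_EFin; [rewrite integral_indic// setIT | exact: bdmeas_indic].
Qed.

Lemma dfn_Ex mu t : dfn mu t = Ex mu (\1_(`]-oo, t]%classic) : R -> R).
Proof. by apply: EFin_inj; rewrite -dfnE Ex_indic. Qed.

Definition idR (y : R) : R := y.
HB.instance Definition _ := isMeasurableFun.Build _ _ _ _ idR (@measurable_id _ R setT).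

Lemma dfn_right_continuous mu t e : 0 < e ->
  exists2 d : R, 0 < d & dfn mu (t + d) <= dfn mu t + e.
Proof.
move=> e0; have := @cdf_right_continuous _ _ _ mu (idR : {RV mu >-> R}) t.
have -> : cdf (idR : {RV mu >-> R}) = EFin \o dfn mu.
  by apply/funext => s /=; rewrite -dfnE.
move=> /fine_cvg /= /cvgrPdist_le /(_ _ e0)[d /= d0 H].
exists (d / 2); first by rewrite divr_gt0.
have := H (t + d / 2); rewrite /= opprD addrA subrr sub0r normrN.
rewrite ger0_norm ?divr_ge0 ?(ltW d0)// ltrDl divr_gt0// => /(_ _ _).
rewrite ltr_pdivrMr// ltr_pMr// ltr1n => /(_ isT isT).
rewrite ler_norml => /andP[+ _]; lra.
Qed.

(** A Lipschitz approximation of the indicator of []-oo, t]]: equal to 1 up to [t] and to 0 from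
    [t + 1 / n.+1] on. *)
Definition ramp t (n : nat) (y : R) : R := clip01 (1 - n.+1%:R * (y - t)).

Lemma blip_ramp t n : blip (ramp t n).
Proof.
apply: (blip_comp blip_clip01); exists n.+1%:R => y z.
have -> : 1 - n.+1%:R * (y - t) - (1 - n.+1%:R * (z - t)) = - (n.+1%:R * (y - z)) by ring.
by rewrite normrN normrM ger0_norm.
Qed.

Lemma ramp_anti t n : {homo ramp t n : y z /~ y <= z}.
Proof.
by move=> y z yz; apply: clip01_homo; rewrite lerD2l lerN2 ler_wpM2l// lerD2r.
Qed.

Lemma dfn_le_ramp mu t n : dfn mu t <= Ex mu (ramp t n).
Proof.
rewrite dfn_Ex; apply: le_Ex; first exact: bdmeas_indic.
  exact/blip_bdmeas/blip_ramp.
move=> y; rewrite indicE; have [|] := boolP (y \in _); last by rewrite /ramp clip01_ge0.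
rewrite inE/= in_itv/= => yt; rewrite /ramp clip01E.
have H : 0 <= n.+1%:R * (t - y) by rewrite mulr_ge0// subr_ge0.
have E : n.+1%:R * (y - t) = - (n.+1%:R * (t - y)) by ring.
have v1 : 1 <= 1 - n.+1%:R * (y - t) by rewrite E opprK lerDl.
by rewrite v1; case: (leP (1 - n.+1%:R * (y - t)) 0) => //= ?; lra.
Qed.

Lemma ramp_le_dfn mu t n : Ex mu (ramp t n) <= dfn mu (t + n.+1%:R^-1).
Proof.
rewrite dfn_Ex; apply: le_Ex; last 1 first.
- move=> y; rewrite indicE; have [|] := boolP (y \in _); first by rewrite /ramp clip01_le1.
  rewrite notin_setE/= in_itv/= => /negP; rewrite -ltNge => yt; rewrite /ramp clip01E.
  have H : 1 <= n.+1%:R * (y - t) by rewrite -ler_pdivrMl// mulr1 lerBrDl ltW.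
  by rewrite ifT// subr_le0.
- exact/blip_bdmeas/blip_ramp.
- exact: bdmeas_indic.
Qed.

Lemma st_le_dfn mu nu t : st_le mu nu -> dfn nu t <= dfn mu t.
Proof.
move=> mn; apply/ler_addgt0Pr => e e0.
have [d d0 H] := dfn_right_continuous mu t e0.
have [n nd] : exists n : nat, n.+1%:R^-1 <= d.
  exists (Num.truncn d^-1); rewrite -[leRHS]invrK lef_pV2 ?posrE ?invr_gt0//.
  by rewrite ltW// truncnS_gt.
apply: le_trans H; apply: le_trans (dfn_le_ramp nu t n) _.
apply: le_trans (st_le_anti mn (blip_ramp t n) (@ramp_anti t n)) _.
apply: le_trans (ramp_le_dfn mu t n) _.
by apply: dfn_homo; rewrite lerD2l.
Qed.

Lemma measure_itvoc mu a b : a <= b -> mu `]a, b]%classic = (dfn mu b - dfn mu a)%:E.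
Proof.
move=> ab; rewrite EFinB -!dfnE.
have -> : `]a, b]%classic = `]-oo, b] `\` `]-oo, a] :> set R.
  apply/seteqP; split => y /=; rewrite !in_itv/=.
    by case/andP => ay yb; split => //; apply/negP; rewrite -ltNge.
  by case=> yb /negP; rewrite -ltNge yb andbT.
rewrite measureD ?setIidr//; last by rewrite -ge0_fin_numE// fin_num_measure.
by apply: subset_itvl; rewrite bnd_simp.
Qed.

Lemma eq_dfn_eq mu nu : dfn mu =1 dfn nu -> forall A, measurable A -> mu A = nu A.
Proof.
move=> mn; apply: (@measure_unique _ _ _ (@ocitv R) (fun k => `]- k%:R, k%:R]%classic)) => //.
- exact: ocitvI.
- by move=> k; exact: is_ocitv.
- exact: (bigcup_itvT false false).
- move=> _ [[a b] _ <-] /=; have [ab|ba] := leP a b; first by rewrite !measure_itvoc// !mn.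
  by rewrite set_itv_ge ?measure0// bnd_simp -leNgt ltW.
- by move=> k; rewrite -ge0_fin_numE// fin_num_measure.
Qed.

Lemma st_le_eq mu nu : st_le mu nu -> st_le nu mu ->
  forall A, measurable A -> mu A = nu A.
Proof.
by move=> mn nm; apply: eq_dfn_eq => t; apply/eqP; rewrite eq_le !st_le_dfn.
Qed.

Lemma bdmeas_sum (N : nat) (F : nat -> R -> R) : (forall j, bdmeas (F j)) ->
  bdmeas (fun y => \sum_(j < N) F j y).
Proof.
move=> bF; elim: N => [|N IH].
  by under eq_fun do rewrite big_ord0; exact: bdmeas_cst.
by under eq_fun do rewrite big_ord_recr; exact: bdmeasD.
Qed.

Lemma Ex_sum mu (N : nat) (F : nat -> R -> R) : (forall j, bdmeas (F j)) ->
  Ex mu (fun y => \sum_(j < N) F j y) = \sum_(j < N) Ex mu (F j).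
Proof.
move=> bF; elim: N => [|N IH].
  by rewrite big_ord0; under eq_fun do rewrite big_ord0; rewrite Ex_cst.
under eq_fun do rewrite big_ord_recr.
by rewrite /= ExD ?IH ?big_ord_recr//; exact: bdmeas_sum.
Qed.

Lemma count_lt_bounds (N : nat) (w : R) : 0 <= w <= N%:R ->
  w <= \sum_(j < N) (j%:R < w)%R%:R <= w + 1.
Proof.
move=> /andP[w0]; pose S N := \sum_(j < N) (j%:R < w)%R%:R : R.
have H M : (M%:R < w -> S M = M%:R) /\ (w <= M%:R -> w <= S M <= w + 1).
  elim: M => [|M [IH1 IH2]].
    by rewrite /S big_ord0; split => // w0'; apply/andP; split; lra.
  rewrite /S big_ord_recr/= -/(S M) -natr1.
  case: (ltP M%:R w) => wM /=; rewrite ?addr0.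
    by rewrite IH1//; split => // ?; apply/andP; split; lra.
  by split => [?|_]; [lra | exact: IH2].
by case: (H N) => _; apply.
Qed.

(* Layer-cake discretisation: [g] is within [1/N] of the average of the
   indicators of [g > j/N], whose level sets are half-lines. *)
Lemma dfn_st_le mu nu : (forall t, dfn nu t <= dfn mu t) -> st_le mu nu.
Proof.
move=> dd f bf df; have [[L Lf] [M fM]] := bf.
have cf := lipschitzR_continuous Lf.
(* For a continuous nondecreasing [f] a sublevel set is empty, everything, or a closed half-line
   ending at its supremum. *)
have level (c : R) : (nu [set y | (f y <= c)%R] <= mu [set y | (f y <= c)%R])%E.
  have [[y0 fy0]|no] := pselect (exists y, f y <= c); last first.
    have -> : [set y | f y <= c] = set0.
      by apply/seteqP; split => // y fy; apply: no; exists y.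
    by rewrite !measure0.
  have [[z fz]|no] := pselect (exists z, c < f z); last first.
    have -> : [set y | f y <= c] = setT.
      apply/seteqP; split => // y _ /=; rewrite leNgt; apply/negP => fy.
      by apply: no; exists y.
    by rewrite !probability_setT.
  pose A := [set y | f y <= c].
  have ubA : ubound A z.
    move=> y /= fy; rewrite leNgt; apply/negP => /ltW/df.
    by rewrite leNgt (le_lt_trans fy fz).
  have supA : has_sup A by split; [exists y0 | exists z].
  suff -> : [set y | f y <= c] = `]-oo, sup A]%classic.
    by rewrite !dfnE lee_fin.
  have supin : f (sup A) <= c.
    apply/ler_addgt0Pr => e e0; have L0 := lipschitz_ge0 Lf.
    have L1 : 0 < L + 1 by rewrite ltr_wpDl.
    have [d d0 dE] : exists2 d, 0 < d & (L + 1) * d = e.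
      exists (e / (L + 1)); first exact: divr_gt0.
      by rewrite mulrCA divff ?mulr1// gt_eqF.
    have [y /= fy sy] := sup_adherent d0 supA.
    have ys : y <= sup A by apply: ub_le_sup => //; exists z.
    have := Lf (sup A) y; rewrite ler_norml => /andP[_ H].
    rewrite ger0_norm ?subr_ge0// in H.
    have fyc : f y <= c := fy.
    have : L * (sup A - y) <= e; last by move=> ?; lra.
    rewrite -dE; apply: ler_pM => //; [by rewrite subr_ge0 | by rewrite lerDl | by lra].
  apply/seteqP; split => y /=; rewrite in_itv/=; first by move=> fy; apply: ub_le_sup => //; exists z.
  by move=> /df/le_trans; apply.
have M0 : 0 <= M by apply: le_trans (fM 0); exact: normr_ge0.
pose K := 2 * M + 1; have K0 : 0 < K by rewrite /K; lra.
(* [g] rescales [f] to [[0, N]], and [S] counts the naturals below [g], which costs at most 1 out of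
   [N]. The extra 1 in [K] keeps it positive when [M = 0]. *)
have main (N : nat) : N%:R * (Ex mu f - Ex nu f) <= K.
  pose g y := N%:R / K * (f y + M).
  have bfm := blip_bdmeas bf.
  have bg : bdmeas g by apply: bdmeasZ; apply: bdmeasD => //; exact: bdmeas_cst.
  have g01 y : 0 <= g y <= N%:R.
    have := fM y; rewrite ler_norml => /andP[f1 f2].
    rewrite /g mulr_ge0 ?divr_ge0 ?(ltW K0)//=; last by lra.
    rewrite mulrAC ler_pdivrMr// ler_wpM2l// /K; lra.
  pose S y := \sum_(j < N) (j%:R < g y)%R%:R : R.
  have mset (j : nat) : measurable [set y | f y <= K * j%:R / N%:R - M].
    have := bfm.1 measurableT `]-oo, (K * j%:R / N%:R - M)]%classic (measurable_itv _).
    rewrite setTI; congr measurable; apply/seteqP; split => y /=; by rewrite in_itv.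
  have SE y : S y = \sum_(j < N) \1_(~` [set y | f y <= K * j%:R / N%:R - M]) y.
    apply: eq_bigr => j _; rewrite indicE; congr (nat_of_bool _)%:R.
    have N0 : 0 < N%:R :> R by rewrite ltr0n (leq_ltn_trans _ (ltn_ord j)).
    rewrite /g -ltr_pdivrMl ?divr_gt0// invf_div -ltrBlDr (_ : K / N%:R * j%:R = K * j%:R / N%:R); last by rewrite mulrAC.
    apply/idP/idP; first by rewrite inE/= => H; apply/negP; rewrite -ltNge.
    by rewrite inE/= => /negP; rewrite -ltNge.
  have bI j : bdmeas (\1_(~` [set y | f y <= K * j%:R / N%:R - M]) : R -> R).
    exact/bdmeas_indic/measurableC.
  have bS : bdmeas S.
    by rewrite (_ : S = fun y => \sum_(j < N) \1_(~` [set y | f y <= K * j%:R / N%:R - M]) y);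
      [exact: (bdmeas_sum N bI) | exact/funext].
  have ES m : Ex m S = \sum_(j < N) Ex m (\1_(~` [set y | f y <= K * j%:R / N%:R - M]) : R -> R).
    by rewrite -(Ex_sum m N bI); congr Ex; exact/funext.
  have H1 : Ex mu g <= Ex mu S.
    by apply: le_Ex => // y; have /andP[] := count_lt_bounds (g01 y).
  have H2 : Ex mu S <= Ex nu S.
    rewrite !ES; apply: ler_sum => j _; rewrite -lee_fin !Ex_indic; try exact: measurableC.
    rewrite [leLHS]probability_setC// [leRHS]probability_setC//.
    by apply: leeB => //; exact: level.
  have H3 : Ex nu S <= Ex nu g + 1.
    rewrite -[X in _ + X](Ex_cst nu) -ExD//; last exact: bdmeas_cst.
    apply: le_Ex => //; first by apply: bdmeasD => //; exact: bdmeas_cst.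
    by move=> y; have /andP[] := count_lt_bounds (g01 y).
  have Eg m : Ex m g = N%:R / K * (Ex m f + M).
    rewrite /g ExZ; last by apply: bdmeasD => //; exact: bdmeas_cst.
    by rewrite ExD ?Ex_cst//; exact: bdmeas_cst.
  have : Ex mu g - Ex nu g <= 1 by lra.
  rewrite !Eg -mulrBr opprD addrACA subrr addr0 mulrAC ler_pdivrMr// mul1r.
  by [].
rewrite -subr_le0 leNgt; apply/negP => d0.
have := main (Num.truncn (K / (Ex mu f - Ex nu f))).+1.
by rewrite leNgt -ltr_pdivrMr// truncnS_gt.
Qed.

Section stieltjes.
Variable F : R -> R.
Hypothesis F_nd : {homo F : s t / s <= t}.
Hypothesis F_rc : forall t e, 0 < e -> exists2 d : R, 0 < d & F (t + d) <= F t + e.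
Hypothesis F_lt0 : forall t, t < 0 -> F t = 0.
Hypothesis F_ge1 : forall t, 1 <= t -> F t = 1.

Let F_right_continuous : right_continuous F.
Proof.
move=> t; apply/cvgrPdist_le => e e0; have [d d0 H] := F_rc t e0.
exists d => //= s /=; rewrite distrC ltr_distl => /andP[_ s2] ts.
rewrite distrC ger0_norm ?subr_ge0 ?F_nd ?(ltW ts)// lerBlDl.
by apply: le_trans H; apply: F_nd; rewrite ltW.
Qed.

HB.instance Definition _ := isCumulative.Build R _ R F F_nd F_right_continuous.

Let F_Ny : F @ -oo --> (0 : R).
Proof.
apply: cvg_near_cst; exists 0; split => // t t0; exact: F_lt0.
Qed.

Let F_y : F @ +oo --> (1 : R).
Proof.
apply: cvg_near_cst; exists 1; split => // t t0; apply: F_ge1; exact: ltW.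
Qed.

HB.instance Definition _ := isCumulativeBounded.Build R 0 1 F F_Ny F_y.

Let idTR : measurableTypeR R -> R := idfun.

HB.instance Definition _ := @isMeasurableFun.Build _ _ _ _ idTR (@measurable_id _ _ setT).

(** The Lebesgue-Stieltjes measure of [F]; the push-forward by the identity only changes the
    measurable structure under which the real line is presented. *)
Lemma exists_law : exists mu : probability R R, dfn mu =1 F.
Proof.
pose f : cumulativeBounded (0 : R) (1 : R) := F.
pose m : probability (measurableTypeR R) R := lebesgue_stieltjes_measure f.
exists (distribution m (idTR : {mfun measurableTypeR R >-> R})) => t.
apply: EFin_inj; rewrite -dfnE.
exact: (cdf_lebesgue_stieltjes_id f t).
Qed.

End stieltjes.

End distribution_function.

(** * The distributional recursion *)

Section exchangeability.
Context {R : realType}.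
Implicit Types (mu nu : probability R R) (u : R -> R).

(** Exchangeability: each summand contributes equally to [E[S u(S)]]. As [sumlaw] is built one
    variable at a time, the symmetry is obtained by induction and a Fubini swap of the first two
    variables. *)
Lemma Ex_sumlaw_exchange mu k u M : measurable_fun setT u ->
  (forall s, 0 <= s -> 0 <= u s <= M) -> (forall s, 0 <= s -> s * u s <= M) ->
  Ex (sumlaw mu k.+1) (fun s => posr s * u (posr s)) =
  k.+1%:R * Ex mu (fun y => Ex (sumlaw mu k)
    (fun s => clip01 y * u (clip01 y + posr s))).
Proof.
elim: k u => [|k IH] u mu_ uM suM.
all: have bU : bdmeas (fun s : R => posr s * u (posr s)).
1,3: split; [apply: measurable_funM; [exact: measurable_posr|]; apply: (measurableT_comp mu_); exact: measurable_posr
            |exists M => s; have s0 := posr_ge0 s; have /andP[? ?] := uM _ s0; rewrite ger0_norm ?suM ?mulr_ge0//].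
all: have b2 (a : R) : 0 <= a -> bdmeas (fun s : R => u (a + posr s)).
1,3: move=> a0; split; [apply: (measurableT_comp mu_); apply: measurable_funD => //; exact: measurable_posr
            |exists M => s; have s0 : 0 <= a + posr s by rewrite addr_ge0// posr_ge0].
1,2: by have /andP[? ?] := uM _ s0; rewrite ger0_norm.
- rewrite [sumlaw _ 1]/= mul1r Ex_convp//; congr Ex; apply/funext => y.
  rewrite !Ex_dirac//=; last 2 first.
  + by apply: bdmeasZ; apply: b2; exact: clip01_ge0.
  + exact: (bdmeas_addc y bU).
  by rewrite (posr_id (lexx 0)) addr0 posr_id// clip01_ge0.
have bm2 : bdmeas (fun p : R * R => clip01 p.1 * u (clip01 p.1 + posr p.2)).
  split; first (apply: measurable_funM; [exact: (measurableT_comp measurable_clip01 measurable_fst)|]).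
    exact: (measurableT_comp mu_ measurable_addc).
  exists M => p; have y0 := clip01_ge0 p.1; have y1 := clip01_le1 p.1.
  have s0 := posr_ge0 p.2; have t0 : 0 <= clip01 p.1 + posr p.2 by rewrite addr_ge0.
  have /andP[u0 u1] := uM _ t0; rewrite ger0_norm ?mulr_ge0//.
  by rewrite (le_trans _ u1)// ler_piMl.
rewrite [sumlaw _ k.+2]/= -/(sumlaw mu k.+1) Ex_convp//.
(* The first summand gives one term; the others are handled by the induction hypothesis for [u]
   shifted by the first summand. *)
transitivity (Ex mu (fun y => Ex (sumlaw mu k.+1) (fun s => clip01 y * u (clip01 y + posr s)) +
   k.+1%:R * Ex mu (fun z => Ex (sumlaw mu k) (fun s => clip01 z * u (clip01 y + (clip01 z + posr s)))))).
  congr Ex; apply/funext => y.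
  have y0 := clip01_ge0 y.
  pose v s := u (clip01 y + posr s).
  have E : Ex (sumlaw mu k.+1) (fun s => posr s * v (posr s)) =
     k.+1%:R * Ex mu (fun z => Ex (sumlaw mu k) (fun s => clip01 z * v (clip01 z + posr s))).
    apply: IH.
    - exact: (b2 _ y0).1.
    - move=> s s0; apply: uM; by rewrite addr_ge0// posr_ge0.
    - move=> s s0; rewrite /v (posr_id s0); have sy : 0 <= clip01 y + s by rewrite addr_ge0.
      apply: le_trans (suM _ sy); apply: ler_wpM2r; last by rewrite lerDr.
      by case/andP: (uM _ sy).
  rewrite [X in _ = _ + X](_ : _ = Ex (sumlaw mu k.+1) (fun s => posr s * v (posr s))); last first.
    rewrite E; congr (_ * _); congr Ex; apply/funext => z; congr Ex; apply/funext => s.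
    by rewrite /v [posr (_ + _)]posr_id// addr_ge0 ?clip01_ge0 ?posr_ge0.
  rewrite -ExD.
  - congr Ex; apply/funext => s; rewrite /v (posr_id (posr_ge0 s)) posr_id ?mulrDl//.
    by rewrite addr_ge0 ?posr_ge0.
  - by apply: bdmeasZ; exact: b2.
  - split.
      apply: measurable_funM; first exact: measurable_posr.
      apply: (measurableT_comp (b2 _ y0).1); exact: measurable_posr.
    exists M => s; have s0 := posr_ge0 s; rewrite /v (posr_id s0).
    have sy : 0 <= clip01 y + posr s by rewrite addr_ge0.
    have /andP[u0 _] := uM _ sy; rewrite ger0_norm ?mulr_ge0//.
    by apply: le_trans (suM _ sy); apply: ler_wpM2r => //; rewrite lerDr.
pose H (p : R * R) := Ex (sumlaw mu k) (fun s => clip01 p.2 * u (clip01 p.1 + (clip01 p.2 + posr s))).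
have bH : bdmeas H.
  apply: (@bdmeas_Ex _ _ _ _ (fun q : (R * R) * R => clip01 q.1.2 * u (clip01 q.1.1 + (clip01 q.1.2 + posr q.2)))).
  have m11 : measurable_fun setT (fun q : (R * R) * R => clip01 q.1.1).
    apply: (measurableT_comp measurable_clip01); exact: (measurableT_comp measurable_fst measurable_fst).
  have m12 : measurable_fun setT (fun q : (R * R) * R => clip01 q.1.2).
    apply: (measurableT_comp measurable_clip01); exact: (measurableT_comp measurable_snd measurable_fst).
  split.
    apply: measurable_funM => //; apply: (measurableT_comp mu_).
    apply: measurable_funD => //; apply: measurable_funD => //.
    exact: (measurableT_comp measurable_posr measurable_snd).
  exists M => q; have y0 := clip01_ge0 q.1.2; have y1 := clip01_le1 q.1.2.
  have t0 : 0 <= clip01 q.1.1 + (clip01 q.1.2 + posr q.2) by rewrite !addr_ge0 ?clip01_ge0 ?posr_ge0.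
  have /andP[u0 u1] := uM _ t0; rewrite ger0_norm ?mulr_ge0//.
  by rewrite (le_trans _ u1)// ler_piMl.
have bA := bdmeas_Ex (sumlaw mu k.+1) bm2.
have bB := bdmeas_Ex mu bH.
rewrite ExD ?ExZ//; last exact: bdmeasZ.
rewrite -[k.+2%:R]natr1 [RHS]mulrDl mul1r addrC; congr (_ * _ + _).
rewrite [LHS](Ex_swap mu mu bH); congr Ex; apply/funext => z.
rewrite /H [RHS]/= Ex_convp; last first.
  by apply: bdmeasZ; apply: b2; exact: clip01_ge0.
congr Ex; apply/funext => y; congr Ex; apply/funext => s /=.
by rewrite [posr (_ + _)]posr_id ?addr_ge0 ?clip01_ge0 ?posr_ge0// addrCA.
Qed.

End exchangeability.

(** * The cavity operator on laws *)

Section cavity_operator.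
Context {R : realType}.
Variables (q : nat -> R) (q0 : forall k, 0 <= q k).
Hypothesis q1 : (fun n => \sum_(k < n) q k) @ \oo --> (1 : R).
Variables (c : R) (c0 : 0 < c).
Implicit Types (mu nu : probability R R) (f : R -> R).

Lemma measurable_cav : measurable_fun setT (cav c).
Proof. by have [] := blip_bdmeas (blip_cav c0). Qed.

HB.instance Definition _ := isMeasurableFun.Build _ _ _ _ (cav c) measurable_cav.

(** The law of [cav c (X_1 + ... + X_K)] with [K] distributed as [q], independent of the i.i.d.
    [X_i] of law [mu], written as a mixture of push-forwards. *)
Definition cavlaw_meas mu : set R -> \bar R :=
  mseries (fun k => mscale (NngNum (q0 k))
    (distribution (sumlaw mu k) (cav c : {mfun R >-> R}))) 0.

HB.instance Definition _ mu := Measure.on (cavlaw_meas mu).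

Lemma eseries_q1 : (\sum_(k <oo) (q k)%:E)%E = 1%E.
Proof.
apply/cvg_lim => //.
rewrite (_ : (fun n => _) = EFin \o (fun n => \sum_(k < n) q k)); last first.
  by apply/funext => n /=; rewrite -sumEFin big_mkord.
by apply/cvg_EFin; [exact: nearW | exact: q1].
Qed.

Lemma cavlaw_setT mu : cavlaw_meas mu setT = 1%E.
Proof.
rewrite -eseries_q1 /cavlaw_meas /mseries; apply: eq_eseriesr => k _.
rewrite /mscale -[RHS]mule1; congr (_ * _)%E; exact: (probability_setT (distribution _ _)).
Qed.

HB.instance Definition _ mu := Measure_isProbability.Build _ _ _ (cavlaw_meas mu) (cavlaw_setT mu).

Definition cavlaw mu : probability R R := cavlaw_meas mu.

Lemma cavlawE mu (A : set R) :
  cavlaw mu A = (\sum_(k <oo) (q k)%:E * sumlaw mu k (cav c @^-1` A))%E.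
Proof. by []. Qed.

End cavity_operator.

(** A pointwise limit of functions continuous everywhere; at 0 they vanish, in agreement with the
    convention for [0^-1]. *)
Lemma measurable_invr {R : realType} : measurable_fun setT (fun v : R => v^-1).
Proof.
apply: (@measurable_fun_cvg _ R R setT (fun n (v : R) => v / (v ^+ 2 + n.+1%:R^-1)) (fun v => v^-1)) => //.
  move=> n; apply: continuous_measurable_fun => v.
  apply: cvgM; first exact: cvg_id.
  apply: cvgV; first by rewrite gt_eqF// ltr_wpDl ?sqr_ge0// invr_gt0 ltr0n.
  apply: cvgD; last exact: cvg_cst.
  exact: exprn_continuous.
move=> v _; have [->|v0] := eqVneq v 0.
  by rewrite invr0; under eq_fun do rewrite mul0r; exact: cvg_cst.
rewrite (_ : v^-1 = v / (v ^+ 2 + 0)); last by field.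
apply: cvgM; first exact: cvg_cst.
apply: cvgV; first by rewrite addr0 expf_neq0.
by apply: cvgD; [exact: cvg_cst | exact: cvg_harmonic].
Qed.

Section cavity_operator.
Context {R : realType}.
Variables (q : nat -> R) (q0 : forall k, 0 <= q k).
Hypothesis q1 : (fun n => \sum_(k < n) q k) @ \oo --> (1 : R).
Variables (c : R) (c0 : 0 < c).
Implicit Types (mu nu : probability R R) (f : R -> R).

Local Notation Phi := (cavlaw q0 q1 c0).

Lemma supp01_cavlaw mu : supp01 (Phi mu).
Proof.
rewrite /supp01 cavlawE -(eseries_q1 q1); apply: eq_eseriesr => k _.
rewrite (_ : cav c @^-1` _ = setT) ?probability_setT ?mule1//.
by apply/seteqP; split => // s _ /=; exact: cav_bounds.
Qed.

Lemma bdmeas_cav f : bdmeas f -> bdmeas (f \o cav c).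
Proof.
move=> [mf [M fM]]; split; last by exists M => s /=.
by apply: (measurableT_comp mf); exact: measurable_cav.
Qed.

Lemma mix_ge0_cvg (a : nat -> R) M : (forall k, 0 <= a k <= M) ->
  cvg ((fun n => \sum_(k < n) q k * a k) @ \oo).
Proof.
move=> aM; apply: nondecreasing_is_cvgn.
  apply/nondecreasing_seqP => n; rewrite big_ord_recr/= lerDl mulr_ge0//.
  by case/andP: (aM n).
exists M => _ [n _ <-].
have M0 : 0 <= M by case/andP: (aM 0%N) => ? ?; exact: le_trans (_ : a 0%N <= M).
apply: (@le_trans _ _ (\sum_(k < n) q k * M)).
  by apply: ler_sum => k _; apply: ler_wpM2l => //; case/andP: (aM k).
rewrite -mulr_suml ler_piMl//.
have nd : nondecreasing_seq (fun n => \sum_(k < n) q k).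
  by apply/nondecreasing_seqP => i; rewrite big_ord_recr/= lerDl.
have := nondecreasing_cvgn_le nd (ltac:(by apply/cvg_ex; exists 1)) n.
by rewrite (cvg_lim _ q1).
Qed.

Lemma Ex_cavlaw mu f : bdmeas f ->
  (fun n => \sum_(k < n) q k * Ex (sumlaw mu k) (f \o cav c)) @ \oo --> Ex (Phi mu) f.
Proof.
move=> bf.
(* Integration against a series of measures is done for nonnegative functions; adding the bound [M]
   shifts both sides by [M], since the weights sum to 1. *)
wlog f0 : f bf / forall y, 0 <= f y.
  move=> W; have [mf [M fM]] := bf.
  have bg : bdmeas (fun y => f y + M) by apply: bdmeasD => //; exact: bdmeas_cst.
  have g0 y : 0 <= f y + M by have := fM y; rewrite ler_norml => /andP[+ _]; lra.
  have := W _ bg g0; rewrite ExD//; last exact: bdmeas_cst.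
  rewrite Ex_cst => Wg.
  rewrite (_ : (fun n => _) = (fun n => \sum_(k < n) q k * Ex (sumlaw mu k) ((fun y => f y + M) \o cav c) - (\sum_(k < n) q k) * M)).
    have H := cvgB Wg (cvgM q1 (cvg_cst M)); rewrite mul1r addrK in H; exact: H.
  apply/funext => n /=; rewrite mulr_suml -sumrB; apply: eq_bigr => k _.
  rewrite (ExD (sumlaw mu k) (bdmeas_cav bf) (bdmeas_cst M)) Ex_cst; ring.
have f0E y : (0 <= (f y)%:E)%E by rewrite lee_fin.
have mfE : measurable_fun setT (fun y => (f y)%:E) by apply/measurable_EFinP; case: bf.
have H : (\int[Phi mu]_y (f y)%:E)%E = (\sum_(k <oo) (q k * Ex (sumlaw mu k) (f \o cav c))%:E)%E.
  rewrite [LHS]ge0_integral_measure_series//; apply: eq_eseriesr => k _.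
  rewrite ge0_integral_mscale// EFinM; congr (_ * _)%E.
  by rewrite ge0_integral_distribution// -Ex_EFin//; exact: bdmeas_cav.
rewrite Ex_EFin// in H.
have C : (fun n => (\sum_(k < n) q k * Ex (sumlaw mu k) (f \o cav c))%:E) @ \oo --> (Ex (Phi mu) f)%:E.
  rewrite H; under eq_fun do rewrite -sumEFin -(big_mkord xpredT (fun k => (q k * Ex (sumlaw mu k) (f \o cav c))%:E)).
  apply: is_cvg_nneseries => k _ _; rewrite lee_fin mulr_ge0//.
  by apply: Ex_ge0 => y /=.
have H2 := fine_cvg C; exact: H2.
Qed.

Lemma le_cvg_mix (a b : nat -> R) (la lb : R) : (forall k, a k <= b k) ->
  (fun n => \sum_(k < n) q k * a k) @ \oo --> la ->
  (fun n => \sum_(k < n) q k * b k) @ \oo --> lb -> la <= lb.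
Proof.
move=> ab ca cb; apply: (ler_cvg_to ca cb); apply: nearW => n.
by apply: ler_sum => k _; rewrite ler_wpM2l.
Qed.

Lemma cavlaw_anti mu nu : st_le mu nu -> st_le (Phi nu) (Phi mu).
Proof.
move=> mn f bf df; have bm := blip_bdmeas bf.
apply: (le_cvg_mix _ (@Ex_cavlaw nu _ bm) (@Ex_cavlaw mu _ bm)) => k.
apply: (st_le_anti (st_le_sumlaw k mn)).
  by apply: blip_comp bf _; exists c^-1; exact: cav_lip.
by move=> s t st /=; apply: df; exact: cav_anti.
Qed.

Definition EYc mu : R := limn (fun n => \sum_(k < n) q k * Ex (sumlaw mu k) (cav c)).

Lemma EYc_cvg mu :
  (fun n => \sum_(k < n) q k * Ex (sumlaw mu k) (cav c)) @ \oo --> EYc mu.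
Proof.
apply: (@mix_ge0_cvg (fun k => Ex (sumlaw mu k) (cav c)) 1) => k; have bm := blip_bdmeas (blip_cav c0).
apply/andP; split; first by apply: Ex_ge0 => y; exact: cav_ge0.
rewrite -[leRHS](Ex_cst (sumlaw mu k)); apply: le_Ex => //; first exact: bdmeas_cst.
by move=> y; exact: cav_le1.
Qed.

Lemma EYc_anti mu nu : st_le mu nu -> EYc nu <= EYc mu.
Proof.
move=> mn; apply: (@le_cvg_mix (fun k => Ex (sumlaw nu k) (cav c)) (fun k => Ex (sumlaw mu k) (cav c)) _ _ _ (@EYc_cvg nu) (@EYc_cvg mu)) => k.
apply: (st_le_anti (st_le_sumlaw k mn)); first exact: blip_cav.
exact: cav_anti.
Qed.

(** By monotonicity no degree contributes negatively to the difference, so the strict gain of the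
    single degree [k.+1] is kept. *)
Lemma EYc_gap mu nu k : st_le mu nu ->
  q k.+1 * (c / (c + k.+1%:R) ^+ 2) * (meanc nu - meanc mu) <= EYc mu - EYc nu.
Proof.
move=> mn.
pose a n := \sum_(k < n) q k * Ex (sumlaw mu k) (cav c) - \sum_(k < n) q k * Ex (sumlaw nu k) (cav c).
have ca : a @ \oo --> EYc mu - EYc nu by apply: cvgB; exact: EYc_cvg.
rewrite -(cvg_lim _ ca)//; apply: limr_ge; first by apply/cvg_ex; exists (EYc mu - EYc nu).
exists k.+2 => // n /= kn; rewrite /a -sumrB.
rewrite (bigD1 (Ordinal kn))//= -mulrBr -[leLHS]addr0 lerD//.
  by rewrite -mulrA ler_wpM2l// cav_sumlaw_gap.
apply: sumr_ge0 => i _; rewrite -mulrBr mulr_ge0// subr_ge0.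
by apply: (st_le_anti (st_le_sumlaw i mn)); [exact: blip_cav | exact: cav_anti].
Qed.

Lemma EY_EYc x mu : c = x ^+ 2 -> supp01 mu -> EY q x mu = (EYc mu)%:E.
Proof.
move=> cx smu; apply/cvg_lim => //.
rewrite (_ : (fun n => _) = EFin \o (fun n => \sum_(k < n) q k * Ex (sumlaw mu k) (cav c))); last first.
  apply/funext => n /=; rewrite -sumEFin big_mkord; apply: eq_bigr => k _.
  rewrite EFinM; congr (_ * _)%E; rewrite -cx.
  have mF : measurable_fun setT (fun s : R => c / (c + s)).
    apply: measurable_funM => //; apply: (measurableT_comp measurable_invr).
    exact: measurable_funD.
  have := @iint_sumlaw R mu k (fun s => c / (c + s)) (cav c) 0 smu mF (blip_bdmeas (blip_cav c0)).
  rewrite (_ : (fun t => _) = (fun s => (c / (c + \sum_(y <- s) y))%:E)); last first.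
    by apply/funext => t; rewrite add0r.
  move=> ->//; first congr (Ex _ _)%:E.
    by apply/funext => s; rewrite add0r /cav (posr_id (posr_ge0 s)).
  by move=> s s0; rewrite cavE.
by apply/cvg_EFin; [exact: nearW | exact: EYc_cvg].
Qed.

Lemma rde_rhs_cavlaw x mu (A : set R) : c = x ^+ 2 -> supp01 mu -> measurable A ->
  rde_rhs q x mu A = Phi mu A.
Proof.
move=> cx smu mA; rewrite cavlawE; apply: eq_eseriesr => k _; congr (_ * _)%E.
have mF : measurable_fun setT (fun s : R => \1_A (c / (c + s)) : R).
  apply: (measurableT_comp (measurable_indic mA)); apply: measurable_funM => //.
  by apply: (measurableT_comp measurable_invr); exact: measurable_funD.
have mcA : measurable (cav c @^-1` A).
  by rewrite -[X in measurable X]setTI; apply: measurable_cav.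
have bf : bdmeas (\1_A \o cav c : R -> R).
  apply: bdmeas_cav; split; first exact: measurable_indic.
  by exists 1 => y; rewrite indicE ger0_norm// lern1 leq_b1.
have := @iint_sumlaw R mu k _ _ 0 smu mF bf.
rewrite (_ : (fun t => _) = (fun s => (\1_A (x ^+ 2 / (x ^+ 2 + \sum_(y <- s) y)))%:E)); last first.
  by apply/funext => t; rewrite add0r -cx.
move=> ->//; last by move=> s s0 /=; rewrite cavE.
have -> : (fun s => (\1_A \o cav c) (0 + posr s)) = \1_(cav c @^-1` A) :> (R -> R).
  by apply/funext => s /=; rewrite add0r /cav (posr_id (posr_ge0 s)) -/(cav c s).
rewrite -Ex_EFin; first by rewrite integral_indic// setIT.
split; first exact: measurable_indic.
by exists 1 => y; rewrite indicE ger0_norm// lern1 leq_b1.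
Qed.

End cavity_operator.

(** * Unimodularity and the limit of the truncated laws *)

Section unimodular.
Context {R : realType}.
Variables (P rho : nat -> R) (Pbar : R).
Hypotheses (P0 : forall k, 0 <= P k)
  (P1 : (fun n => \sum_(k < n) P k) @ \oo --> (1 : R))
  (PbarE : (fun n => \sum_(k < n) k%:R * P k) @ \oo --> Pbar)
  (Pbar0 : 0 < Pbar)
  (rhoE : forall k, rho k = k.+1%:R * P k.+1 / Pbar).
Implicit Types (mu nu : probability R R).

Lemma rho_ge0 k : 0 <= rho k.
Proof. by rewrite rhoE divr_ge0 ?mulr_ge0// ltW. Qed.

Lemma rho_sum1 : (fun n => \sum_(k < n) rho k) @ \oo --> (1 : R).
Proof.
rewrite (_ : (fun n => _) = (fun n => (\sum_(k < n + 1) k%:R * P k) * Pbar^-1)).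
  rewrite -[X in _ --> X](divff (lt0r_neq0 Pbar0)).
  apply: cvgM; last exact: cvg_cst.
  by have H := PbarE; rewrite -(cvg_shiftn 1) in H; exact: H.
apply/funext => n; rewrite addn1 big_ord_recl mul0r add0r mulr_suml.
by apply: eq_bigr => k _; rewrite rhoE.
Qed.

Variables (c : R) (c0 : 0 < c).

Local Notation Phi := (cavlaw rho_ge0 rho_sum1 c0).
Local Notation EYP := (EYc P c).

(** On a tree, messages [y] and [a] across an edge put it in the matching with probability
    [y a / (c + y a)], that is [1 - c / (c + y a)]; here [y] is averaged over [mu]. *)
Definition edge_prob mu (a : R) : R :=
  Ex mu (fun y => 1 - cav c (clip01 y * clip01 a)).

Let kern (p : R * R) := 1 - cav c (clip01 p.1 * clip01 p.2).

Let bd_kern : bdmeas kern.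
Proof.
apply: bdmeasB; first exact: bdmeas_cst.
split.
  apply: (measurableT_comp (measurable_cav c0)).
  apply: measurable_funM; apply: (measurableT_comp measurable_clip01) => //.
by exists 1 => p; rewrite ger0_norm ?cav_le1 ?cav_ge0.
Qed.

Let bd_kern1 a : bdmeas (fun y => 1 - cav c (clip01 y * clip01 a)).
Proof.
apply: bdmeasB; first exact: bdmeas_cst.
split; last by exists 1 => y; rewrite ger0_norm ?cav_le1 ?cav_ge0.
apply: (measurableT_comp (measurable_cav c0)); apply: measurable_funM => //.
exact: measurable_clip01.
Qed.

Lemma edge_prob_lip mu a b : `|edge_prob mu a - edge_prob mu b| <= c^-1 * `|clip01 a - clip01 b|.
Proof.
rewrite /edge_prob -ExB//; apply: normr_Ex; first exact: bdmeasB.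
move=> y.
rewrite (_ : _ - _ = cav c (clip01 y * clip01 b) - cav c (clip01 y * clip01 a)); last by ring.
rewrite (le_trans (cav_lip c0 _ _))// ler_wpM2l ?invr_ge0 ?(ltW c0)//.
rewrite -mulrBr normrM (ger0_norm (clip01_ge0 y)) distrC.
by rewrite ler_piMl// clip01_le1.
Qed.

Lemma blip_edge_prob mu : blip (edge_prob mu).
Proof.
split.
  exists c^-1 => a b; rewrite (le_trans (edge_prob_lip _ _ _))//.
  by rewrite ler_wpM2l ?invr_ge0 ?(ltW c0)// clip01_lip.
by case: bd_kern => mk [M kM]; exists M => a; apply: normr_Ex => // y; exact: (kM (y, a)).
Qed.

Lemma edge_prob_sym mu nu : Ex mu (edge_prob nu) = Ex nu (edge_prob mu).
Proof.
rewrite /edge_prob -(Ex_swap nu mu bd_kern); congr Ex; apply/funext => a.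
by congr Ex; apply/funext => y; rewrite /kern/= mulrC.
Qed.

(* Counting covered half-edges from both endpoints: unimodularity turns the
   root degree bias into an independent pair of messages along one edge. *)
Lemma EYc_edge mu : EYP mu = 1 - Pbar * Ex (Phi mu) (edge_prob mu).
Proof.
have bc := blip_bdmeas (blip_cav c0).
pose u (s : R) := (c + posr s)^-1.
(* Exchangeability turns [s / (c + s)] into [k.+1] copies of [y / (c + y + s)], which equals
   [y a / (c + y a)] for the message [a = c / (c + s)]. *)
have step k : Ex (sumlaw mu k.+1) (fun s => 1 - cav c s) =
    k.+1%:R * Ex (sumlaw mu k) (edge_prob mu \o cav c).
  have -> : (fun s => 1 - cav c s) = (fun s => posr s * u (posr s)).
    apply/funext => s; rewrite /u /cav (posr_id (posr_ge0 s)); field.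
    by rewrite gt_eqF// cav_den_gt0.
  rewrite (@Ex_sumlaw_exchange _ mu k u (c^-1 + 1)); last 3 first.
  - apply: (measurableT_comp measurable_invr); apply: measurable_funD => //.
    exact: measurable_posr.
  - move=> s s0; rewrite /u invr_ge0 (ltW (cav_den_gt0 _ c0))/=.
    rewrite ler_wpDr// lef_pV2 ?posrE ?cav_den_gt0//.
    by rewrite lerDl posr_ge0.
  - move=> s s0; rewrite /u posr_id// ler_wpDl ?invr_ge0 ?(ltW c0)//.
    by rewrite ler_pdivrMr ?mul1r ?ltr_wpDr// lerDr ltW.
  congr (_ * _).
  transitivity (Ex mu (fun y => Ex (sumlaw mu k) (fun s => kern (y, cav c s)))).
    congr Ex; apply/funext => y; congr Ex; apply/funext => s; rewrite /kern /u/=.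
    have y0 := clip01_ge0 y; have s0 := posr_ge0 s.
    have d1 : 0 < c + posr s by rewrite ltr_wpDr.
    have d2 : 0 < c + (clip01 y + posr s) by rewrite ltr_wpDr// addr_ge0.
    rewrite [clip01 (cav c s)]clip01_id ?cav_bounds// [cav c (_ * _)]cavE; last first.
      by rewrite mulr_ge0// cav_ge0.
    rewrite posr_id ?addr_ge0// /cav; field.
    rewrite !gt_eqF//= ltr_wpDr ?mulr_gt0//.
    by rewrite mulr_ge0// ltW.
  have bK : bdmeas (fun p : R * R => kern (p.1, cav c p.2)).
    case: bd_kern => mk [M kM]; split; last by exists M => p; exact: kM.
    apply: (measurableT_comp mk); apply: measurable_fun_pair => //.
    exact: (measurableT_comp (measurable_cav c0)).
  rewrite (Ex_swap _ _ bK); congr Ex; apply/funext => s.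
have H : (fun n => \sum_(k < n) P k - \sum_(k < n) P k * Ex (sumlaw mu k) (cav c)) @ \oo --> 1 - EYP mu.
  by apply: cvgB => //; exact: EYc_cvg.
have H' : (fun n => \sum_(k < n) rho k * Ex (sumlaw mu k) (edge_prob mu \o cav c)) @ \oo --> Ex (Phi mu) (edge_prob mu).
  exact/Ex_cavlaw/blip_bdmeas/blip_edge_prob.
suff : 1 - EYP mu = Pbar * Ex (Phi mu) (edge_prob mu) by lra.
have Hs := H; rewrite -(cvg_shiftn 1) in Hs.
apply: (cvg_unique _ Hs) => //.
rewrite (_ : (fun n => _) = (fun n => Pbar * \sum_(k < n) rho k * Ex (sumlaw mu k) (edge_prob mu \o cav c))).
  by apply: cvgM => //; exact: cvg_cst.
(* An isolated root is never covered, so degree 0 drops out; for degree [k.+1], the product of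
   [k.+1] and [P k.+1] is [Pbar * rho k]. *)
apply/funext => n; rewrite /= addn1 -sumrB big_ord_recl /= Ex_dirac// /cav.
rewrite (posr_id (lexx 0)) addr0 divff ?gt_eqF// mulr1 subrr add0r mulr_sumr.
apply: eq_bigr => k _; rewrite /bump/= add1n -[X in X - _]mulr1 -mulrBr -[X in X - _](Ex_cst (sumlaw mu k.+1)).
rewrite -ExB//; last exact: bdmeas_cst.
rewrite -/(cav c) step rhoE mulrA mulrCA; field.
by rewrite gt_eqF.
Qed.

Lemma st_le_dirac1 mu : supp01 mu -> st_le mu (\d_(1 : R)).
Proof.
move=> smu f bf df; have bm := blip_bdmeas bf.
rewrite Ex_dirac// -[leRHS](Ex_cst mu).
apply: (le_Ex_supp measurable_01 smu) => //; first exact: bdmeas_cst.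
by move=> y /andP[_ y1]; exact: df.
Qed.

(** The law of the message truncated at depth [r]. It starts from the largest law on [[0, 1]], so
    the order-reversing [Phi] makes the iterates alternate around any fixed point. *)
Definition cavseq r : probability R R := iter r Phi (\d_(1 : R)).

Lemma supp01_cavseq r : supp01 (cavseq r).
Proof.
case: r => [|r]; last exact: supp01_cavlaw.
by rewrite /supp01 /= diracE mem_set//= ler01 lexx.
Qed.

Lemma cavseq_step2 r : if odd r then st_le (cavseq r) (cavseq r.+2)
                       else st_le (cavseq r.+2) (cavseq r).
Proof.
elim: r => [|r IH]; first exact/st_le_dirac1/supp01_cavlaw.
rewrite /=; move: IH; case: (odd r) => /= IH; exact: cavlaw_anti IH.
Qed.

Lemma cavseq_step1 r : if odd r then st_le (cavseq r) (cavseq r.+1)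
                       else st_le (cavseq r.+1) (cavseq r).
Proof.
elim: r => [|r IH]; first exact/st_le_dirac1/supp01_cavlaw.
rewrite /=; move: IH; case: (odd r) => /= IH; exact: cavlaw_anti IH.
Qed.

Lemma cavseq_even_le i j : (i <= j)%N -> st_le (cavseq j.*2) (cavseq i.*2).
Proof.
move=> /subnK <-; elim: (j - i)%N => [|k IH]; first exact: st_le_refl.
apply: st_le_trans IH; rewrite addSn doubleS.
by have := cavseq_step2 (k + i).*2; rewrite odd_double.
Qed.

Lemma cavseq_odd_le i j : (i <= j)%N -> st_le (cavseq i.*2.+1) (cavseq j.*2.+1).
Proof.
move=> /subnK <-; elim: (j - i)%N => [|k IH]; first exact: st_le_refl.
apply: (st_le_trans IH); rewrite addSn doubleS.
by have := cavseq_step2 (k + i).*2.+1; rewrite /= odd_double.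
Qed.

Lemma cavseq_odd_even i j : st_le (cavseq i.*2.+1) (cavseq j.*2).
Proof.
apply: st_le_trans (cavseq_odd_le (leq_maxl i j)) _.
apply: st_le_trans (cavseq_even_le (leq_maxr i j)).
by have := cavseq_step1 (maxn i j).*2; rewrite odd_double.
Qed.

(** The common device for existence and uniqueness: fixed points are sandwiched, [Phi] preserves the
    property, and [sandwiched_le] shows that at most one law has it. *)
Definition sandwiched mu := forall j, st_le (cavseq j.*2.+1) mu /\ st_le mu (cavseq j.*2).

Lemma sandwiched_Phi mu : sandwiched mu -> sandwiched (Phi mu).
Proof.
move=> smu j; split; first exact: (cavlaw_anti _ _ _ (smu j).2).
case: j => [|j]; first exact/st_le_dirac1/supp01_cavlaw.
by rewrite doubleS; exact: (cavlaw_anti _ _ _ (smu j).1).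
Qed.

Lemma sandwiched_fix nu : supp01 nu -> st_le nu (Phi nu) -> st_le (Phi nu) nu ->
  sandwiched nu.
Proof.
move=> snu n1 n2.
have H r : if odd r then st_le (cavseq r) nu else st_le nu (cavseq r).
  elim: r => [|r] /=; first exact: st_le_dirac1.
  case: (odd r) => /= IH; first exact: st_le_trans n1 (cavlaw_anti _ _ _ IH).
  exact: st_le_trans (cavlaw_anti _ _ _ IH) n2.
by move=> j; split; [have := H j.*2.+1; rewrite /= odd_double | have := H j.*2; rewrite odd_double].
Qed.

Local Notation m r := (meanc (cavseq r)).

(** By [EYc_edge] the two terms involve messages of depths [2j+2, 2j+1] and [2j+1, 2j]. Symmetry
    aligns the common depth [2j+1], leaving one function, Lipschitz with constant [c^-1], tested
    against depths [2j] and [2j+2]. *)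
Lemma EYc_step_le j : EYP (cavseq j.*2.+1) - EYP (cavseq j.*2) <=
  Pbar / c * (m j.*2 - m j.*2.+2).
Proof.
rewrite !EYc_edge -[Phi (cavseq j.*2.+1)]/(cavseq j.*2.+2) -[Phi (cavseq j.*2)]/(cavseq j.*2.+1).
rewrite [Ex (cavseq j.*2.+1) _]edge_prob_sym.
set A := Ex _ _; set B := Ex _ _.
have -> : 1 - Pbar * A - (1 - Pbar * B) = Pbar * (B - A) by ring.
rewrite -mulrA ler_wpM2l ?(ltW Pbar0)//.
have s2 : st_le (cavseq j.*2.+2) (cavseq j.*2).
  by have := cavseq_step2 j.*2; rewrite odd_double.
have := st_le_lip s2 (edge_prob_lip (cavseq j.*2.+1)) (blip_edge_prob _).
by apply: le_trans; exact: ler_norm.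
Qed.

Lemma exists_degree_gt0 : exists k, 0 < P k.+1.
Proof.
apply/not_existsP => H; have Pz k : P k.+1 = 0.
  by apply/eqP; rewrite eq_le P0 andbT leNgt; apply/negP => /H.
move: Pbar0; have -> : Pbar = 0; last by rewrite ltxx.
apply: (cvg_unique _ PbarE) => //.
rewrite (_ : (fun n => _) = (fun=> 0)); first exact: cvg_cst.
apply/funext => n; apply: big1 => -[[|k] ?] _ /=; first by rewrite mul0r.
by rewrite Pz mulr0.
Qed.

(** The upper bound [EYc_step_le] meets the lower bound [EYc_gap] at a degree of positive
    probability; [C] is the quotient of their constants. *)
Lemma meanc_step_le : exists2 C, 0 <= C & forall j, m j.*2 - m j.*2.+1 <= C * (m j.*2 - m j.*2.+2).
Proof.
have [k Pk] := exists_degree_gt0.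
set kap := P k.+1 * (c / (c + k.+1%:R) ^+ 2).
have kap0 : 0 < kap by rewrite mulr_gt0// divr_gt0// exprn_gt0// ltr_wpDr.
exists (Pbar / c / kap); first by rewrite !divr_ge0// ltW.
move=> j; rewrite mulrAC ler_pdivlMr// mulrC.
apply: le_trans (EYc_step_le j); apply: EYc_gap => //.
by have := cavseq_step1 j.*2; rewrite odd_double.
Qed.

Lemma meanc_step2_cvg0 : (fun j => m j.*2 - m j.*2.+2) @ \oo --> (0 : R).
Proof.
have ni : nonincreasing_seq (fun j => m j.*2).
  by move=> i j ij; apply: st_le_meanc; exact: cavseq_even_le.
have cv : cvgn (fun j => m j.*2).
  apply: nonincreasing_is_cvgn => //; exists 0 => _ [j _ <-].
  by apply: Ex_ge0 => y; exact: clip01_ge0.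
have cv1 := cv; rewrite /= -(cvg_shiftn 1) in cv1.
have H := cvgB cv cv1; rewrite subrr in H.
rewrite (_ : (fun j => _) = (fun j => m j.*2 - m (j + 1).*2)); first exact: H.
by apply/funext => j; rewrite addn1 doubleS.
Qed.

Lemma meanc_step1_cvg0 : (fun j => m j.*2 - m j.*2.+1) @ \oo --> (0 : R).
Proof.
have [C C0 HC] := meanc_step_le.
apply: (@squeeze_cvgr _ _ _ _ (fun=> 0) (fun j => C * (m j.*2 - m j.*2.+2))).
- apply: nearW => j; rewrite HC andbT subr_ge0; apply: st_le_meanc.
  by have := cavseq_step1 j.*2; rewrite odd_double.
- exact: cvg_cst.
- by rewrite -(mulr0 C); apply: cvgM; [exact: cvg_cst | exact: meanc_step2_cvg0].
Qed.

Lemma EYc_step_cvg0 : (fun j => EYP (cavseq j.*2.+1) - EYP (cavseq j.*2)) @ \oo --> (0 : R).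
Proof.
apply: (@squeeze_cvgr _ _ _ _ (fun=> 0) (fun j => Pbar / c * (m j.*2 - m j.*2.+2))).
- apply: nearW => j; rewrite EYc_step_le andbT subr_ge0; apply: EYc_anti => //.
  by have := cavseq_step1 j.*2; rewrite odd_double.
- exact: cvg_cst.
- by rewrite -(mulr0 (Pbar / c)); apply: cvgM; [exact: cvg_cst | exact: meanc_step2_cvg0].
Qed.

Lemma Ex_clip01 mu (f : R -> R) : supp01 mu -> blip f -> Ex mu (f \o clip01) = Ex mu f.
Proof.
move=> smu bf; have b1 := blip_bdmeas bf.
have b2 : bdmeas (f \o clip01) by apply/blip_bdmeas/(blip_comp bf); exact: blip_clip01.1.
by apply/eqP; rewrite eq_le; apply/andP; split;
  apply: (le_Ex_supp measurable_01 smu) => // y y01 /=; rewrite clip01_id.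
Qed.

(** [mu] lies below the even iterates and [nu] above the odd ones, and on an [L]-Lipschitz test
    function these differ by at most [L] times a vanishing difference of means. *)
Lemma sandwiched_le mu nu : sandwiched mu -> sandwiched nu -> st_le mu nu.
Proof.
move=> smu snu f bf df; have [[L Lf] _] := bf.
have cvL : (fun j => Ex nu f + L * (m j.*2 - m j.*2.+1)) @ \oo --> Ex nu f.
  rewrite -[X in _ --> X]addr0 -(mulr0 L); apply: cvgD; first exact: cvg_cst.
  by apply: cvgM; [exact: cvg_cst | exact: meanc_step1_cvg0].
rewrite -(cvg_lim _ cvL)//; apply: limr_ge; first by apply/cvg_ex; exists (Ex nu f).
apply: nearW => j.
apply: le_trans ((smu j).2 f bf df) _; rewrite -lerBlDl.
apply: le_trans (_ : Ex (cavseq j.*2) f - Ex (cavseq j.*2.+1) f <= _).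
  by rewrite lerD2l lerN2; exact: (snu j).1.
(* [st_le_lip] requires variation controlled by that of [clip01]; replacing [f] by [f \o clip01]
   changes nothing on laws carried by [[0, 1]]. *)
have bfc : blip (f \o clip01) by apply: (blip_comp bf); exact: blip_clip01.1.
rewrite -!(Ex_clip01 (supp01_cavseq _) bf).
apply: le_trans (ler_norm _) _.
apply: (st_le_lip (cavseq_odd_even j j)) => // y z; exact: Lf.
Qed.

Lemma dfn_supp_lt0 mu t : supp01 mu -> t < 0 -> dfn mu t = 0.
Proof.
move=> smu t0; apply: EFin_inj; rewrite -dfnE; apply/eqP; rewrite -measure_le0.
have H : mu (~` [set y | 0 <= y <= 1]) = 0%E.
  by rewrite [LHS]probability_setC ?smu ?subee//; exact: measurable_01.
rewrite -H le_measure ?inE//; first by apply: measurableC; exact: measurable_01.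
move=> y /=; rewrite in_itv/= => yt; apply/negP; rewrite negb_and -ltNge.
by rewrite (le_lt_trans yt).
Qed.

Lemma dfn_supp_ge1 mu t : supp01 mu -> 1 <= t -> dfn mu t = 1.
Proof.
move=> smu t1; apply/eqP; rewrite eq_le dfn_le1 -lee_fin -dfnE -smu /=.
rewrite le_measure ?inE//; first exact: measurable_01.
by move=> y /= /andP[_ y1]; rewrite in_itv/= (le_trans y1).
Qed.

(** Odd iterates increase, so their distribution functions decrease in [j], and an infimum of
    nondecreasing right-continuous functions is again of that kind. *)
Lemma exists_sandwiched : exists mu : probability R R, sandwiched mu.
Proof.
pose S t := [set dfn (cavseq j.*2.+1) t | j in [set: nat]].
have hS t : has_inf (S t).
  split; first by exists (dfn (cavseq 1) t); exists 0%N.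
  by exists 0 => _ [j _ <-]; exact: dfn_ge0.
have infle t j : inf (S t) <= dfn (cavseq j.*2.+1) t.
  by apply: ge_inf; [case: (hS t) | exists j].
have [mu muE] : exists mu : probability R R, dfn mu =1 (fun t => inf (S t)).
  apply: exists_law.
  - move=> s t st; apply: lb_le_inf; first by case: (hS t).
    by move=> _ [j _ <-]; apply: le_trans (infle s j) _; exact: dfn_homo.
  - move=> t e e0; have e2 : 0 < e / 2 by rewrite divr_gt0.
    have [_ [j _ <-] Hj] := inf_adherent e2 (hS t).
    have [d d0 Hd] := dfn_right_continuous (cavseq j.*2.+1) t e2.
    exists d => //; apply: le_trans (infle _ j) _; apply: le_trans Hd _.
    by rewrite [in leRHS](splitr e) addrA lerD2r ltW.
  - move=> t t0; rewrite (_ : S t = [set 0]) ?inf1//.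
    apply/seteqP; split => [_ [j _ <-]|_ ->]; first exact: (dfn_supp_lt0 (supp01_cavseq _) t0).
    by exists 0%N => //; exact: (dfn_supp_lt0 (supp01_cavseq _) t0).
  - move=> t t0; rewrite (_ : S t = [set 1]) ?inf1//.
    apply/seteqP; split => [_ [j _ <-]|_ ->]; first exact: (dfn_supp_ge1 (supp01_cavseq _) t0).
    by exists 0%N => //; exact: (dfn_supp_ge1 (supp01_cavseq _) t0).
exists mu => j; split; apply: dfn_st_le => t; rewrite muE; first exact: infle.
apply: lb_le_inf; first by case: (hS t).
by move=> _ [i _ <-]; apply: st_le_dfn; exact: cavseq_odd_even.
Qed.

Lemma eq_meas_st_le mu nu : (forall A, measurable A -> mu A = nu A) -> st_le mu nu.
Proof.
move=> mn f bf df; rewrite /Ex /Rintegral.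
by rewrite (eq_measure_integral nu)// => A mA _; exact: mn.
Qed.

Theorem cavity_law : exists mu : probability R R,
  [/\ supp01 mu, forall A, measurable A -> mu A = Phi mu A,
      forall nu : probability R R, supp01 nu -> (forall A, measurable A -> nu A = Phi nu A) ->
        forall A, measurable A -> nu A = mu A &
      forall j, EYP (cavseq j.*2) <= EYP mu <= EYP (cavseq j.*2.+1)].
Proof.
have [mu smu] := exists_sandwiched; have spmu := sandwiched_Phi smu.
have fix_mu A : measurable A -> mu A = Phi mu A.
  by apply: st_le_eq; exact: sandwiched_le.
exists mu; split => //.
- by rewrite /supp01 fix_mu; [exact: supp01_cavlaw | exact: measurable_01].
- move=> nu snu fix_nu; have : sandwiched nu.
    by apply: sandwiched_fix => //; apply: eq_meas_st_le => A mA; rewrite -fix_nu.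
  by move=> swnu; apply: st_le_eq; exact: sandwiched_le.
- by move=> j; rewrite !EYc_anti//; [exact: (smu j).1 | exact: (smu j).2].
Qed.

End unimodular.

(** * Galton--Watson sums and local convergence *)

Section tree_sums.
Context {R : realType}.

Lemma lists_prod_sum (A : Type) k (s : seq A) (w : A -> R) :
  \sum_(l <- lists k s) \prod_(a <- l) w a = (\sum_(a <- s) w a) ^+ k.
Proof.
elim: k => [|k IH]; first by rewrite /= big_seq1 big_nil expr0.
rewrite big_lists exprS mulr_suml; apply: eq_bigr => a _.
by rewrite -IH mulr_sumr; apply: eq_bigr => l _; rewrite big_cons.
Qed.

(** A finite list carries only part of the law [mu], hence an inequality for nonnegative functions;
    it extends to [k] independent copies by conditioning on the first. *)
Lemma lists_le_sumlaw (A : Type) (L : seq A) (w val : A -> R) (mu : probability R R) :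
  (forall t, 0 <= w t) -> (forall t, 0 <= val t <= 1) ->
  (forall g, bdmeas g -> (forall y, 0 <= g y) ->
     \sum_(t <- L) w t * g (val t) <= Ex mu g) ->
  forall k f, bdmeas f -> (forall y, 0 <= f y) ->
    \sum_(ts <- lists k L) (\prod_(t <- ts) w t) * f (\sum_(t <- ts) val t)
    <= Ex (sumlaw mu k) f.
Proof.
move=> w0 v01 H; elim=> [|k IH] f bf f0.
  by rewrite /= big_seq1 !big_nil mul1r Ex_dirac.
rewrite big_lists [Ex _ _]/= Ex_convp//.
pose g y := Ex (sumlaw mu k) (fun s => f (clip01 y + posr s)).
apply: le_trans (H g _ _); last 2 first.
- exact: bdmeas_Ex_addc.
- by move=> y; apply: Ex_ge0.
apply: ler_sum => a _.
under eq_bigr do rewrite !big_cons -mulrA.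
rewrite -mulr_sumr ler_wpM2l//; apply: le_trans (IH _ (bdmeas_addc (val a) bf) _); last by [].
apply: ler_sum => l _; rewrite clip01_id// posr_id//.
by apply: sumr_ge0 => t _; case/andP: (v01 t).
Qed.

(** Choose [K] so that the degrees below [K] carry almost all the mass; for them [m n ^ k] is at
    least [m n ^ K], which tends to 1. *)
Lemma mix_pow_cvg (q : nat -> R) (m : nat -> R) : (forall k, 0 <= q k) ->
  (fun n => \sum_(k < n) q k) @ \oo --> (1 : R) ->
  (forall n, 0 <= m n <= 1) -> m @ \oo --> (1 : R) ->
  (fun n => \sum_(k < n) q k * m n ^+ k) @ \oo --> (1 : R).
Proof.
move=> q0 q1 m01 m1; apply/cvgrPdist_le => e e0.
have e2 : 0 < e / 2 by rewrite divr_gt0.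
have /cvgrPdist_lt/(_ _ e2)[K _ HK] := q1.
have cp : (fun n => (\sum_(k < K) q k) * m n ^+ K) @ \oo --> (\sum_(k < K) q k) * 1 ^+ K.
  by apply: cvgM; [exact: cvg_cst | exact: (cvg_comp _ _ m1 (@exprn_continuous R K 1))].
rewrite expr1n mulr1 in cp.
have /cvgrPdist_lt/(_ _ e2) := cp.
have := HK K (leqnn K); rewrite /= ltr_norml => /andP[_ K1].
have nd : nondecreasing_seq (fun n => \sum_(k < n) q k).
  by apply/nondecreasing_seqP => i; rewrite big_ord_recr/= lerDl.
have qle n : \sum_(k < n) q k <= 1.
  rewrite -(cvg_lim _ q1)//; apply: (nondecreasing_cvgn_le nd).
  by apply/cvg_ex; exists 1.
move=> H; near=> n.
have le1 : \sum_(k < n) q k * m n ^+ k <= 1.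
  apply: le_trans (qle n); apply: ler_sum => k _.
  by rewrite ler_piMr// exprn_ile1//; case/andP: (m01 n).
rewrite ger0_norm ?subr_ge0//.
have : `|\sum_(k < K) q k - (\sum_(k < K) q k) * m n ^+ K| < e / 2 by near: n; exact: H.
rewrite ltr_norml => /andP[_ H1].
have Kn : (K <= n)%N by near: n; exact: nbhs_infty_ge.
have : (\sum_(k < K) q k) * m n ^+ K <= \sum_(k < n) q k * m n ^+ k; last by move=> ?; lra.
rewrite -(big_mkord xpredT (fun k => q k * m n ^+ k)) (big_cat_nat (leq0n K) Kn)//= big_mkord -[leLHS]addr0 lerD//.
  rewrite mulr_suml; apply: ler_sum => k _; rewrite ler_wpM2l//.
  by case/andP: (m01 n) => ? ?; rewrite ler_wiXn2l// ltnW.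
by apply: sumr_ge0 => k _; rewrite mulr_ge0 ?exprn_ge0//; case/andP: (m01 n).
Unshelve. all: by end_near. Qed.

Variables (P rho : nat -> R) (Pbar : R).
Hypotheses (P0 : forall k, 0 <= P k)
  (P1 : (fun n => \sum_(k < n) P k) @ \oo --> (1 : R))
  (PbarE : (fun n => \sum_(k < n) k%:R * P k) @ \oo --> Pbar)
  (Pbar0 : 0 < Pbar)
  (rhoE : forall k, rho k = k.+1%:R * P k.+1 / Pbar).
Variables (c : R) (c0 : 0 < c).
Let rho0 : forall k, 0 <= rho k := rho_ge0 P0 Pbar0 rhoE.
Let rho1 := rho_sum1 PbarE Pbar0 rhoE.
Local Notation cavs := (cavseq P0 PbarE Pbar0 rhoE c0).

Lemma gw_weight_ge0 (q : nat -> R) r t : (forall k, 0 <= q k) -> 0 <= gw_weight q rho r t.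
Proof. by move=> q0; apply: prodr_ge0 => u _; case: ifP. Qed.

Lemma gw_weight_height0 (q : nat -> R) t : gw_weight q rho 0 t = 1.
Proof. by rewrite /gw_weight big_pred0. Qed.

Lemma trees_sum_root N r (q : nat -> R) (g : R -> R) :
  \sum_(t <- trees N r.+1) gw_weight q rho r.+1 t * g (tval c r.+1 t [::]) =
  \sum_(k < N) q k * \sum_(ts <- lists k (trees N r))
    (\prod_(t <- ts) gw_weight rho rho r t) * g (cav c (\sum_(t <- ts) tval c r t [::])).
Proof.
rewrite big_trees; apply: eq_bigr => k _; rewrite mulr_sumr.
rewrite big_seq [RHS]big_seq; apply: eq_bigr => ts /lists_ptree[pts sz].
rewrite gw_weight_node// tval_node// sz -mulrA cavE//.
by apply: sumr_ge0 => t _; case/andP: (tval_bounds r t [::] c0).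
Qed.

Lemma trees_le_root N r (q : nat -> R) (g : R -> R) : (forall k, 0 <= q k) ->
  bdmeas g -> (forall y, 0 <= g y) ->
  (forall g, bdmeas g -> (forall y, 0 <= g y) ->
    \sum_(t <- trees N r) gw_weight rho rho r t * g (tval c r t [::]) <= Ex (cavs r) g) ->
  \sum_(t <- trees N r.+1) gw_weight q rho r.+1 t * g (tval c r.+1 t [::]) <=
  \sum_(k < N) q k * Ex (sumlaw (cavs r) k) (g \o cav c).
Proof.
move=> q0 bg g0 IH; rewrite trees_sum_root; apply: ler_sum => k _; rewrite ler_wpM2l//.
apply: (@lists_le_sumlaw _ _ (gw_weight rho rho r) (fun t => tval c r t [::]) _ _ _ IH k (g \o cav c)) => //.
- by move=> t; exact: gw_weight_ge0.
- by move=> t; exact: tval_bounds.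
- exact: bdmeas_cav.
- by move=> y /=.
Qed.

Lemma trees_le_cavseq N r (g : R -> R) : bdmeas g -> (forall y, 0 <= g y) ->
  \sum_(t <- trees N r) gw_weight rho rho r t * g (tval c r t [::]) <= Ex (cavs r) g.
Proof.
elim: r g => [|r IH] g bg g0.
  by rewrite /= big_seq1 gw_weight_height0 mul1r Ex_dirac.
apply: le_trans (trees_le_root rho0 bg g0 IH) _.
have C := @Ex_cavlaw R rho rho0 rho1 c c0 (cavs r) g bg.
rewrite -[cavs r.+1]/(cavlaw rho0 rho1 c0 (cavs r)) -(cvg_lim _ C)//.
apply: (nondecreasing_cvgn_le (u_ := fun n => \sum_(k < n) rho k * Ex (sumlaw (cavs r) k) (g \o cav c))).
  apply/nondecreasing_seqP => i; rewrite big_ord_recr/= lerDl mulr_ge0//.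
  by apply: Ex_ge0 => y /=.
by apply/cvg_ex; eexists; exact: C.
Qed.

Definition tmass (q : nat -> R) N r : R := \sum_(t <- trees N r) gw_weight q rho r t.

Lemma tmass_rec q N r : tmass q N r.+1 = \sum_(k < N) q k * tmass rho N r ^+ k.
Proof.
rewrite /tmass; have := @trees_sum_root N r q (fun=> 1).
under eq_bigr do rewrite mulr1; move=> ->; apply: eq_bigr => k _; congr (_ * _).
by under eq_bigr do rewrite mulr1; rewrite lists_prod_sum.
Qed.

Lemma tmass_bounds N r : 0 <= tmass rho N r <= 1.
Proof.
apply/andP; split; first by apply: sumr_ge0 => t _; exact: gw_weight_ge0.
have := @trees_le_cavseq N r (fun=> 1) (bdmeas_cst 1) (fun=> ler01).
by rewrite Ex_cst; apply: le_trans; rewrite le_eqVlt; apply/orP; left; apply/eqP;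
  apply: eq_bigr => t _; rewrite mulr1.
Qed.

Lemma tmass_cvg r : (fun N => tmass rho N r) @ \oo --> (1 : R).
Proof.
elim: r => [|r IH].
  rewrite (_ : (fun N => _) = (fun=> 1)); first exact: cvg_cst.
  by apply/funext => N; rewrite /tmass /= big_seq1 gw_weight_height0.
under eq_fun do rewrite tmass_rec.
by apply: mix_pow_cvg => // n; exact: tmass_bounds.
Qed.

Lemma tmass_root_cvg r : (fun N => tmass P N r.+1) @ \oo --> (1 : R).
Proof.
under eq_fun do rewrite tmass_rec.
by apply: mix_pow_cvg => // [n|]; [exact: tmass_bounds | exact: tmass_cvg].
Qed.

Lemma EYc_mix_le (g : R -> R) (l : R) N r : (forall y, 0 <= g y) ->
  (fun n => \sum_(k < n) P k * Ex (sumlaw (cavs r) k) g) @ \oo --> l ->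
  \sum_(k < N) P k * Ex (sumlaw (cavs r) k) g <= l.
Proof.
move=> g0 C; rewrite -(cvg_lim _ C)//.
apply: (nondecreasing_cvgn_le (u_ := fun n => \sum_(k < n) P k * Ex (sumlaw (cavs r) k) g)).
  by apply/nondecreasing_seqP => i; rewrite big_ord_recr/= lerDl mulr_ge0// Ex_ge0.
by apply/cvg_ex; exists l.
Qed.

Lemma trees_EYc N r :
  \sum_(t <- trees N r.+1) gw_weight P rho r.+1 t * tval c r.+1 t [::] <= EYc P c (cavs r) /\
  \sum_(t <- trees N r.+1) gw_weight P rho r.+1 t * (1 - tval c r.+1 t [::]) <= 1 - EYc P c (cavs r).
Proof.
have bc := blip_bdmeas (@blip_clip01 R).
have b1c : bdmeas (fun y : R => 1 - clip01 y) by apply: bdmeasB => //; exact: bdmeas_cst.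
have clipE t : clip01 (tval c r.+1 t [::]) = tval c r.+1 t [::].
  by rewrite clip01_id// tval_bounds.
have clipcav : clip01 \o cav c = cav c.
  by apply/funext => s /=; rewrite clip01_id// cav_bounds.
have C := EYc_cvg P0 P1 c0 (mu := cavs r).
split.
- have := @trees_le_root N r P clip01 P0 bc clip01_ge0 (@trees_le_cavseq N r).
  under eq_bigr do rewrite clipE; move/le_trans; apply.
  by rewrite clipcav; apply: EYc_mix_le => //; move=> y; exact: cav_ge0.
- have := @trees_le_root N r P (fun y => 1 - clip01 y) P0 b1c
    (fun y => ltac:(by rewrite subr_ge0 clip01_le1)) (@trees_le_cavseq N r).
  under eq_bigr do rewrite clipE; move/le_trans; apply.
  apply: EYc_mix_le; first by move=> y /=; rewrite subr_ge0 clip01_le1.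
  rewrite (_ : (fun n => _) = (fun n => \sum_(k < n) P k - \sum_(k < n) P k * Ex (sumlaw (cavs r) k) (cav c))).
    by apply: cvgB.
  apply/funext => n; rewrite -sumrB; apply: eq_bigr => k _.
  rewrite -[X in X - _]mulr1 -mulrBr; congr (_ * _).
  rewrite -[X in _ = X - _](Ex_cst (sumlaw (cavs r) k)) -ExB; last 2 first.
  + exact: bdmeas_cst.
  + exact/blip_bdmeas/blip_cav.
  by congr Ex; apply/funext => s /=; rewrite clip01_id// cav_bounds.
Qed.

(** The two sums add up to the mass of [trees N r.+1], which tends to 1; so the upper bound on each
    yields the lower bound on the other. *)
Lemma trees_approx r (e : R) : 0 < e -> exists N,
  EYc P c (cavs r) - e <= \sum_(t <- trees N r.+1) gw_weight P rho r.+1 t * tval c r.+1 t [::] /\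
  1 - EYc P c (cavs r) - e <= \sum_(t <- trees N r.+1) gw_weight P rho r.+1 t * (1 - tval c r.+1 t [::]).
Proof.
move=> e0; have /cvgrPdist_le/(_ _ e0)[N _ /(_ N (leqnn N))] := tmass_root_cvg r.
rewrite /= ler_norml => /andP[_ H].
have [H1 H2] := trees_EYc N r; exists N.
have E : tmass P N r.+1 = \sum_(t <- trees N r.+1) gw_weight P rho r.+1 t * tval c r.+1 t [::] +
   \sum_(t <- trees N r.+1) gw_weight P rho r.+1 t * (1 - tval c r.+1 t [::]).
  by rewrite -big_split; apply: eq_bigr => t _ /=; ring.
by split; lra.
Qed.

End tree_sums.

Lemma rooted_iso_refl (A : Type) (VA : A -> Prop) adjA ra : rooted_iso VA adjA ra VA adjA ra.
Proof. by exists id; split => // a Va; exists a. Qed.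

Lemma rooted_iso_sym (A : choiceType) (B : Type) (VA : A -> Prop) adjA ra (VB : B -> Prop) adjB rb :
  VA ra -> rooted_iso VA adjA ra VB adjB rb -> rooted_iso VB adjB rb VA adjA ra.
Proof.
move=> Vra [f [f1 f2 f3 f4 f5]].
pose g b := xget ra [set a | VA a /\ f a = b].
have gP b : VB b -> VA (g b) /\ f (g b) = b.
  by move=> /f3[a Va fa]; rewrite /g; case: xgetP => [_ _ //|/(_ a)/=[]].
have gf a : VA a -> g (f a) = a.
  by move=> Va; have [Vg fg] := gP _ (f1 _ Va); apply: f2.
exists g; split.
- by move=> b /gP[].
- by move=> b b' /gP[_ E] /gP[_ E'] H; rewrite -E -E' H.
- by move=> a Va; exists (f a); [exact: f1 | exact: gf].
- by rewrite -f4 gf.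
- by move=> b b' /gP[V E] /gP[V' E']; rewrite f5// E E'.
Qed.

Lemma rooted_iso_trans (A B C : Type) (VA : A -> Prop) adjA ra (VB : B -> Prop) adjB rb
    (VC : C -> Prop) adjC rc :
  rooted_iso VA adjA ra VB adjB rb -> rooted_iso VB adjB rb VC adjC rc ->
  rooted_iso VA adjA ra VC adjC rc.
Proof.
move=> [f [f1 f2 f3 f4 f5]] [g [g1 g2 g3 g4 g5]]; exists (g \o f); split => /=.
- by move=> a /f1/g1.
- by move=> a a' Va Va' /g2 E; apply: f2 => //; apply: E; exact: f1.
- by move=> c /g3[b /f3[a Va <-] <-]; exists a.
- by rewrite f4.
- by move=> a a' Va Va'; rewrite f5// g5//; exact: f1.
Qed.

(** * From local frequencies to averages over vertices *)

Section local_frequencies.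
Context {R : realType}.
Variables (P rho : nat -> R).
Implicit Types (t s T : {fset word}).

Definition tiso t s : bool :=
  `[< rooted_iso (fun w => w \in t) tadj [::] (fun w => w \in s) tadj [::] >].

Lemma tisoxx t : tiso t t.
Proof. exact/asboolP/rooted_iso_refl. Qed.

Lemma tiso_sym t s : is_ptree t -> tiso t s -> tiso s t.
Proof. by move=> [rt _] /asboolP H; apply/asboolP; exact: rooted_iso_sym H. Qed.

Lemma tiso_trans t s u : tiso t s -> tiso s u -> tiso t u.
Proof. by move=> /asboolP ts /asboolP su; apply/asboolP; exact: rooted_iso_trans su. Qed.

(** The first tree of [L] isomorphic to [t]. Frequencies count unlabelled trees whereas [L] lists
    plane ones, so one representative per class prevents counting a vertex twice. *)
Definition rep (L : seq {fset word}) t := nth t L (find (tiso t) L).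

Lemma rep_iso L t : t \in L -> rep L t \in L /\ tiso t (rep L t).
Proof.
move=> tL; have h : has (tiso t) L by apply/hasP; exists t => //; exact: tisoxx.
by split; [rewrite mem_nth -?has_find | exact: nth_find].
Qed.

Lemma rep_eq L t s : is_ptree t -> is_ptree s -> t \in L -> tiso t s -> rep L t = rep L s.
Proof.
move=> pt ps tL ts; have st := tiso_sym pt ts.
have E : tiso t =1 tiso s.
  by move=> u; apply/idP/idP => H; [exact: tiso_trans H | exact: tiso_trans H].
rewrite /rep (eq_find E); apply: set_nth_default.
by rewrite -has_find; apply/hasP; exists t.
Qed.

Definition biso (G : simple_graph) r (v : 'I_(nv G)) T : bool :=
  `[< rooted_iso (fun x => x \in gball v r) (@adj G) v (fun w => w \in T) tadj [::] >].

Lemma biso_tiso (G : simple_graph) r (v : 'I_(nv G)) T T' :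
  biso r v T -> biso r v T' -> tiso T T'.
Proof.
move=> /asboolP H /asboolP H'; apply/asboolP.
apply: rooted_iso_trans H'; apply: rooted_iso_sym H.
by apply: (@gball_le _ _ 0) => //; rewrite /gball /= inE.
Qed.

Lemma gw_prob_ge r T (s : seq {fset word}) : uniq s ->
  (forall t, t \in s -> [/\ is_ptree t, height_le t r & tiso t T]) ->
  ((\sum_(t <- s) gw_weight P rho r t)%:E <= gw_prob P rho r T)%E.
Proof.
move=> us sP; apply: esum_ge; exists [set` s].
  split; first exact: finite_seq.
  by move=> t /= /sP[pt ht /asboolP tT]; split.
by rewrite -fsbig_seq// sumEFin.
Qed.

Variables (Gs : nat -> simple_graph) (r : nat).
Hypothesis conv : forall T, is_ptree T -> height_le T r ->
  (fun n => (loc_freq (Gs n) r T)%:E) @ \oo --> gw_prob P rho r T.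
Variables (phi : {fset word} -> R) (psi : forall n, 'I_(nv (Gs n)) -> R).
Hypotheses (phi0 : forall t, 0 <= phi t) (psi0 : forall n (v : 'I_(nv (Gs n))), 0 <= psi v)
  (phi_iso : forall t s, is_ptree t -> is_ptree s -> tiso t s -> phi t = phi s)
  (psi_phi : forall n (v : 'I_(nv (Gs n))) T, is_ptree T -> biso r v T -> psi v = phi T).

(** A Fatou-type bound: finitely many isomorphism classes have converging frequencies, and the
    vertices whose balls fall outside them contribute nonnegatively. *)
Lemma mean_ge_trees (L : seq {fset word}) (e : R) : uniq L ->
  (forall t, t \in L -> is_ptree t /\ height_le t r) -> 0 < e ->
  \forall n \near \oo, \sum_(t <- L) gw_weight P rho r t * phi t - e <=
     (\sum_(v : 'I_(nv (Gs n))) psi v) / (nv (Gs n))%:R.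
Proof.
move=> uL pL e0; pose reps := undup (map (rep L) L).
have repsP s : s \in reps -> [/\ s \in L, is_ptree s, height_le s r & rep L s = s].
  rewrite mem_undup => /mapP[t tL ->]; have [rL tr] := rep_iso tL.
  have [pr hr] := pL _ rL; split => //; have [pt _] := pL _ tL.
  by rewrite -(rep_eq pt pr tL tr).
have reps_iso s s' : s \in reps -> s' \in reps -> tiso s s' -> s = s'.
  move=> /repsP[sL ps _ Es] /repsP[s'L ps' _ Es'] ss'.
  by rewrite -Es -Es'; exact: rep_eq.
have reps_mem t : t \in L -> rep L t \in reps.
  by move=> tL; rewrite mem_undup; apply: map_f.
have ureps : uniq reps := undup_uniq _.
pose p s := fine (gw_prob P rho r s).
(* [gw_prob] is finite because it is a limit of frequencies, each at most 1. *)
have pE s : s \in reps -> gw_prob P rho r s = (p s)%:E.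
  move=> /repsP[_ ps hs _]; rewrite /p fineK// ge0_fin_numE.
    have C := conv ps hs; rewrite -(cvg_lim _ C)//.
    apply: (@le_lt_trans _ _ 1%E); last exact: ltry.
    apply: lime_le; first by apply/cvg_ex; eexists; exact: C.
    apply: nearW => n; rewrite lee_fin /loc_freq.
    have [N0|N0] := posnP (nv (Gs n)).
      have z : (nv (Gs n))%:R = 0 :> R by rewrite N0.
      by rewrite z invr0 mulr0.
    by rewrite ler_pdivrMr ?ltr0n// mul1r ler_nat (leq_trans (max_card _))// card_ord.
  have := @gw_prob_ge r s [::] isT; rewrite big_nil; apply => t; by rewrite inE.
pose F n := \sum_(s <- reps) loc_freq (Gs n) r s * phi s.
have CF : F @ \oo --> \sum_(s <- reps) p s * phi s.
  apply: (@cvg_sum_seq _ _ _ (fun s n => loc_freq (Gs n) r s * phi s) (fun s => p s * phi s)).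
  move=> s sr; apply: cvgM; last exact: cvg_cst.
  have [_ ps hs _] := repsP _ sr; have C := conv ps hs; rewrite pE// in C.
  by have H := fine_cvg C; exact: H.
have low1 : \sum_(t <- L) gw_weight P rho r t * phi t <= \sum_(s <- reps) p s * phi s.
  have -> : \sum_(t <- L) gw_weight P rho r t * phi t =
     \sum_(s <- reps) \sum_(t <- L | rep L t == s) gw_weight P rho r t * phi t.
    rewrite (exchange_big_dep xpredT)//= big_seq [RHS]big_seq; apply: eq_bigr => t tL.
    rewrite -big_filter (_ : [seq s <- reps | rep L t == s] = [:: rep L t]) ?big_seq1//.
    rewrite -(filter_pred1_uniq ureps (reps_mem t tL)); apply: eq_filter => s.
    by rewrite /= eq_sym.
  rewrite big_seq [leRHS]big_seq; apply: ler_sum => s sr; have [sL ps hs Es] := repsP _ sr.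
  have -> : \sum_(t <- L | rep L t == s) gw_weight P rho r t * phi t =
      (\sum_(t <- [seq t <- L | rep L t == s]) gw_weight P rho r t) * phi s.
    rewrite big_filter mulr_suml big_seq_cond [RHS]big_seq_cond.
    apply: eq_bigr => t /andP[tL /eqP ts]; congr (_ * _).
    have [pt _] := pL _ tL; have [_ ti] := rep_iso tL.
    by apply: phi_iso => //; rewrite -ts.
  rewrite ler_wpM2r// -lee_fin -pE//; apply: gw_prob_ge; first exact: filter_uniq.
  move=> t; rewrite mem_filter => /andP[/eqP ts tL]; have [pt ht] := pL _ tL.
  by split => //; rewrite -ts; case: (rep_iso tL).
(* The ball around a vertex is isomorphic to at most one representative. *)
have low2 n : F n <= (\sum_(v : 'I_(nv (Gs n))) psi v) / (nv (Gs n))%:R.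
  rewrite /F /loc_freq; under eq_bigr do rewrite mulrAC.
  rewrite -mulr_suml ler_wpM2r ?invr_ge0//.
  have cE s : #|[set v : 'I_(nv (Gs n)) | biso r v s]|%:R * phi s =
     \sum_(v : 'I_(nv (Gs n))) (biso r v s)%:R * phi s.
    rewrite -sum1_card natr_sum mulr_suml [RHS](bigID (fun v => biso r v s))/=.
    rewrite [X in _ = _ + X]big1 ?addr0; last by move=> v /negbTE ->; rewrite mul0r.
    have inb v : (v \in [set v : 'I_(nv (Gs n)) | biso r v s]) = biso r v s.
      by apply/idP/idP; rewrite inE.
    by apply: eq_big => [v|v]; [exact: inb | rewrite inb => ->].
  rewrite (eq_bigr (fun s => \sum_(v : 'I_(nv (Gs n))) (biso r v s)%:R * phi s)); last first.
    by move=> s _; exact: cE.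
  rewrite exchange_big /=; apply: ler_sum => v _.
  have [/hasP[s sr vs]|no] := boolP (has (fun s => biso r v s) reps); last first.
    rewrite big_seq big1 ?psi0// => s sr.
    by move/hasPn: no => /(_ s sr)/negbTE ->; rewrite mul0r.
  rewrite (bigD1_seq s)//= vs mul1r big_seq_cond big1 ?addr0; last first.
    move=> s' /andP[s'r ne]; case: (boolP (biso r v s')) => [vs'|]; last by rewrite mul0r.
    by case/eqP: ne; apply: reps_iso => //; exact: biso_tiso vs' vs.
  by have [_ ps _ _] := repsP _ sr; rewrite (psi_phi ps vs).
have /cvgrPdist_le/(_ _ e0) := CF; apply: filterS => n; rewrite ler_norml => /andP[_ H].
by apply: le_trans (low2 n); lra.
Qed.

End local_frequencies.

(** * Convergence of the mean monomer probability *)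

Section convergence.
Context {R : realType}.
Variables (P rho : nat -> R) (Pbar : R).
Hypotheses (P0 : forall k, 0 <= P k)
  (P1 : (fun n => \sum_(k < n) P k) @ \oo --> (1 : R))
  (PbarE : (fun n => \sum_(k < n) k%:R * P k) @ \oo --> Pbar)
  (Pbar0 : 0 < Pbar)
  (rhoE : forall k, rho k = k.+1%:R * P k.+1 / Pbar).
Variables (x : R) (x0 : 0 < x).
Let c0 : 0 < x ^+ 2 := exprn_gt0 2 x0.
Local Notation cavs := (cavseq P0 PbarE Pbar0 rhoE c0).

Variable Gs : nat -> simple_graph.
Hypothesis conv : forall r (T : {fset word}), is_ptree T -> height_le T r ->
  (fun n => (loc_freq (Gs n) r T)%:E) @ \oo --> gw_prob P rho r T.

(** At depth 0 the one-vertex tree has weight 1, so the average of the constant 1 is eventually at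
    least 1/2; over an empty graph it would be 0. *)
Lemma near_nonempty : \forall n \near \oo, (0 < nv (Gs n))%N.
Proof.
have H := @mean_ge_trees R P rho Gs 0 (conv (r := 0)) (fun=> 1) (fun _ _ => 1)
  (fun=> ler01) (fun _ _ => ler01) (fun _ _ _ _ _ => erefl) (fun _ _ _ _ _ => erefl)
  (trees 0 0) 2^-1 (uniq_trees 0 0) (fun t => @trees_ptree 0 0 t) (ltac:(by rewrite invr_gt0)).
apply: filterS H => n; rewrite /= big_seq1 gw_weight_height0 mulr1 => H.
rewrite lt0n; apply/eqP => N0; move: H.
have -> : (nv (Gs n))%:R = 0 :> R by rewrite N0.
by rewrite invr0 mulr0; lra.
Qed.

Lemma saw_mean_ge r (e : R) : 0 < e ->
  \forall n \near \oo, EYc P (x ^+ 2) (cavs r) - e <=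
    (\sum_(v : 'I_(nv (Gs n))) saw (x ^+ 2) nbG r.+1 [::] v) / (nv (Gs n))%:R.
Proof.
move=> e0; have e2 : 0 < e / 2 by rewrite divr_gt0.
have [N [H _]] := trees_approx P0 P1 PbarE Pbar0 rhoE c0 r e2.
pose phi t : R := tval (x ^+ 2) r.+1 t [::].
pose psi n (v : 'I_(nv (Gs n))) : R := saw (x ^+ 2) nbG r.+1 [::] v.
have h1 t : 0 <= phi t by rewrite /phi ; case/andP: (tval_bounds r.+1 t [::] c0).
have h2 n (v : 'I_(nv (Gs n))) : 0 <= psi n v.
  by rewrite /psi ; case/andP: (saw_bounds nbG r.+1 [::] v c0).
have h3 t s : is_ptree t -> is_ptree s -> tiso t s -> phi t = phi s.
  by move=> pt ps /asboolP ts; exact: tval_iso.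
have h4 n (v : 'I_(nv (Gs n))) T : is_ptree T -> biso r.+1 v T -> psi n v = phi T.
  by move=> pT /asboolP vT; exact: saw_ball.
have := mean_ge_trees (conv (r := r.+1)) h1 h2 h3 h4 (uniq_trees N r.+1) (@trees_ptree N r.+1) e2.
by apply: filterS => n; apply: le_trans; lra.
Qed.

Lemma saw_mean_le r (e : R) : 0 < e ->
  \forall n \near \oo, 1 - EYc P (x ^+ 2) (cavs r) - e <=
    (\sum_(v : 'I_(nv (Gs n))) (1 - saw (x ^+ 2) nbG r.+1 [::] v)) / (nv (Gs n))%:R.
Proof.
move=> e0; have e2 : 0 < e / 2 by rewrite divr_gt0.
have [N [_ H]] := trees_approx P0 P1 PbarE Pbar0 rhoE c0 r e2.
pose phi t : R := 1 - tval (x ^+ 2) r.+1 t [::].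
pose psi n (v : 'I_(nv (Gs n))) : R := 1 - saw (x ^+ 2) nbG r.+1 [::] v.
have h1 t : 0 <= phi t by rewrite /phi subr_ge0; case/andP: (tval_bounds r.+1 t [::] c0).
have h2 n (v : 'I_(nv (Gs n))) : 0 <= psi n v.
  by rewrite /psi subr_ge0; case/andP: (saw_bounds nbG r.+1 [::] v c0).
have h3 t s : is_ptree t -> is_ptree s -> tiso t s -> phi t = phi s.
  by move=> pt ps /asboolP ts; congr (1 - _); exact: tval_iso.
have h4 n (v : 'I_(nv (Gs n))) T : is_ptree T -> biso r.+1 v T -> psi n v = phi T.
  by move=> pT /asboolP vT; congr (1 - _); exact: saw_ball.
have := mean_ge_trees (conv (r := r.+1)) h1 h2 h3 h4 (uniq_trees N r.+1) (@trees_ptree N r.+1) e2.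
by apply: filterS => n; apply: le_trans; lra.
Qed.

Lemma mean_R_cvg (l : R) :
  (forall j, EYc P (x ^+ 2) (cavs j.*2) <= l <= EYc P (x ^+ 2) (cavs j.*2.+1)) ->
  (fun n => mean_R (Gs n) x) @ \oo --> l.
Proof.
move=> lj; apply/cvgrPdist_le => e e0; have e2 : 0 < e / 2 by rewrite divr_gt0.
have /cvgrPdist_le/(_ _ e2)[j _ /(_ j (leqnn j))] := EYc_step_cvg0 P0 P1 PbarE Pbar0 rhoE c0.
rewrite /= sub0r normrN => gap.
have {}gap := le_trans (ler_norm _) gap.
have /andP[l1 l2] := lj j.
have H0 := near_nonempty; have H1 := saw_mean_ge j.*2 e2; have H2 := saw_mean_le j.*2.+1 e2.
near=> n.
have N0 : (0 < nv (Gs n))%N by near: n.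
have N0' : 0 < (nv (Gs n))%:R :> R by rewrite ltr0n.
(* The root adds one level: messages of even depth [2j] give walks of odd depth [2j+1], hence a
   lower bound. *)
have L1 : EYc P (x ^+ 2) (cavs j.*2) - e / 2 <= mean_R (Gs n) x.
  apply: (@le_trans _ _ ((\sum_(v : 'I_(nv (Gs n))) saw (x ^+ 2) nbG j.*2.+1 [::] v) / (nv (Gs n))%:R)).
    by near: n.
  rewrite /mean_R ler_wpM2r ?invr_ge0//; apply: ler_sum => v _; rewrite mdR_Rsub.
  by have := saw_sandwich j.*2.+1 (p := [::]) (o := v) x0 isT; rewrite /= odd_double.
have L2 : mean_R (Gs n) x <= EYc P (x ^+ 2) (cavs j.*2.+1) + e / 2.
  have : 1 - EYc P (x ^+ 2) (cavs j.*2.+1) - e / 2 <= 1 - mean_R (Gs n) x; last by lra.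
  apply: (@le_trans _ _ ((\sum_(v : 'I_(nv (Gs n))) (1 - saw (x ^+ 2) nbG j.*2.+2 [::] v)) / (nv (Gs n))%:R)).
    by near: n.
  have -> : 1 - mean_R (Gs n) x = (\sum_(v : 'I_(nv (Gs n))) (1 - mdR (Gs n) x v)) / (nv (Gs n))%:R.
    rewrite sumrB mulrBl sumr_const card_ord -mulr_natr mul1r divff ?gt_eqF//.
  rewrite ler_wpM2r ?invr_ge0//; apply: ler_sum => v _; rewrite mdR_Rsub lerD2l lerN2.
  by have := saw_sandwich j.*2.+2 (p := [::]) (o := v) x0 isT; rewrite /= odd_double.
rewrite ler_norml; apply/andP; split; lra.
Unshelve. all: by end_near. Qed.

End convergence.

Theorem theorem4p7 (R : realType) (d : measure_display) (Omega : measurableType d)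
  (Pr : probability Omega R) (G : nat -> Omega -> simple_graph) (P rho : nat -> R) :
  (* P is a probability distribution on nat *)
  (forall k, 0 <= P k) ->
  (fun n => \sum_(k < n) P k) @ \oo --> (1 : R) ->
  (* 0 < Pbar < oo *)
  cvg ((fun n => \sum_(k < n) k%:R * P k) @ \oo) ->
  0 < limn (fun n => \sum_(k < n) k%:R * P k) ->
  (* unimodularity: rho_k = (k+1) P_{k+1} / Pbar *)
  (forall k, rho k = k.+1%:R * P k.+1 / limn (fun n => \sum_(i < n) i%:R * P i)) ->
  (* finite second moment *)
  cvg ((fun n => \sum_(k < n) (k ^ 2)%:R * P k) @ \oo) ->
  (* almost sure local convergence of G_n to T(P, rho) *)
  (forall (r : nat) (T : {fset word}), is_ptree T -> height_le T r ->
     {ae Pr, forall w : Omega,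
        (fun n => (loc_freq (G n w) r T)%:E) @ \oo --> gw_prob P rho r T}) ->
  exists mu : R -> probability R R,
    [/\ (* mu x is the unique [0,1]-supported solution of the RDE *)
        forall x, 0 < x ->
          is_rde_sol rho x (mu x) /\
          (forall nu : probability R R, is_rde_sol rho x nu ->
             forall A, measurable A -> nu A = mu x A),
        (* x |-> E[Y(x)] is analytic on (0, oo) *)
        real_analytic_on [set x : R | 0 < x] (fun x => fine (EY P x (mu x))),
        (* eps_{G_n}(x) = x d/dx (log Z_{G_n}(x) / |V_n|) = (1/|V_n|) sum_v R_x(G_n, v) *)
        forall n (w : Omega) (x : R), 0 < x ->
          x * derive1 (fun y => ln (mdZ (G n w) y) / (nv (G n w))%:R) x = mean_R (G n w) x &
        (* almost surely, for all x > 0, eps_{G_n}(x) -> E[Y(x)] *)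
        {ae Pr, forall w : Omega, forall x : R, 0 < x ->
           (fun n => (mean_R (G n w) x)%:E) @ \oo --> EY P x (mu x)}].
Proof.
move=> P0 P1 cPbar Pbar0 rhoE _ loc.
set Pbar := limn _ in Pbar0 rhoE.
have PbarE : (fun n => \sum_(k < n) k%:R * P k) @ \oo --> Pbar by exact: cPbar.
pose sol (x : R) (m : probability R R) := forall x0 : 0 < x, [/\ supp01 m,
    forall A, measurable A -> m A = rde_rhs rho x m A,
    forall nu : probability R R, is_rde_sol rho x nu ->
       forall A, measurable A -> nu A = m A,
    EY P x m = (EYc P (x ^+ 2) m)%:E &
    forall j, EYc P (x ^+ 2) (cavseq P0 PbarE Pbar0 rhoE (exprn_gt0 2 x0) j.*2) <= EYc P (x ^+ 2) m
       <= EYc P (x ^+ 2) (cavseq P0 PbarE Pbar0 rhoE (exprn_gt0 2 x0) j.*2.+1)].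
have /choice[mu muP] : forall x, exists m, sol x m.
  (* For nonpositive [x] any law will do, as [sol] is then vacuous; [\d_0] makes [mu] total. *)
  move=> x; have [x0|nx] := pselect (0 < x); last by exists (\d_(0 : R)) => x0.
  have [m [sm fm um bm]] := cavity_law P0 P1 PbarE Pbar0 rhoE (exprn_gt0 2 x0).
  exists m => x0'; rewrite (bool_irrelevance x0' x0).
  have rdeE nu A : supp01 nu -> measurable A -> rde_rhs rho x nu A = _ :=
    @rde_rhs_cavlaw R rho (rho_ge0 P0 Pbar0 rhoE) (rho_sum1 PbarE Pbar0 rhoE) _ (exprn_gt0 2 x0) x nu A erefl.
  split => //.
  - by move=> A mA; rewrite rdeE// -fm.
  - by move=> nu [snu fnu]; apply: um => // A mA; rewrite fnu// rdeE.
  - exact: (EY_EYc P0 P1 (exprn_gt0 2 x0)).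
pose good w := forall r (T : {fset word}), is_ptree T -> height_le T r ->
  (fun n => (loc_freq (G n w) r T)%:E) @ \oo --> gw_prob P rho r T.
have ae_good : {ae Pr, forall w, good w}.
  (* The pairs of a depth and a finite tree are countable, so their null sets have a null union,
     which does not involve [x]. *)
  pose Q (i : nat) w := if @choice.unpickle (nat * {fset word})%type i is Some (r, T) then
    is_ptree T -> height_le T r -> (fun n => (loc_freq (G n w) r T)%:E) @ \oo --> gw_prob P rho r T
    else True.
  have aeQ i : {ae Pr, forall w, Q i w}.
    rewrite /Q; case: (choice.unpickle i) => [[r T]|]; last exact: aeW.
    have [pT|nT] := pselect (is_ptree T); last by apply: aeW => w /nT.
    have [hT|nT] := pselect (height_le T r); last by apply: aeW => w _ /nT.
    by have := loc r T pT hT; apply: filterS => w H _ _.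
  have := ae_foralln aeQ; apply: filterS => w Qw r T.
  by have := Qw (choice.pickle (r, T)); rewrite /Q choice.pickleK.
have cvg_good w (x : R) : good w -> 0 < x ->
    (fun n => mean_R (G n w) x) @ \oo --> EYc P (x ^+ 2) (mu x).
  by move=> gw x0; have [_ _ _ _ bm] := muP x x0; apply: mean_R_cvg bm.
(* [E[Y]] is deterministic, so its expansion can be read off from one realisation where convergence
   holds for all [x]. *)
have [w0 gw0] : exists w0, good w0.
  have [B [mB B0 sB]] := ae_good; apply/not_existsP => no.
  have BT : B = setT by apply/seteqP; split => // w _; apply: sB => /= /no.
  have := probability_setT Pr; rewrite -BT B0 => /eqP.
  by rewrite eqe eq_sym oner_eq0.
exists mu; split.
- move=> x x0; have [sm fm um _ _] := muP x x0; split => //; split => //.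
- move=> a /= a0; exists a => //.
  have [cc ccP] := choice (fun k => mean_R_series (G k w0) a0).
  exists (fun n => limn (fun k => cc k n)) => y ya.
  have gl h : `|h| < a -> (fun k => mean_R (G k w0) (a + h)) @ \oo --> EYc P ((a + h) ^+ 2) (mu (a + h)).
    by move=> ha; apply: cvg_good => //; move: ha; rewrite ltr_norml => /andP[]; lra.
  have H := limit_series a0 ccP gl ya.
  have y0 : 0 < y by move: ya; rewrite ltr_norml => /andP[]; lra.
  have [_ _ _ -> _] := muP y y0.
  by rewrite [a + _]addrC subrK in H; exact: H.
- by move=> n w x x0; exact: derive_ln_mdZ.
- apply: filterS ae_good => w gw x x0; have [_ _ _ -> _] := muP x x0.
  by apply/cvg_EFin; [exact: nearW | exact: cvg_good].
Qed.
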